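(* Consider the Gaussian Y-channel described in the context, with channel gains satisfying $h_1^2\ge h_2^2\ge h_3^2$ and power constraint $P$. Let $\vec R=(R_{12},R_{13},R_{21},R_{23},R_{31},R_{32})$ be a rate tuple. Suppose there exist nonnegative numbers (rate splits) $R_{ij}^b,R_{ij}^c,R_{ij}^u$ for all ordered pairs $(i,j)$ of distinct indices in $\{1,2,3\}$ with $R_{ij}=R_{ij}^b+R_{ij}^c+R_{ij}^u$, and $$R_{12}^b=R_{21}^b,\quad R_{13}^b=R_{31}^b,\quad R_{23}^b=R_{32}^b,\quad R_{12}^c=R_{23}^c=R_{31}^c=:R_{123}^c,\quad R_{13}^c=R_{32}^c=R_{21}^c=:R_{132}^c,$$ together with nonnegative user powers $P_{ij}^b,P_{ij}^c,P_{ij}^u$ (all ordered pairs $(i,j)$), $\tilde P_{23}^c,\tilde P_{13}^c$, and nonnegative relay powers $P_{r,ij}^u$ (all six ordered pairs), $P_{r,12}^c,P_{r,31}^c,P_{r,21}^c,P_{r,32}^c$, $P_{r,21}^b,P_{r,31}^b,P_{r,32}^b$, satisfying: (Alignment) $h_1^2P_{12}^b=h_2^2P_{21}^b$, $h_1^2P_{13}^b=h_3^2P_{31}^b$, $h_2^2P_{23}^b=h_3^2P_{32}^b$, $h_1^2P_{12}^c=h_2^2P_{23}^c$, $h_2^2\tilde P_{23}^c=h_3^2P_{31}^c$, $h_1^2P_{13}^c=h_3^2P_{32}^c$, $h_1^2\tilde P_{13}^c=h_2^2P_{21}^c$. (User power) $P_1:=P_{12}^b+P_{13}^b+P_{12}^c+P_{13}^c+\tilde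 P_{13}^c+P_{12}^u+P_{13}^u\le P$, $P_2:=P_{21}^b+P_{23}^b+P_{21}^c+P_{23}^c+\tilde P_{23}^c+P_{21}^u+P_{23}^u\le P$, $P_3:=P_{31}^b+P_{32}^b+P_{31}^c+P_{32}^c+P_{31}^u+P_{32}^u\le P$. (Relay power) the sum of all the relay powers listed above is at most $P$. (Uplink rate constraints) with $\sigma^2=1+h_3^2(2P_{31}^b+2P_{32}^b+2P_{31}^c+2P_{32}^c+P_{31}^u+P_{32}^u)$: $R_{12}^u\le C\!\left(\frac{h_1^2P_{12}^u}{1+h_3^2P_3+h_2^2P_2+h_1^2(P-P_{12}^u)}\right)$, $R_{13}^u\le C\!\left(\frac{h_1^2P_{13}^u}{1+h_3^2P_3+h_2^2P_2+h_1^2(P-P_{12}^u-P_{13}^u)}\right)$, $R_{21}^u\le C\!\left(\frac{h_2^2P_{21}^u}{1+h_3^2P_3+h_2^2(P_2-P_{21}^u)+h_1^2(P-P_{12}^u-P_{13}^u)}\right)$, $R_{23}^u\le C\!\left(\frac{h_2^2P_{23}^u}{1+h_3^2P_3+h_2^2(P_2-P_{21}^u-P_{23}^u)+h_1^2(P-P_{12}^u-P_{13}^u)}\right)$, $R_{132}^c\le C^+\!\left(\frac{h_2^2P_{21}^c}{\sigma^2+2h_2^2(P_{21}^b+P_{23}^c)}-\frac12\right)$, $R_{123}^c\le C^+\!\left(\frac{h_2^2P_{23}^c}{\sigma^2+2h_2^2P_{21}^b}-\frac12\right)$, $R_{21}^b\le C^+\!\left(\frac{h_2^2P_{21}^b}{\sigma^2}-\frac12\right)$,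 $R_{31}^u\le C\!\left(\frac{h_3^2P_{31}^u}{1+h_3^2(2P_{32}^b+2P_{31}^b+2P_{31}^c+2P_{32}^c+P_{32}^u)}\right)$, $R_{32}^u\le C\!\left(\frac{h_3^2P_{32}^u}{1+2h_3^2(P_{32}^b+P_{31}^b+P_{31}^c+P_{32}^c)}\right)$, $R_{132}^c\le C^+\!\left(\frac{h_3^2P_{32}^c}{1+2h_3^2(P_{32}^b+P_{31}^b+P_{31}^c)}-\frac12\right)$, $R_{123}^c\le C^+\!\left(\frac{h_3^2P_{31}^c}{1+2h_3^2(P_{32}^b+P_{31}^b)}-\frac12\right)$, $R_{31}^b\le C^+\!\left(\frac{h_3^2P_{31}^b}{1+2h_3^2P_{32}^b}-\frac12\right)$, $R_{32}^b\le C^+\!\left(h_3^2P_{32}^b-\frac12\right)$. (Downlink rate constraints) with $\sigma_{r1}^2=1+h_3^2(P_{r,12}^u+P_{r,32}^u+P_{r,12}^c+P_{r,21}^c+P_{r,21}^b+P_{r,21}^u+P_{r,31}^u)$ and $\sigma_{r2}^2=1+h_2^2(P_{r,21}^u+P_{r,31}^u)$: $R_{13}^u\le C\!\left(\frac{h_3^2P_{r,13}^u}{\sigma_{r1}^2+h_3^2(P_{r,23}^u+P_{r,32}^c+P_{r,31}^c+P_{r,31}^b+P_{r,32}^b)}\right)$, $R_{23}^u\le C\!\left(\frac{h_3^2P_{r,23}^u}{\sigma_{r1}^2+h_3^2(P_{r,32}^c+P_{r,31}^c+P_{r,31}^b+P_{r,32}^b)}\right)$, $R_{132}^c\le C\!\left(\frac{h_3^2P_{r,32}^c}{\sigma_{r1}^2+h_3^2(P_{r,31}^c+P_{r,31}^b+P_{r,32}^b)}\right)$,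 $R_{123}^c\le C\!\left(\frac{h_3^2P_{r,31}^c}{\sigma_{r1}^2+h_3^2(P_{r,31}^b+P_{r,32}^b)}\right)$, $R_{31}^b\le C\!\left(\frac{h_3^2P_{r,31}^b}{\sigma_{r1}^2+h_3^2P_{r,32}^b}\right)$, $R_{32}^b\le C\!\left(\frac{h_3^2P_{r,32}^b}{\sigma_{r1}^2}\right)$, $R_{12}^u\le C\!\left(\frac{h_2^2P_{r,12}^u}{\sigma_{r2}^2+h_2^2(P_{r,32}^u+P_{r,12}^c+P_{r,21}^c+P_{r,21}^b)}\right)$, $R_{32}^u\le C\!\left(\frac{h_2^2P_{r,32}^u}{\sigma_{r2}^2+h_2^2(P_{r,12}^c+P_{r,21}^c+P_{r,21}^b)}\right)$, $R_{123}^c\le C\!\left(\frac{h_2^2P_{r,12}^c}{\sigma_{r2}^2+h_2^2(P_{r,21}^c+P_{r,21}^b)}\right)$, $R_{132}^c\le C\!\left(\frac{h_2^2P_{r,21}^c}{\sigma_{r2}^2+h_2^2P_{r,21}^b}\right)$, $R_{21}^b\le C\!\left(\frac{h_2^2P_{r,21}^b}{\sigma_{r2}^2}\right)$, $R_{21}^u\le C\!\left(\frac{h_1^2P_{r,21}^u}{1+h_1^2P_{r,31}^u}\right)$, $R_{31}^u\le C(h_1^2P_{r,31}^u)$. Then $\vec R$ is achievable, i.e., it lies in the capacity region $\mathcal C_g$ of the Gaussian Y-channel. (Equivalently, the union over all such power allocations of the region of rate tuples satisfying these constraints is an inner bound on $\mathcal C_g$.)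
   Context: The Gaussian Y-channel consists of three users $U_1,U_2,U_3$ and a relay. Each user $U_i$ has an independent message $m_{ij}$ of rate $R_{ij}$ for each other user $U_j$ ($i\ne j$, $i,j\in\{1,2,3\}$), uniformly distributed. All communication goes via the relay (users do not hear each other directly). All signals are real-valued. At time $i$ the relay receives $y_{ri}=h_1x_{1i}+h_2x_{2i}+h_3x_{3i}+z_{ri}$, and user $j$ receives $y_{ji}=h_jx_{ri}+z_{ji}$, where $h_1,h_2,h_3\in\mathbb R$ are fixed constant channel gains (reciprocal for uplink and downlink), $x_{ri}$ is the relay's transmit symbol, and the noises $z_{ri},z_{ji}$ are i.i.d. $\mathcal N(0,1)$, independent of each other and of the messages. All nodes (users and relay) have average power constraint $P$ over a block of length $n$: $\frac1n\sum_{i=1}^n\mathbb E[X_{ki}^2]\le P$. The relay's transmit symbol at time $i$ may depend causally on its past received symbols; each user's transmit symbol at time $i$ may depend on its own messages and its past received symbols. Each user decodes its two intended messages from its received sequence and its own messages. A rate tuple is achievable if there exist codes of length $n$ with these rates whose probability of decoding error tends to $0$ as $n\to\infty$; the capacity region $\mathcal C_g$ is the closure of the set of achievable tuples. Notation: $C(x)=\frac12\log_2(1+x)$ and $C^+(x)=\max\{0,C(x)\}$. *)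

(* Defs.v *)
From HB Require Import structures.
From mathcomp Require Import all_boot all_order all_algebra.
From mathcomp Require Import all_classical all_reals all_analysis.
Unset Printing Implicit Defensive.
Import Order.TTheory GRing.Theory Num.Theory.
Local Open Scope classical_set_scope.
Local Open Scope ring_scope.

Section YChannel.
Context {R : realType}.

Definition log2 (x : R) : R := ln x / ln 2.
Definition Ccap (x : R) : R := 2^-1 * log2 (1 + x).
Definition Cplus (x : R) : R := Num.max 0 (Ccap x).

(** Users U1,U2,U3 are 'I_3 (index 0 <-> U1, 1 <-> U2, 2 <-> U3).
    Nodes: [Some i] = user i, [None] = relay. *)
Definition node := option 'I_3.

(** ordered pairs (i,j) of distinct users: message m_ij goes from i to j *)
Definition pair3 := {p : 'I_3 * 'I_3 | p.1 != p.2}.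

Definition gains (h1 h2 h3 : R) (i : 'I_3) : R :=
  match val i with 0 => h1 | 1 => h2 | _ => h3 end.

(** rate tuple (R12,R13,R21,R23,R31,R32) as a function of (i,j);
    the diagonal is irrelevant (never used). *)
Definition rates6 (r12 r13 r21 r23 r31 r32 : R) (i j : 'I_3) : R :=
  match val i, val j with
  | 0, 1 => r12 | 0, 2 => r13 | 1, 0 => r21
  | 1, 2 => r23 | 2, 0 => r31 | 2, 1 => r32 | _, _ => 0 end.

Definition Msg (M : pair3 -> nat) := {dffun forall p : pair3, 'I_(M p)}.

(** A code of block length n: message set sizes, user encoders, relay
    encoder, user decoders.  Causality / information constraints are
    imposed separately in [ycode_wf]. *)
Record ycode (n : nat) := YCode {
  msz : pair3 -> nat;
  uenc : 'I_3 -> nat -> Msg msz -> (nat -> R) -> R;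
    (* uenc i t w y = x_{i,t} given messages w and received sequence y *)
  renc : nat -> (nat -> R) -> R;
    (* renc t y = x_{r,t} given relay received sequence y *)
  udec : 'I_3 -> Msg msz -> (nat -> R) -> Msg msz
    (* udec j w y = estimates (components p with p.2 = j are used) *)
}.
Arguments msz {_} _.
Arguments uenc {_} _.
Arguments renc {_} _.
Arguments udec {_} _.

Definition ycode_wf {n} (c : ycode n) : Prop :=
  (forall (i : 'I_3) (t : nat) (w w' : Msg (msz c)) (y y' : nat -> R),
      (forall p : pair3, (val p).1 = i -> w p = w' p) ->
      (forall s, (s < t)%N -> y s = y' s) ->
      uenc c i t w y = uenc c i t w' y') /\
  (forall (t : nat) (y y' : nat -> R),
      (forall s, (s < t)%N -> y s = y' s) -> renc c t y = renc c t y') /\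
  (forall (j : 'I_3) (w w' : Msg (msz c)) (y y' : nat -> R),
      (forall p : pair3, (val p).1 = j -> w p = w' p) ->
      (forall s, (s < n)%N -> y s = y' s) ->
      udec c j w y = udec c j w' y').

Section Signals.
Context {d : measure_display} {Omega : measurableType d}.
Variable (h : 'I_3 -> R) (z : node * nat -> Omega -> R).

(** [hist c w om t k s] : symbol received by node k at time s, for s < t
    (0 for s >= t), for messages w and noise realization om. *)
Fixpoint hist {n} (c : ycode n) (w : Msg (msz c)) (om : Omega) (t : nat)
    : node -> nat -> R :=
  match t with
  | 0 => fun _ _ => 0
  | t'.+1 =>
    let H := hist c w om t' in
    let yr := \sum_(i < 3) h i * uenc c i t' w (H (Some i)) + z (None, t') om in
    let xr := renc c t' (H None) in
    fun k s => if s == t' then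
                 match k with
                 | None => yr
                 | Some j => h j * xr + z (Some j, t') om
                 end
               else H k s
  end.

Definition xsym {n} (c : ycode n) (w : Msg (msz c)) (k : node) (t : nat)
    (om : Omega) : R :=
  match k with
  | Some i => uenc c i t w (hist c w om t (Some i))
  | None => renc c t (hist c w om t None)
  end.

Definition err_event {n} (c : ycode n) (w : Msg (msz c)) : set Omega :=
  [set om | exists (j : 'I_3) (p : pair3),
      (val p).2 = j /\ udec c j w (hist c w om n (Some j)) p != w p].
End Signals.

Section Achievability.
Context {d : measure_display} {Omega : measurableType d}.
Variable (Pr : probability Omega R) (z : node * nat -> Omega -> R).

Definition iid_std_gaussian : Prop :=
  (forall k, measurable_fun setT (z k)) /\
  (forall (J : seq (node * nat)) (B : node * nat -> set R),
      uniq J -> (forall k, measurable (B k)) ->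
      Pr (\bigcap_(k in [set k | k \in J]) (z k @^-1` B k)) =
      (\prod_(k <- J) normal_prob 0 1 (B k))%E).

Variable (h : 'I_3 -> R) (P : R).

Definition achievable (r : 'I_3 -> 'I_3 -> R) : Prop :=
  forall eps : R, 0 < eps -> exists N : nat, forall n : nat, (N < n)%N ->
  exists c : ycode n,
    ycode_wf c /\
    [/\ (forall p : pair3, 2 `^ (n%:R * r (val p).1 (val p).2) <= (msz c p)%:R),
        (forall (w : Msg (msz c)) (k : node) (t : nat), (t < n)%N ->
            measurable_fun setT (xsym h z c w k t)),
        (forall w : Msg (msz c), measurable (err_event h z c w)),
        (forall k : node,
           (((#|{: Msg (msz c)}|%:R * n%:R)^-1)%:E *
            \sum_(w : Msg (msz c)) \sum_(t < n)
               \int[Pr]_om (xsym h z c w k t om ^+ 2)%:E <= P%:E)%E) &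
        ((#|{: Msg (msz c)}|%:R^-1)%:E *
           \sum_(w : Msg (msz c)) Pr (err_event h z c w) <= eps%:E)%E].

Definition cap_region (r : 'I_3 -> 'I_3 -> R) : Prop :=
  forall e : R, 0 < e -> exists r' : 'I_3 -> 'I_3 -> R,
    achievable r' /\
    forall p : pair3, `|r (val p).1 (val p).2 - r' (val p).1 (val p).2| < e.
End Achievability.
End YChannel.

(* Main.v *)
Require Import Defs.
From HB Require Import structures.
From mathcomp Require Import all_boot all_order all_algebra perm.
From mathcomp Require Import ring lra zify boolp.

(* Each layer of the scheme uses a random affine code over F_q: message m and
   auxiliary index l are sent as delta * lift (m G + l H + d), where the index is
   chosen uniformly among those for which this point falls into a ball of squared
   radius n.  The two users of a lattice layer share G and H and are received with
   equal strength, so the sum of their codewords is again a point of the code and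
   the relay decodes only the sum of the two messages.

   A receiver decodes the layers successively by an MMSE-scaled ball test.  For a
   wrong index the competing point is uniform and independent of the transmitted
   ones, so the union bound only needs the number of grid points in a ball, which
   is compared with the size of the shaping set through Gaussian box
   probabilities.  Codewords of different layers, and the noise, are nearly
   orthogonal by Chebyshev's inequality, so that interference acts like noise of
   the same power.  This gives every rate below 1/2 ln (1/c + g^2 / N), where c is
   the number of transmitters of the layer, hence the term -1/2 of the theorem.

   The relay forwards the decoded sums in the next block with a superposition code,
   and each user strips off its own messages: for instance U1 knows c12, gets c23
   from c12 + c23, and then c31 from c31 + c23.  Averaging over the codes and the
   messages yields one good code, the extra block costs a vanishing fraction of
   the rate, and the strict inequalities come from scaling all powers by a factor
   slightly smaller than 1. *)

Set Implicit Arguments.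
Unset Strict Implicit.
Unset Printing Implicit Defensive.
Import Order.TTheory GRing.Theory Num.Theory.
Local Open Scope ring_scope.

(** * Averages over finite ensembles *)

Section Averages.
Context {R : realFieldType}.

(** The shaping ball is reached by choosing an index, not by reducing modulo a coarse lattice. The
    points sent are therefore real vectors of bounded norm, and the alphabet only has to be so large
    that the sum of two of them does not wrap around. On the other hand [q] has to stay below
    [expR (v * n)], so that rounding dimensions to integers costs almost no rate. The two users of a
    layer must share the linear map, since the sum has to be a code point; their shifts [d] are
    independent, and this decouples their codewords. Every random choice ranges over a finite type.
    For a fixed noise vector the code enters through finite averages only, and independence of a few
    points at a time suffices, so that second moments replace exponential estimates. The resulting
    error bound [D / n] is weak but enough, since the number of blocks does not grow with the
    length. The Gaussian law is used twice: it limits the norm of the noise, and it is the reference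
    measure in which grid points are counted, so that no volume of a ball in dimension [n] has to be
    computed. *)

Definition avg (T : finType) (f : T -> R) : R := (\sum_x f x) / #|T|%:R.

Lemma eq_avg (T : finType) (f g : T -> R) : f =1 g -> avg f = avg g.
Proof. by move=> fg; rewrite /avg; under eq_bigr do rewrite fg. Qed.

Lemma ler_avg (T : finType) (f g : T -> R) :
  (forall x, f x <= g x) -> avg f <= avg g.
Proof. by move=> fg; rewrite ler_wpM2r ?invr_ge0 ?ler0n ?ler_sum. Qed.

Lemma avg_const (T : finType) (c : R) : (0 < #|T|)%N -> avg (fun _ : T => c) = c.
Proof.
by move=> T0; rewrite /avg sumr_const -[_ *+ _]mulr_natr mulfK// pnatr_eq0 -lt0n.
Qed.

Lemma sum_cst (T : finType) (c : R) : \sum_(x : T) c = #|T|%:R * c.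
Proof. by rewrite sumr_const mulr_natl. Qed.

Lemma ler_bool (a b : bool) : (a -> b) -> a%:R <= b%:R :> R.
Proof. by case: a b => -[] // /(_ isT). Qed.

Lemma avgD (T : finType) (f g : T -> R) : avg (fun x => f x + g x) = avg f + avg g.
Proof. by rewrite /avg big_split mulrDl. Qed.

Lemma avgZ (T : finType) (c : R) (f : T -> R) : avg (fun x => c * f x) = c * avg f.
Proof. by rewrite /avg -mulr_sumr mulrA. Qed.

Lemma avg_sum (T I : finType) (P : pred I) (f : I -> T -> R) :
  avg (fun x => \sum_(i | P i) f i x) = \sum_(i | P i) avg (f i).
Proof. by rewrite /avg exchange_big mulr_suml. Qed.

Lemma avg_pair (T U : finType) (f : T * U -> R) :
  avg f = avg (fun x => avg (fun y => f (x, y))).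
Proof.
rewrite /avg -mulr_suml pair_bigA /= card_prod natrM invfM mulrA mulrAC.
by congr (_ / _ / _); apply: eq_bigr => -[].
Qed.

Lemma avg_exchange (T U : finType) (f : T -> U -> R) :
  avg (fun x => avg (f x)) = avg (fun y => avg (f^~ y)).
Proof. by rewrite /avg -!mulr_suml exchange_big mulrAC. Qed.

Lemma avg_reindex (T U : finType) (h : T -> U) (f : U -> R) :
  bijective h -> avg f = avg (f \o h).
Proof.
move=> bh; rewrite /avg (reindex h) /=; last exact: onW_bij.
by rewrite (bij_eq_card bh).
Qed.

Lemma avg_le_exists (T : finType) (f : T -> R) (c : R) :
  (0 < #|T|)%N -> avg f <= c -> exists x, f x <= c.
Proof.
move=> T0 fc; have [/existsP[x xc]|] := boolP [exists x, f x <= c]; first by exists x.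
rewrite negb_exists => /forallP fltc; suff : c < avg f by rewrite ltNge fc.
rewrite -(avg_const c T0) /avg ltr_pM2r ?invr_gt0 ?ltr0n//.
have /card_gt0P[x0 _] := T0.
apply: ltr_sum => [|i _]; last by rewrite ltNge fltc.
by apply/hasP; exists x0; rewrite ?mem_index_enum.
Qed.

(** One coordinate of a product ensemble may be drawn afresh: exchanging it with the fresh value is
    an involution of the pairs, hence a bijection. *)
Lemma avg_ffun_upd (L T : finType) (s : L) (f : {ffun L -> T} -> R) :
  avg f = avg (fun th : {ffun L -> T} =>
                 avg (fun t => f [ffun x => if x == s then t else th x])).
Proof.
have [T0|T0] := posnP #|T|.
  have F0 (th : {ffun L -> T}) : False by move/card0_eq: T0 => /(_ (th s)).
  by rewrite /avg !big1// => th; case: (F0 th).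
rewrite -(avg_pair (fun p : {ffun L -> T} * T =>
    f [ffun x => if x == s then p.2 else p.1 x])).
pose h (p : {ffun L -> T} * T) :=
  ([ffun x => if x == s then p.2 else p.1 x], p.1 s) : {ffun L -> T} * T.
have hK : involutive h.
  move=> [th t]; rewrite /h /= ffunE eqxx; congr (_, _).
  by apply/ffunP => x; rewrite !ffunE; case: eqP => // ->.
rewrite -(avg_reindex (fun p => f p.1) (inv_bij hK)).
by rewrite avg_pair; apply: eq_avg => th /=; rewrite avg_const.
Qed.

(** Conditioning: the codes of the other layers are frozen and only that of layer [s] is averaged.
    The estimates on single layers of a superposition start this way. *)
Lemma avg_ffun_le (L T : finType) (s : L) (f : {ffun L -> T} -> R) (c : R) :
  (0 < #|T|)%N ->
  (forall th : {ffun L -> T}, avg (fun t => f [ffun x => if x == s then t else th x]) <= c) ->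
  avg f <= c.
Proof.
move=> T0 fc; rewrite (avg_ffun_upd s) -[leRHS](@avg_const {ffun L -> T} c).
  exact: ler_avg.
by rewrite card_ffun expn_gt0 T0.
Qed.

End Averages.

Section Selection.
Context {R : realFieldType}.

(** The set to choose from depends on the rest of the random code. A seed from a fixed type, reduced
    modulo the size of the set, keeps the whole ensemble one finite product. *)
Definition pick_mod (T : finType) (x0 : T) (j : nat) (A : {set T}) : T :=
  nth x0 (enum A) (j %% #|A|)%N.

Lemma pick_mod_in (T : finType) (x0 : T) j (A : {set T}) :
  A != set0 -> pick_mod x0 j A \in A.
Proof.
rewrite -card_gt0 => A0; rewrite -mem_enum mem_nth//.
by rewrite -cardE ltn_pmod.
Qed.

Lemma sum_modn (N c : nat) (f : nat -> R) : (0 < N)%N ->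
  \sum_(0 <= j < c * N) f (j %% N)%N = c%:R * \sum_(0 <= j < N) f j.
Proof.
move=> N0; elim: c => [|c IH]; first by rewrite mul0n big_geq// mul0r.
rewrite mulSn addnC (@big_cat_nat _ _ _ (c * N)) ?leq_addr//= IH.
rewrite -natr1 mulrDl mul1r; congr (_ + _).
rewrite -{1}[(c * N)%N]add0n big_addn addKn big_nat [RHS]big_nat.
by apply: eq_bigr => i /andP[_ iN]; rewrite addnC modnMDl modn_small.
Qed.

(* The seed ranges over [#|T|`!] values so that every subset size divides the number of seeds. *)
Lemma avg_pick_mod (T : finType) (x0 : T) (A : {set T}) (f : T -> R) :
  A != set0 ->
  avg (fun j : 'I_(#|T|`!) => f (pick_mod x0 j A)) = (\sum_(l in A) f l) / #|A|%:R.
Proof.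
rewrite -card_gt0 => A0; rewrite /avg card_ord.
rewrite -(big_mkord xpredT (fun j : nat => f (pick_mod x0 j A))).
have /dvdnP[c cE] : (#|A| %| #|T|`!)%N by rewrite dvdn_fact// A0 max_card.
have c0 : (0 < c)%N by have := fact_gt0 #|T|; rewrite cE muln_gt0 => /andP[].
rewrite cE (sum_modn c (fun j => f (nth x0 (enum A) j)) A0).
rewrite natrM invfM mulrACA divff ?mul1r ?pnatr_eq0 -?lt0n//; congr (_ / _).
by rewrite -big_enum /= (big_nth x0) cardE.
Qed.

End Selection.

(** * Random layer codes *)

Section Layer.
Context {R : realFieldType} {Gam : finType} {M L V : finZmodType}.
Variable ev : Gam -> M -> L -> V.
Hypothesis Gam_gt0 : (0 < #|Gam|)%N.
Hypothesis evB : forall g m m' l l', ev g (m - m') (l - l') = ev g m l - ev g m' l'.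
Hypothesis ev_unif : forall m l, (m, l) != (0, 0) ->
  forall f : V -> R, avg (fun g => f (ev g m l)) = avg f.
Variable S : {set V}.
Hypothesis S_gt0 : (0 < #|S|)%N.

Definition layer_seed : finType := 'I_(#|L|`!).
(** One shared linear map, then a shift and a seed for each of the two transmitters. *)
Definition layer_code : finType := ((Gam * (V * V)) * (layer_seed * layer_seed))%type.

Implicit Types (g : Gam) (d : V * V) (w : layer_code) (i : bool) (m : M) (l : L).

Definition proj_b (T : Type) (d : T * T) i : T := if i then d.2 else d.1.
Definition shaped g (v : V) m : {set L} := [set l | ev g m l + v \in S].
Definition sel_idx w i m : L :=
  pick_mod 0 (proj_b w.2 i) (shaped w.1.1 (proj_b w.1.2 i) m).
Definition codeword w i m : V := ev w.1.1 m (sel_idx w i m) + proj_b w.1.2 i.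
(** The expected number of indices whose shifted point falls into [S], called [mu] below. *)
Definition mean_shaped : R := #|L|%:R * #|S|%:R / #|V|%:R.
Definition sparse w i m : bool :=
  #|shaped w.1.1 (proj_b w.1.2 i) m|%:R < mean_shaped / 2.

Local Notation mu := mean_shaped.
Local Notation nV := (#|V|%:R : R).

Lemma card_zmod_gt0 (U : finZmodType) : (0 < #|U|)%N.
Proof. by apply/card_gt0P; exists 0. Qed.

Lemma nV_gt0 : 0 < nV. Proof. by rewrite ltr0n card_zmod_gt0. Qed.

Lemma mean_shaped_gt0 : 0 < mu.
Proof. by rewrite divr_gt0 ?mulr_gt0 ?ltr0n ?card_zmod_gt0. Qed.

Lemma avg_shift (U : finZmodType) (f : U -> R) (c : U) : avg (fun x => f (x + c)) = avg f.
Proof.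
rewrite [RHS](avg_reindex f (h := fun x => x + c))//.
by exists (fun x => x - c) => x; rewrite ?addrK ?subrK.
Qed.

Lemma avg_mem (U : finType) (A : {set U}) : avg (fun x => (x \in A)%:R) = #|A|%:R / #|U|%:R :> R.
Proof.
rewrite /avg; congr (_ / _); rewrite -sum1_card natr_sum [RHS]big_mkcond.
by apply: eq_bigr => x _; case: ifP.
Qed.

(** The two shifts make the first two points uniform whatever the map is, and the third point
    depends on the map alone. This is the independence of a competitor from the transmitted
    codewords. *)
Lemma avg_triple m0 l0 m1 l1 m l (f : V -> V -> V -> R) : (m, l) != (0, 0) ->
  avg (fun gd : Gam * (V * V) => f (ev gd.1 m0 l0 + gd.2.1) (ev gd.1 m1 l1 + gd.2.2) (ev gd.1 m l))
  = avg (fun v0 => avg (fun v1 => avg (f v0 v1))).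
Proof.
move=> ml; rewrite avg_pair.
transitivity (avg (fun g => avg (fun v0 => avg (fun v1 => f v0 v1 (ev g m l))))).
  apply: eq_avg => g; rewrite avg_pair /=.
  rewrite -(avg_shift (fun v0 => avg (fun v1 => f v0 v1 (ev g m l))) (ev g m0 l0)).
  apply: eq_avg => v0 /=.
  rewrite -(avg_shift (fun v1 => f _ v1 (ev g m l)) (ev g m1 l1)).
  by apply: eq_avg => v1; rewrite ![ev g _ _ + _]addrC.
rewrite avg_exchange; apply: eq_avg => v0; rewrite avg_exchange; apply: eq_avg => v1.
exact: ev_unif.
Qed.

Lemma avg_double m0 l0 m1 l1 (f : V -> V -> R) :
  avg (fun gd : Gam * (V * V) => f (ev gd.1 m0 l0 + gd.2.1) (ev gd.1 m1 l1 + gd.2.2))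
  = avg (fun v0 => avg (f v0)).
Proof.
rewrite avg_pair.
transitivity (avg (fun g : Gam => avg (fun v0 => avg (fun v1 => f v0 v1)))).
  apply: eq_avg => g; rewrite avg_pair /=.
  rewrite -(avg_shift (fun v0 => avg (fun v1 => f v0 v1)) (ev g m0 l0)).
  apply: eq_avg => v0 /=.
  rewrite -(avg_shift (fun v1 => f _ v1) (ev g m1 l1)).
  by apply: eq_avg => v1; rewrite ![ev g _ _ + _]addrC.
by rewrite avg_const.
Qed.

Lemma avg_fst (T U : finType) (f : T -> R) : (0 < #|U|)%N ->
  avg (fun p : T * U => f p.1) = avg f.
Proof. by move=> U0; rewrite avg_pair; apply: eq_avg => x /=; rewrite avg_const. Qed.

Lemma avg_snd (T U : finType) (f : U -> R) : (0 < #|T|)%N ->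
  avg (fun p : T * U => f p.2) = avg f.
Proof. by move=> T0; rewrite avg_pair /= avg_const. Qed.

Lemma avg_proj_b (T : finType) (f : T -> R) i : (0 < #|T|)%N ->
  avg (fun p : T * T => f (proj_b p i)) = avg f.
Proof. by case: i => T0; [rewrite avg_snd | rewrite avg_fst]. Qed.

Let p : R := #|S|%:R / nV.

Lemma card_shaped g v m : #|shaped g v m|%:R = \sum_l (ev g m l + v \in S)%:R :> R.
Proof.
rewrite -sum1_card natr_sum [LHS]big_mkcond; apply: eq_bigr => l _.
by rewrite inE; case: ifP.
Qed.

Lemma avg_hit g m l : avg (fun v => (ev g m l + v \in S)%:R) = p.
Proof.
rewrite -[RHS]avg_mem -(avg_shift (fun v => (v \in S)%:R) (ev g m l)).
by apply: eq_avg => v; rewrite addrC.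
Qed.

(** Two points with the same message differ by [ev g 0 (l' - l)], which is uniform; so the hits are
    pairwise independent. *)
Lemma avg_hit2 m l l' : l != l' ->
  avg (fun g => avg (fun v => (ev g m l + v \in S)%:R * (ev g m l' + v \in S)%:R)) = p ^+ 2.
Proof.
move=> ll'.
transitivity (avg (fun g => avg (fun v => (v \in S)%:R * (v + ev g 0 (l' - l) \in S)%:R : R))).
  apply: eq_avg => g.
  rewrite -(avg_shift (fun v => (v \in S)%:R * (v + ev g 0 (l' - l) \in S)%:R : R) (ev g m l)).
  have -> : ev g 0 (l' - l) = ev g m l' - ev g m l by rewrite -evB subrr.
  apply: eq_avg => v; congr ((_ \in S)%:R * (_ \in S)%:R); first by rewrite addrC.
  by rewrite -addrA [ev g m l + _]addrC subrK addrC.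
rewrite avg_exchange.
transitivity (avg (fun v : V => (v \in S)%:R * p)).
  apply: eq_avg => v; rewrite avgZ; congr (_ * _).
  rewrite (ev_unif _ (fun u => (v + u \in S)%:R)).
    rewrite -[RHS]avg_mem -(avg_shift (fun v => (v \in S)%:R) v).
    by apply: eq_avg => u; rewrite addrC.
  by rewrite xpair_eqE eqxx subr_eq0 eq_sym.
rewrite -[RHS]mulrC; under eq_avg do rewrite mulrC.
by rewrite avgZ avg_mem.
Qed.

(** Chebyshev's inequality: by pairwise independence the variance of the number of hits is at most
    [mu], and the deviation considered is [mu / 2]. *)
Lemma avg_sparse_gv m :
  avg (fun gv : Gam * V => (#|shaped gv.1 gv.2 m|%:R < mu / 2)%R%:R) <= 4 / mu.
Proof.
have mu0 := mean_shaped_gt0.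
have muE : mu = #|L|%:R * p by rewrite /mean_shaped mulrA.
have E1 : avg (fun gv : Gam * V => #|shaped gv.1 gv.2 m|%:R) = mu.
  under eq_avg do rewrite card_shaped.
  rewrite avg_sum muE; transitivity (\sum_(l : L) p); last by rewrite sumr_const mulr_natl.
  apply: eq_bigr => l _; rewrite avg_pair /=.
  by under eq_avg do rewrite avg_hit; rewrite avg_const.
have E2 : avg (fun gv : Gam * V => #|shaped gv.1 gv.2 m|%:R ^+ 2) <= mu + mu ^+ 2.
  under eq_avg do rewrite card_shaped expr2 big_distrlr /=.
  rewrite avg_sum.
  apply: (@le_trans _ _ (\sum_(l : L) (p + #|L|%:R * p ^+ 2))); last first.
    by rewrite sumr_const -[leLHS]mulr_natl muE le_eqVlt; apply/orP; left; apply/eqP; ring.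
  apply: ler_sum => l _; rewrite avg_sum (bigD1 l)//=; apply: lerD.
    rewrite avg_pair /=; apply: (@le_trans _ _ (avg (fun g : Gam => p))); last by rewrite avg_const.
    apply: ler_avg => g; rewrite -(avg_hit g m l); apply: ler_avg => v.
    by case: (_ \in S); rewrite ?mulr1 ?mulr0.
  apply: (@le_trans _ _ (\sum_(l' : L) p ^+ 2)); last by rewrite sumr_const mulr_natl.
  rewrite [leRHS](bigD1 l)//= -[leLHS]add0r; apply: lerD; first exact: sqr_ge0.
  apply: ler_sum => l' l'l; rewrite avg_pair /= avg_hit2//.
  by rewrite eq_sym.
(* The indicator is dominated by [4 * (x - mu) ^+ 2 / mu ^+ 2]; the square is expanded so that the
   two moments can be inserted. *)
have H (x : R) : (x < mu / 2)%R%:R <= 4 * (x ^+ 2 + (-2 * mu * x + mu ^+ 2)) / mu ^+ 2.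
  rewrite ler_pdivlMr ?exprn_gt0//; case: ltP => [xm|_] /=; last first.
    by rewrite mul0r; have := sqr_ge0 (x - mu); lra.
  have : 0 <= (mu - 2 * x) * (3 * mu - 2 * x) by rewrite mulr_ge0//; lra.
  by lra.
apply: (le_trans (ler_avg (fun gv => H _))).
under eq_avg do rewrite mulrAC.
rewrite avgZ avgD avgD avgZ E1 avg_const; last by rewrite card_prod muln_gt0 Gam_gt0 card_zmod_gt0.
have -> : 4 / mu = 4 / mu ^+ 2 * mu by field; rewrite gt_eqF.
by rewrite ler_pM2l ?divr_gt0 ?exprn_gt0//; nra.
Qed.

Lemma seed_gt0 : (0 < #|layer_seed|)%N. Proof. by rewrite card_ord fact_gt0. Qed.

Lemma layer_code_gt0 : (0 < #|layer_code|)%N.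
Proof. by rewrite !card_prod !muln_gt0 Gam_gt0 !card_zmod_gt0 seed_gt0. Qed.

Lemma avg_sparse i m : avg (fun w => (sparse w i m)%:R) <= 4 / mu.
Proof.
rewrite /sparse.
rewrite (avg_fst (fun gd : Gam * (V * V) => (#|shaped gd.1 (proj_b gd.2 i) m|%:R < mu / 2)%R%:R)); last first.
  by rewrite card_prod muln_gt0 seed_gt0.
rewrite avg_pair /=; apply: le_trans (avg_sparse_gv m); rewrite avg_pair /=.
apply: ler_avg => g; rewrite (avg_proj_b (fun v => (#|shaped g v m|%:R < mu / 2)%R%:R))//.
exact: card_zmod_gt0.
Qed.

(* Off the sparse event each index is selected with probability at most [2 / mu]. *)
Lemma avg_dominate m0 m1 (F : Gam -> V * V -> L -> L -> R) :
  (forall g d l l', 0 <= F g d l l') ->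
  avg (fun w => (~~ sparse w false m0 && ~~ sparse w true m1)%:R
      * F w.1.1 w.1.2 (sel_idx w false m0) (sel_idx w true m1))
  <= (2 / mu) ^+ 2 * \sum_l \sum_l' avg (fun gd : Gam * (V * V) =>
       ((ev gd.1 m0 l + gd.2.1 \in S) && (ev gd.1 m1 l' + gd.2.2 \in S))%:R
        * F gd.1 gd.2 l l').
Proof.
move=> F0; have mu0 := mean_shaped_gt0.
have -> : \sum_l \sum_l' avg (fun gd : Gam * (V * V) =>
       ((ev gd.1 m0 l + gd.2.1 \in S) && (ev gd.1 m1 l' + gd.2.2 \in S))%:R
        * F gd.1 gd.2 l l') = avg (fun gd : Gam * (V * V) => \sum_l \sum_l'
       ((ev gd.1 m0 l + gd.2.1 \in S) && (ev gd.1 m1 l' + gd.2.2 \in S))%:R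
        * F gd.1 gd.2 l l').
  by rewrite avg_sum; apply: eq_bigr => l _; rewrite avg_sum.
rewrite -avgZ [leLHS](@avg_pair _ (Gam * (V * V))%type (layer_seed * layer_seed)%type).
apply: ler_avg => -[g d] /=; rewrite avg_pair /=.
rewrite /sparse /sel_idx /=.
set A0 := shaped g d.1 m0; set A1 := shaped g d.2 m1.
have F' : 0 <= \sum_l \sum_l' ((ev g m0 l + d.1 \in S) && (ev g m1 l' + d.2 \in S))%:R * F g d l l'.
  by rewrite !sumr_ge0// => l _; rewrite sumr_ge0// => l' _; rewrite mulr_ge0// ler0n.
have S0 : 0 <= (2 / mu) ^+ 2 by rewrite sqr_ge0.
case: (boolP (_ && _)) => [/andP[]|_]; last first.
  under eq_avg do under eq_avg do rewrite mul0r.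
  by rewrite !avg_const ?seed_gt0//; apply: mulr_ge0.
rewrite -!leNgt => A0m A1m.
have nz (A : {set L}) : mu / 2 <= #|A|%:R -> A != set0.
  by apply: contraTneq => ->; rewrite cards0 -ltNge divr_gt0.
have inv (A : {set L}) : mu / 2 <= #|A|%:R -> #|A|%:R^-1 <= 2 / mu.
  move=> Am; have m20 : 0 < mu / 2 by rewrite divr_gt0.
  by rewrite -[2 / mu]invf_div lef_pV2 ?posrE// (lt_le_trans m20 Am).
under eq_avg => s0.
  under eq_avg do rewrite mul1r.
  rewrite (avg_pick_mod 0 (fun l' => F g d (pick_mod 0 s0 A0) l') (nz _ A1m)).
  over.
rewrite (avg_pick_mod 0 (fun l => (\sum_(l' in A1) F g d l l') / #|A1|%:R) (nz _ A0m)).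
rewrite -mulr_suml -mulrA -invfM mulrC expr2; apply: ler_pM; rewrite ?invr_ge0 ?mulr_ge0 ?ler0n//.
- by rewrite sumr_ge0// => l _; rewrite sumr_ge0.
- by rewrite invfM ler_pM ?invr_ge0 ?ler0n ?inv.
rewrite big_mkcond; apply: ler_sum => l _; rewrite inE.
case: (ev g m0 l + d.1 \in S) => /=; last first.
  by rewrite sumr_ge0// => l' _; rewrite mul0r.
rewrite big_mkcond; apply: ler_sum => l' _; rewrite inE.
by case: (_ \in S); rewrite ?mul1r ?mul0r.
Qed.

(** Up to the factor 4, the selected codewords behave like two independent uniform points of [S]:
    the factor [(2 / mu) ^+ 2], times the number of index pairs, over the number of pairs in [V], is
    4 over the number of pairs in [S]. *)
Lemma avg_codewords m0 m1 (f : V -> V -> R) : (forall u v, 0 <= f u v) ->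
  avg (fun w => (~~ sparse w false m0 && ~~ sparse w true m1)%:R
      * f (codeword w false m0) (codeword w true m1))
  <= 4 * ((\sum_(u in S) \sum_(v in S) f u v) / #|S|%:R ^+ 2).
Proof.
move=> f0.
apply: (le_trans (avg_dominate m0 m1
  (F := fun g d l l' => f (ev g m0 l + d.1) (ev g m1 l' + d.2)) _)); first by move=> *; exact: f0.
have E l l' : avg (fun gd : Gam * (V * V) =>
    ((ev gd.1 m0 l + gd.2.1 \in S) && (ev gd.1 m1 l' + gd.2.2 \in S))%:R *
    f (ev gd.1 m0 l + gd.2.1) (ev gd.1 m1 l' + gd.2.2)) =
   (\sum_(u in S) \sum_(v in S) f u v) / nV ^+ 2.
  rewrite (avg_double m0 l m1 l' (fun u v => ((u \in S) && (v \in S))%:R * f u v)).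
  rewrite /avg -mulr_suml -mulrA -invfM; congr (_ / _).
  rewrite [RHS]big_mkcond; apply: eq_bigr => u _; case: (u \in S) => /=; last first.
    by rewrite big1// => v _; rewrite mul0r.
  rewrite [RHS]big_mkcond; apply: eq_bigr => v _.
  by case: (_ \in S); rewrite ?mul1r ?mul0r.
under eq_bigr do under eq_bigr do rewrite E.
rewrite !sum_cst /mean_shaped le_eqVlt; apply/orP; left; apply/eqP.
have nz (U : finZmodType) : #|U|%:R != 0 :> R by rewrite pnatr_eq0 -lt0n card_zmod_gt0.
by field; rewrite !nz pnatr_eq0 -lt0n S_gt0.
Qed.

(* [b] tells whether the second codeword is actually superposed on the first one. *)
Lemma avg_wrong_index m0 m1 (b : bool) (C : {set M}) (B : V -> V -> {set V}) (c : nat) :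
  (forall u v, (#|B u v| <= c)%N) ->
  avg (fun w => (~~ sparse w false m0 && ~~ sparse w true m1)%:R *
     [exists a : M * L,
        [&& a.1 \in C,
            a != (m0 + m1 *+ b, sel_idx w false m0 + sel_idx w true m1 *+ b) &
            ev w.1.1 a.1 a.2 + (w.1.2.1 + w.1.2.2 *+ b)
              \in B (codeword w false m0) (codeword w true m1)]]%:R)
  <= 4 * (#|C|%:R * #|L|%:R * c%:R / nV).
Proof.
move=> Bc; pose F g d l l' : R := [exists a : M * L,
        [&& a.1 \in C, a != (m0 + m1 *+ b, l + l' *+ b) &
            ev g a.1 a.2 + (d.1 + d.2 *+ b) \in B (ev g m0 l + d.1) (ev g m1 l' + d.2)]]%:R.
apply: (le_trans (avg_dominate m0 m1 (F := F) (fun _ _ _ _ => ler0n _ _))).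
have evb g l l' : ev g (m0 + m1 *+ b) (l + l' *+ b) = ev g m0 l + ev g m1 l' *+ b.
  case: (b) => /=; last by rewrite !mulr0n !addr0.
  have ev0 : ev g 0 0 = 0 by rewrite -(subrr (0 : M)) -(subrr (0 : L)) evB subrr.
  have evN m l1 : ev g (- m) (- l1) = - ev g m l1.
    by rewrite -[- m]sub0r -[- l1]sub0r evB ev0 sub0r.
  by rewrite !mulr1n -{1}[m1]opprK -{1}[l']opprK evB evN opprK.
have E l l' : avg (fun gd : Gam * (V * V) =>
    ((ev gd.1 m0 l + gd.2.1 \in S) && (ev gd.1 m1 l' + gd.2.2 \in S))%:R *
    F gd.1 gd.2 l l') <= #|C|%:R * #|L|%:R * c%:R / nV * p ^+ 2.
  pose G (a : M * L) (gd : Gam * (V * V)) : R :=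
    ((ev gd.1 m0 l + gd.2.1 \in S) && (ev gd.1 m1 l' + gd.2.2 \in S))%:R *
    (ev gd.1 a.1 a.2 + (gd.2.1 + gd.2.2 *+ b) \in B (ev gd.1 m0 l + gd.2.1) (ev gd.1 m1 l' + gd.2.2))%:R.
  apply: (@le_trans _ _ (\sum_(a : M * L | (a.1 \in C) && (a != (m0 + m1 *+ b, l + l' *+ b))) avg (G a))).
    rewrite -avg_sum; apply: ler_avg => gd; rewrite /F.
    case: existsP => [[a /and3P[aC aN aB]]|_]; last first.
      by rewrite mulr0 sumr_ge0// => a _; rewrite mulr_ge0 ?ler0n.
    rewrite (bigD1 a) ?aC//= {1}/G aB lerDl sumr_ge0// => a' _.
    by rewrite mulr_ge0 ?ler0n.
  apply: (@le_trans _ _ (\sum_(a : M * L | a.1 \in C) (c%:R / nV * p ^+ 2))); last first.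
    have CL : \sum_(a : M * L | a.1 \in C) 1 = #|C|%:R * #|L|%:R :> R.
      transitivity (\sum_(m in C) \sum_(l : L) (1 : R)).
        by rewrite pair_big; apply: eq_bigl => a; rewrite andbT.
      by under eq_bigr do rewrite sumr_const; rewrite sumr_const -mulrnA mulnC natrM.
    by under eq_bigr do rewrite -[c%:R / nV]mul1r -mulrA; rewrite -mulr_suml CL !mulrA.
  rewrite big_mkcondr; apply: ler_sum => a aC; case: ifP => [aN|_]; last first.
    by rewrite mulr_ge0 ?sqr_ge0// divr_ge0 ?ler0n.
  (* The competitor is the transmitted point, or the sum of both, plus [ev g a'.1 a'.2]. Since [a']
     is nonzero, this difference is uniform and independent of the codewords, and hits [B u v] with
     probability at most [c / #|V|]. *)
  pose a' := (a.1 - (m0 + m1 *+ b), a.2 - (l + l' *+ b)).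
  have a'0 : a' != (0, 0).
    apply: contraNneq aN => -[/subr0_eq e1 /subr0_eq e2].
    by rewrite [a]surjective_pairing e1 e2.
  rewrite (_ : avg (G a) = avg (fun gd : Gam * (V * V) =>
     (fun u v t => ((u \in S) && (v \in S))%:R * (t + (u + v *+ b) \in B u v)%:R)
     (ev gd.1 m0 l + gd.2.1) (ev gd.1 m1 l' + gd.2.2) (ev gd.1 a'.1 a'.2))); last first.
    apply: eq_avg => gd.
    have ke : ev gd.1 a'.1 a'.2 + (ev gd.1 m0 l + gd.2.1 + (ev gd.1 m1 l' + gd.2.2) *+ b)
              = ev gd.1 a.1 a.2 + (gd.2.1 + gd.2.2 *+ b).
      by rewrite /a' /= evB evb mulrnDl (addrACA (ev gd.1 m0 l)) -[LHS]addrA addKr.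
    by rewrite /G -ke.
  rewrite (avg_triple m0 l m1 l'
    (fun u v t => ((u \in S) && (v \in S))%:R * (t + (u + v *+ b) \in B u v)%:R) a'0).
  apply: (@le_trans _ _ (avg (fun u => avg (fun v => ((u \in S) && (v \in S))%:R * (c%:R / nV))))).
    apply: ler_avg => u; apply: ler_avg => v; rewrite avgZ.
    rewrite ler_wpM2l ?ler0n//.
    rewrite (avg_shift (fun t => (t \in B u v)%:R)) avg_mem.
    by rewrite ler_pM2r ?invr_gt0 ?nV_gt0// ler_nat.
  under eq_avg do under eq_avg do rewrite mulrC.
  under eq_avg do rewrite avgZ.
  rewrite avgZ ler_wpM2l ?divr_ge0 ?ler0n// le_eqVlt; apply/orP; left; apply/eqP.
  under eq_avg => u.
    rewrite (_ : avg _ = (u \in S)%:R * p); last first.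
      rewrite /p -avg_mem -avgZ; apply: eq_avg => v.
      by case: (u \in S); case: (v \in S); rewrite /= ?mulr1 ?mulr0.
    rewrite mulrC; over.
  by rewrite avgZ avg_mem.
apply: (@le_trans _ _ ((2 / mu) ^+ 2 * \sum_(l : L) \sum_(l' : L) (#|C|%:R * #|L|%:R * c%:R / nV * p ^+ 2))).
  by rewrite ler_wpM2l ?sqr_ge0//; apply: ler_sum => l _; apply: ler_sum => l' _.
rewrite !sum_cst /mean_shaped /p le_eqVlt; apply/orP; left; apply/eqP.
have nz (U : finZmodType) : #|U|%:R != 0 :> R by rewrite pnatr_eq0 -lt0n card_zmod_gt0.
by field; rewrite !nz pnatr_eq0 -lt0n S_gt0.
Qed.

End Layer.

(** * Centered representatives of residues modulo a prime *)

Section CenteredLift.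
Variable q : nat.
Hypothesis q_pr : prime q.

Definition clift (u : 'F_q) : int := if (u.*2 < q)%N then u%:Z else u%:Z - q%:Z.

Lemma natF_eq0 k : (k%:R == 0 :> 'F_q) = (q %| k)%N.
Proof. by rewrite (dvdn_pcharf (pchar_Fp q_pr)). Qed.

Lemma clift_val u : (clift u)%:~R = u :> 'F_q.
Proof.
rewrite /clift; case: ifP => _; last rewrite rmorphB /= -!pmulrn.
  by rewrite -pmulrn natr_Zp.
by rewrite (eqP (_ : q%:R == 0 :> 'F_q)) ?natF_eq0// subr0 natr_Zp.
Qed.

Lemma clift_inj : injective clift.
Proof. by move=> u v uv; rewrite -[u]clift_val uv clift_val. Qed.

Lemma ltFp (u : 'F_q) : (u < q)%N.
Proof. by have := ltn_ord u; rewrite [X in (_ < X)%N](Fp_cast q_pr). Qed.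

Lemma clift_bound u : (2 * `|clift u| <= q)%N.
Proof.
have := ltFp u; rewrite /clift; case: ifPn => h1 h2; first by rewrite absz_nat mul2n ltnW.
by rewrite -leqNgt in h1; lia.
Qed.

Lemma clift_id (k : int) : (2 * `|k| < q)%N -> clift k%:~R = k.
Proof.
move=> kq; apply/eqP; rewrite -subr_eq0; set u : 'F_q := k%:~R.
have q0 : (q %| `|clift u - k|)%N.
  rewrite -natF_eq0; have : (clift u - k)%:~R == 0 :> 'F_q.
    by rewrite rmorphB /= clift_val subrr.
  case: (intP (clift u - k)) => [|j|j] //.
  by rewrite rmorphN /= oppr_eq0 -pmulrn.
have := clift_bound u; case/dvdnP: q0 => -[|j] je; first by move=> _; lia.
by move=> cb; exfalso; move: je; rewrite mulSn; lia.
Qed.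

Lemma clift_opp u : odd q -> clift (- u) = - clift u.
Proof.
move=> oq; rewrite -{1}[u]clift_val -rmorphN /= clift_id// abszN.
by have := clift_bound u; lia.
Qed.

Lemma clift_add u v : (2 * (`|clift u| + `|clift v|) < q)%N -> clift (u + v) = clift u + clift v.
Proof.
by move=> uv; rewrite -{1}[u]clift_val -{1}[v]clift_val -rmorphD /= clift_id//; lia.
Qed.

End CenteredLift.

(** * Random linear codes over a prime field *)

Section Ensemble.
Context {R : realFieldType}.
Variables (q n K kl : nat).
Hypothesis q_pr : prime q.

Local Notation V := 'rV['F_q]_n.
Local Notation M := 'rV['F_q]_K.
Local Notation L := 'rV['F_q]_kl.

Definition lin_ev (G : 'M['F_q]_(K + kl, n)) (m : M) (l : L) : V := row_mx m l *m G.

Lemma lin_evB G m m' l l' : lin_ev G (m - m') (l - l') = lin_ev G m l - lin_ev G m' l'.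
Proof. by rewrite /lin_ev -mulmxBl opp_row_mx add_row_mx. Qed.

(** If coordinate [j] of the row is nonzero, adding a suitable multiple of [v] to row [j] of [G]
    translates the image by [v]. So the law of the image is invariant under all translations. *)
Lemma lin_ev_unif m l : (m, l) != (0, 0) ->
  forall f : V -> R, avg (fun G => f (lin_ev G m l)) = avg f.
Proof.
move=> ml f; pose a := row_mx m l.
have [j aj0] : exists j, a 0 j != 0.
  apply/existsP; apply: contraNT ml; rewrite negb_exists => /forallP a0.
  have : a = row_mx 0 0 by rewrite row_mx0; apply/rowP => j; rewrite [RHS]mxE; apply/eqP/negPn/a0.
  by move=> /eq_row_mx[-> ->].
pose E (v : V) : 'M['F_q]_(K + kl, n) := \matrix_(i, t) (if i == j then v 0 t / a 0 j else 0).
have aE v : a *m E v = v.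
  apply/rowP => t; rewrite mxE (bigD1 j)//= big1 ?addr0; first by rewrite [E v _ _]mxE eqxx mulrC divfK.
  by move=> i /negPf ij; rewrite [E v _ _]mxE ij mulr0.
transitivity (avg (fun v : V => avg (fun G : 'M['F_q]_(K + kl, n) => f (lin_ev G m l)))).
  by rewrite avg_const// card_zmod_gt0.
transitivity (avg (fun v : V => avg (fun G : 'M['F_q]_(K + kl, n) => f (lin_ev G m l + v)))).
  apply: eq_avg => v.
  rewrite -(avg_shift (fun G : 'M['F_q]_(K + kl, n) => f (lin_ev G m l)) (E v)).
  by apply: eq_avg => G; rewrite /lin_ev mulmxDr aE.
rewrite avg_exchange; transitivity (avg (fun G : 'M['F_q]_(K + kl, n) => avg f)).
  apply: eq_avg => G; rewrite -(avg_shift f (lin_ev G m l)).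
  by apply: eq_avg => v; rewrite addrC.
by rewrite avg_const// card_zmod_gt0.
Qed.

Lemma lin_Gam_gt0 : (0 < #|{: 'M['F_q]_(K + kl, n)}|)%N.
Proof. exact: card_zmod_gt0. Qed.

End Ensemble.

(** * Norms of combinations of nearly orthogonal vectors *)

Section Dot.
Context {R : realFieldType} {n : nat}.
Implicit Types x y : 'I_n -> R.

Definition dot x y : R := \sum_t x t * y t.

Lemma dotC x y : dot x y = dot y x.
Proof. by apply: eq_bigr => t _; rewrite mulrC. Qed.

Lemma dot_sqr x : dot x x = \sum_t x t ^+ 2.
Proof. by apply: eq_bigr => t _; rewrite expr2. Qed.

Lemma dot_lincomb (I : finType) (c : I -> R) (v : I -> 'I_n -> R) :
  dot (fun t => \sum_i c i * v i t) (fun t => \sum_i c i * v i t)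
  = \sum_i \sum_j c i * c j * dot (v i) (v j).
Proof.
rewrite /dot; under eq_bigr do rewrite big_distrlr /=.
rewrite exchange_big; apply: eq_bigr => i _; rewrite exchange_big; apply: eq_bigr => j _.
by rewrite mulr_sumr; apply: eq_bigr => t _; rewrite mulrACA.
Qed.

(** Up to an error of order [e] the energies of the terms simply add. The same estimate serves for
    the error seen by a decoder and for the transmitted power. *)
Lemma dot_near_orthonormal (I : finType) (c : I -> R) (v : I -> 'I_n -> R) (N e : R) :
  0 <= N -> 0 <= e ->
  (forall i, dot (v i) (v i) <= N * (1 + e)) ->
  (forall i j, i != j -> `|dot (v i) (v j)| <= N * e) ->
  dot (fun t => \sum_i c i * v i t) (fun t => \sum_i c i * v i t)
  <= N * (\sum_i c i ^+ 2 + e * (\sum_i c i ^+ 2 + (\sum_i `|c i|) ^+ 2)).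
Proof.
move=> N0 e0 vi vij; rewrite dot_lincomb.
apply: (@le_trans _ _ (\sum_i (c i ^+ 2 * (N * (1 + e)) + \sum_j `|c i| * `|c j| * (N * e)))).
  apply: ler_sum => i _; rewrite (bigD1 i)//= -expr2; apply: lerD.
    by rewrite ler_wpM2l ?sqr_ge0.
  rewrite [leRHS](bigD1 i)//= -[leLHS]add0r; apply: lerD; first by rewrite !mulr_ge0.
  apply: ler_sum => j ji; rewrite (le_trans (ler_norm _))// !normrM ler_wpM2l ?mulr_ge0//.
  by rewrite vij// eq_sym.
rewrite big_split /= -mulr_suml (_ : \sum_i \sum_j _ = (\sum_i `|c i|) ^+ 2 * (N * e)).
  by rewrite le_eqVlt; apply/orP; left; apply/eqP; ring.
rewrite expr2 big_distrlr /= mulr_suml; apply: eq_bigr => i _.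
by rewrite mulr_suml.
Qed.

End Dot.

(** * Second moments of the shaping ball *)

Section Shaping.
Context {R : realFieldType}.
Variables (q n : nat) (delta : R).
Hypothesis q_pr : prime q.
Hypothesis q_odd : odd q.

Local Notation V := 'rV['F_q]_n.

Definition grid_point (u : V) (t : 'I_n) : R := delta * (clift (u 0 t))%:~R.

Definition shaping : {set V} := [set u | dot (grid_point u) (grid_point u) <= n%:R].

Lemma shaping0 : (0 < #|shaping|)%N.
Proof.
apply/card_gt0P; exists 0; rewrite inE /dot big1 ?ler0n// => t _.
by rewrite /grid_point mxE -[0]/(0%:~R) clift_id ?mulr0 ?mul0r// absz0 muln0 prime_gt0.
Qed.

(** Changing the sign of one coordinate preserves the ball and reverses the sum; the centered lift
    is an odd function because [q] is odd. *)
Lemma sum_shaping_cross (t s : 'I_n) : t != s ->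
  \sum_(u in shaping) grid_point u t * grid_point u s = 0.
Proof.
move=> ts.
pose h (u : V) : V := \row_r (if r == t then - u 0 r else u 0 r).
have hK : involutive h.
  by move=> u; apply/rowP => r; rewrite !mxE; case: (r == t); rewrite ?opprK.
have ph u r : grid_point (h u) r = (-1) ^+ (r == t) * grid_point u r.
  rewrite /grid_point mxE; case: eqP => _; last by rewrite mul1r.
  by rewrite clift_opp// rmorphN /= expr1; ring.
have hS u : (h u \in shaping) = (u \in shaping).
  rewrite !inE /dot; congr (_ <= _); apply: eq_bigr => r _.
  by rewrite ph mulrACA -expr2 sqrr_sign mul1r.
set s0 := \sum_(u in _) _; have : s0 = - s0.
  rewrite {1}/s0 (reindex_inj (inv_inj hK)) /= -sumrN; apply: eq_big => u; first exact: hS.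
  by move=> _; rewrite !ph eqxx eq_sym (negPf ts) /=; ring.
by move=> /eqP; rewrite -addr_eq0 -mulr2n mulrn_eq0 /= => /eqP.
Qed.

(** Permutations of the coordinates preserve the ball, so all second moments agree, and together
    they are at most [n] per point. *)
Lemma sum_shaping_sqr (t : 'I_n) : \sum_(u in shaping) grid_point u t ^+ 2 <= #|shaping|%:R.
Proof.
have E s : \sum_(u in shaping) grid_point u s ^+ 2 = \sum_(u in shaping) grid_point u t ^+ 2.
  pose h (u : V) : V := col_perm (tperm s t) u.
  have hK : involutive h by move=> u; apply/rowP => r; rewrite !mxE tpermK.
  have ph u r : grid_point (h u) r = grid_point u (tperm s t r) by rewrite /grid_point mxE.
  rewrite (reindex_inj (inv_inj hK)) /=; apply: eq_big => u; last by rewrite ph tpermL.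
  rewrite !inE /dot [in RHS](reindex_inj (@perm_inj _ (tperm s t))).
  by congr (_ <= _); apply: eq_bigr => r _; rewrite ph.
have n0 : (0 < n)%N by case: (t) => ? /= /(leq_ltn_trans (leq0n _)).
have : n%:R * (\sum_(u in shaping) grid_point u t ^+ 2) <= n%:R * #|shaping|%:R.
  apply: (@le_trans _ _ (\sum_(u in shaping) dot (grid_point u) (grid_point u))).
    rewrite /dot exchange_big -[n in n%:R]card_ord -sum_cst /=.
    apply: ler_sum => s _; rewrite -(E s); apply: ler_sum => u _; by rewrite expr2.
  apply: (@le_trans _ _ (\sum_(u in shaping) n%:R)); last by rewrite sumr_const mulr_natr.
  by apply: ler_sum => u; rewrite inE.
by rewrite ler_pM2l ?ltr0n.
Qed.

(** The matrix of second moments of the ball is diagonal with entries at most 1, as for white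
    noise. *)
Lemma sum_shaping_dot (b : 'I_n -> R) :
  \sum_(u in shaping) dot (grid_point u) b ^+ 2 <= #|shaping|%:R * dot b b.
Proof.
have -> : \sum_(u in shaping) dot (grid_point u) b ^+ 2 =
    \sum_t b t ^+ 2 * \sum_(u in shaping) grid_point u t ^+ 2.
  transitivity (\sum_t \sum_s b t * b s * \sum_(u in shaping) grid_point u t * grid_point u s).
    rewrite /dot; under eq_bigr do rewrite expr2 big_distrlr /=.
    rewrite exchange_big; apply: eq_bigr => t _; rewrite exchange_big; apply: eq_bigr => s _.
    by rewrite mulr_sumr; apply: eq_bigr => u _; ring.
  apply: eq_bigr => t _; rewrite (bigD1 t)//= [X in _ + X]big1 ?addr0.
    by rewrite [b t ^+ 2]expr2; congr (_ * _); apply: eq_bigr => u _; rewrite expr2.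
  by move=> s st; rewrite sum_shaping_cross ?mulr0// eq_sym.
rewrite /dot mulr_sumr; apply: ler_sum => t _; rewrite -expr2 mulrC.
by rewrite ler_wpM2r ?sqr_ge0 ?sum_shaping_sqr.
Qed.

(** Coordinates of shaping points are at most the square root of [n], so those of a sum are at most
    twice that. Staying below [delta * q / 2] avoids the wraparound, whence the constant 16. *)
Lemma grid_point_add (u v : V) : 0 < delta -> 16 * n%:R < (delta * q%:R) ^+ 2 ->
  u \in shaping -> v \in shaping -> forall t, grid_point (u + v) t = grid_point u t + grid_point v t.
Proof.
move=> d0 nq uS vS t; rewrite /grid_point mxE clift_add ?rmorphD ?mulrDr//.
have B (w : V) : w \in shaping -> delta ^+ 2 * (`|clift (w 0%R t)|%N%:R) ^+ 2 <= n%:R.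
  rewrite inE; apply: le_trans; rewrite /dot (bigD1 t)//= /grid_point -expr2 exprMn.
  rewrite natr_absz intr_norm real_normK ?num_real// lerDl sumr_ge0// => i _.
  by rewrite -expr2 sqr_ge0.
rewrite -(ltr_nat R) -(@ltr_pXn2r _ 2) ?nnegrE ?ler0n// -(@ltr_pM2l _ (delta ^+ 2)) ?exprn_gt0// -[ltRHS]exprMn.
apply: le_lt_trans nq; rewrite [in leLHS]natrM [in leLHS]natrD.
have := B u uS; have := B v vS.
set x : R := `|clift (u 0%R t)|%N%:R; set y : R := `|clift (v 0%R t)|%N%:R => h1 h2.
have : 0 <= delta ^+ 2 * (x - y) ^+ 2 by rewrite mulr_ge0 ?sqr_ge0.
by lra.
Qed.

End Shaping.

(** * Superposition and successive decoding *)

Section Superposition.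
Context {R : realFieldType}.
Variables (q n K kl : nat) (delta : R).
Hypothesis q_pr : prime q.
Hypothesis q_odd : odd q.
Hypothesis n_gt0 : (0 < n)%N.
Hypothesis delta_gt0 : 0 < delta.
Hypothesis q_large : 16 * n%:R < (delta * q%:R) ^+ 2.

Local Notation V := 'rV['F_q]_n.
Local Notation M := 'rV['F_q]_K.
Local Notation L := 'rV['F_q]_kl.
Local Notation S := (shaping q n delta).
Local Notation pt := (@grid_point R q n delta).

Definition lcode : finType :=
  @layer_code 'M['F_q]_(K + kl, n) 'rV['F_q]_kl 'rV['F_q]_n.

Implicit Types (w : lcode) (i : bool) (m : M) (a : M * L).

Definition cw w i m : V := codeword (@lin_ev q n K kl) S w i m.
Definition unshaped w i m : bool := sparse (R := R) (@lin_ev q n K kl) S w i m.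
Definition code_point w i m : 'I_n -> R := pt (cw w i m).
(** With [b] set both shifts are added: the relay searches among the sums of two codewords. *)
Definition index_point (b : bool) w a : 'I_n -> R :=
  pt (lin_ev w.1.1 a.1 a.2 + (w.1.2.1 + w.1.2.2 *+ b)).
Definition true_index (b : bool) w (m : bool -> M) : M * L :=
  (m false + m true *+ b,
   sel_idx (@lin_ev q n K kl) S w false (m false) + sel_idx (@lin_ev q n K kl) S w true (m true) *+ b).

Local Notation nR := (n%:R : R).
Local Notation muS := (mean_shaped (R := R) (L := L) S).

Let nR_gt0 : 0 < nR. Proof. by rewrite ltr0n. Qed.
Let S_gt0 : (0 < #|S|)%N. Proof. exact: shaping0. Qed.

Lemma cw_shaping w i m : ~~ unshaped w i m -> cw w i m \in S.
Proof.
rewrite /unshaped /sparse -leNgt => h.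
have : shaped (@lin_ev q n K kl) S w.1.1 (proj_b w.1.2 i) m != set0.
  apply: contraTneq h => ->; rewrite cards0 -ltNge divr_gt0// mean_shaped_gt0//.
by move=> /pick_mod_in -/(_ 0 (proj_b w.2 i)); rewrite inE.
Qed.

Lemma code_point_dot w i m : ~~ unshaped w i m -> dot (code_point w i m) (code_point w i m) <= nR.
Proof. by move=> /cw_shaping; rewrite inE. Qed.

Lemma index_point_true (b : bool) w (m : bool -> M) :
  ~~ unshaped w false (m false) -> ~~ unshaped w true (m true) ->
  forall t, index_point b w (true_index b w m) t
    = code_point w false (m false) t + code_point w true (m true) t *+ b.
Proof.
move=> /cw_shaping u0 /cw_shaping u1 t; rewrite /index_point /true_index /=.
case: b => /=.
  rewrite !mulr1n /code_point -(grid_point_add q_pr delta_gt0 q_large u0 u1); congr (pt _ t).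
  rewrite /cw /codeword addrACA; congr (_ + _).
  by rewrite /lin_ev -mulmxDl add_row_mx.
by rewrite !mulr0n !addr0.
Qed.

(* Chebyshev's inequality for a vector chosen uniformly in the shaping set. *)
Lemma avg_codewords_far (h : V -> V -> R) (B e : R) (m : bool -> M) : 0 < e ->
  (\sum_(u in S) \sum_(v in S) h u v ^+ 2 <= #|S|%:R ^+ 2 * B) ->
  avg (fun w => (~~ unshaped w false (m false) && ~~ unshaped w true (m true) &&
       (e < `|h (cw w false (m false)) (cw w true (m true))|)%R)%:R)
  <= 4 * (B / e ^+ 2) :> R.
Proof.
move=> e0 hB.
have H := @avg_codewords R _ _ _ _ (@lin_ev q n K kl) (lin_Gam_gt0 q n K kl) S S_gt0 (m false) (m true)
  (fun u v => (e < `|h u v|)%R%:R) (fun _ _ => ler0n _ _).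
apply: (le_trans _ (le_trans H _)); first by apply: ler_avg => w; rewrite -natrM mulnb.
rewrite ler_pM2l//.
rewrite ler_pdivrMr ?exprn_gt0 ?ltr0n// mulrAC ler_pdivlMr ?exprn_gt0//.
apply: (le_trans _ (_ : _ <= B * _)); last by rewrite mulrC; exact: hB.
rewrite mulr_suml; apply: ler_sum => u _; rewrite mulr_suml; apply: ler_sum => v _.
case: ltP => [eh|_]; last by rewrite mul0r sqr_ge0.
by rewrite mul1r -[leRHS]real_normK ?num_real// ler_sqr ?nnegrE ?(ltW e0) ?(ltW eh).
Qed.

Lemma avg_codeword_vec i (b : 'I_n -> R) (e : R) (m : bool -> M) : 0 < e ->
  avg (fun w => (~~ unshaped w false (m false) && ~~ unshaped w true (m true) &&
       (e < `|dot (code_point w i (m i)) b|)%R)%:R)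
  <= 4 * (dot b b / e ^+ 2) :> R.
Proof.
move=> e0.
have := @avg_codewords_far (fun u v => dot (pt (if i then v else u)) b) (dot b b) e m e0.
move=> H; apply: le_trans (H _); first by rewrite /code_point; case: (i).
have D := sum_shaping_dot delta q_pr q_odd b.
case: (i); last first.
  under eq_bigr do rewrite sumr_const; rewrite sumrMnl -[leLHS]mulr_natl expr2 -mulrA.
  by rewrite ler_wpM2l ?ler0n.
rewrite sumr_const -[leLHS]mulr_natl expr2 -mulrA.
by rewrite ler_wpM2l ?ler0n.
Qed.

(** Both codewords come from the same linear map; their independent shifts are enough to make them
    nearly orthogonal. *)
Lemma avg_codeword_pair (e : R) (m : bool -> M) : 0 < e ->
  avg (fun w => (~~ unshaped w false (m false) && ~~ unshaped w true (m true) &&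
       (e < `|dot (code_point w false (m false)) (code_point w true (m true))|)%R)%:R)
  <= 4 * (nR / e ^+ 2) :> R.
Proof.
move=> e0.
apply: (@avg_codewords_far (fun u v => dot (pt u) (pt v)) nR e m e0).
rewrite exchange_big /=; apply: (@le_trans _ _ (\sum_(v in S) #|S|%:R * nR)).
  apply: ler_sum => v vS; apply: le_trans (sum_shaping_dot delta q_pr q_odd _) _.
  by rewrite ler_wpM2l ?ler0n//; move: vS; rewrite inE.
by rewrite sumr_const -[leLHS]mulr_natl mulrA expr2.
Qed.

Section Receiver.
Context {I : finType}.
Variable two : I -> bool.
Variables (g alpha T : I -> R) (C : I -> {set M}) (sq : seq I).
Implicit Types (th : {ffun I -> lcode}) (mu : I -> bool -> M) (z r : 'I_n -> R) (s : I).

Definition layer_point th mu s (t : 'I_n) : R :=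
  code_point (th s) false (mu s false) t + code_point (th s) true (mu s true) t *+ two s.
Definition msg_sum mu s : M := mu s false + mu s true *+ two s.

Definition near_orth (e : R) th mu : bool :=
  [forall p : I * bool, ~~ unshaped (th p.1) p.2 (mu p.1 p.2)] &&
  [forall p : I * bool, forall p' : I * bool, (p != p') ==>
    (`|dot (code_point (th p.1) p.2 (mu p.1 p.2)) (code_point (th p'.1) p'.2 (mu p'.1 p'.2))| <= nR * e)].

Definition index_test s w r a : bool :=
  (a.1 \in C s) &&
  (dot (fun t => alpha s * r t - g s * index_point (two s) w a t)
       (fun t => alpha s * r t - g s * index_point (two s) w a t) <= T s).

Definition find_index s w r : M * L := odflt (0, 0) [pick a | index_test s w r a].

(** A layer of gain zero is skipped and keeps the default value 0; such layers will carry the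
    message 0. *)
Fixpoint successive_decode th (l : seq I) r : {ffun I -> M} :=
  match l with
  | [::] => [ffun=> 0]
  | s :: l' =>
    if g s == 0 then successive_decode th l' r else
    let a := find_index s (th s) r in
    let D := successive_decode th l' (fun t => r t - g s * index_point (two s) (th s) a t) in
    [ffun s' => if s' == s then a.1 else D s']
  end.

(** A layer outside [sq] has index [size sq], so it survives in every residual and is treated as
    noise. *)
Definition residual th mu z (k : nat) (t : 'I_n) : R :=
  \sum_(s | (k <= index s sq)%N) g s * layer_point th mu s t + z t.

(** The test is applied to the residual left when all earlier layers were decoded correctly. So the
    events of different layers can be bounded separately, without following the propagation of
    errors. *)
Definition wrong_index th mu z s : bool :=
  [exists a : M * L, (a != true_index (two s) (th s) (mu s)) &&
     index_test s (th s) (residual th mu z (index s sq)) a].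

(* The residual error of the [alpha]-scaled signal, as a combination of codewords and noise. *)
Definition err_coef s (p : option (I * bool)) : R :=
  match p with
  | None => alpha s
  | Some (s', i) =>
    g s' * (if s' == s then alpha s - 1 else if (index s sq < index s' sq)%N then alpha s else 0)
    * (~~ i || two s')%:R
  end.

(** The bound of [dot_near_orthonormal] for the error coefficients: a squared radius that is sure to
    accept the true index. *)
Definition threshold (e : R) s : R :=
  nR * (\sum_p err_coef s p ^+ 2 + e * (\sum_p err_coef s p ^+ 2 + (\sum_p `|err_coef s p|) ^+ 2)).

Lemma sum_option_pair (F : option (I * bool) -> R) :
  \sum_p F p = F None + \sum_s (F (Some (s, false)) + F (Some (s, true))).
Proof.
rewrite (bigD1 None)//=; congr (_ + _).
rewrite (reindex_omap (fun x => Some x) id) /=; last by case.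
rewrite (eq_bigl xpredT); last by move=> ?; rewrite eqxx.
transitivity (\sum_s \sum_(i : bool) F (Some (s, i))).
  by rewrite pair_bigA; apply: eq_bigr => -[].
by apply: eq_bigr => s _; rewrite big_bool addrC.
Qed.

Lemma find_index_true th mu z s (e : R) : uniq sq -> s \in sq -> 0 <= e ->
  near_orth e th mu ->
  (forall p : I * bool, `|dot (code_point (th p.1) p.2 (mu p.1 p.2)) z| <= nR * e) ->
  dot z z <= nR * (1 + e) ->
  threshold e s <= T s ->
  msg_sum mu s \in C s ->
  ~~ wrong_index th mu z s ->
  find_index s (th s) (residual th mu z (index s sq)) = true_index (two s) (th s) (mu s).
Proof.
move=> uq ssq e0 /andP[/forallP sh /forallP orth] oz zz Ts mC nw.
have pass : index_test s (th s) (residual th mu z (index s sq)) (true_index (two s) (th s) (mu s)).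
  rewrite /index_test mC /=; apply: le_trans Ts.
  pose v (p : option (I * bool)) : 'I_n -> R :=
    if p is Some p then code_point (th p.1) p.2 (mu p.1 p.2) else z.
  have vv : forall p, dot (v p) (v p) <= nR * (1 + e).
    case=> [p|]//=; apply: le_trans (code_point_dot (sh p)) _.
    by rewrite ler_peMr ?(ltW nR_gt0)// lerDl.
  have vo : forall p p', p != p' -> `|dot (v p) (v p')| <= nR * e.
    case=> [p|] [p'|]//=; last by rewrite dotC.
    by move=> pp'; have /forallP/(_ p')/implyP := orth p; apply.
  have := dot_near_orthonormal (err_coef s) (ltW nR_gt0) e0 vv vo.
  apply: le_trans; rewrite le_eqVlt; apply/orP; left; apply/eqP.
  (* In the scaled residual minus the true point, layer [s] has the factor [alpha s - 1], later
     layers and the noise have [alpha s], and earlier layers are absent. *)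
  suff E t : alpha s * residual th mu z (index s sq) t -
      g s * index_point (two s) (th s) (true_index (two s) (th s) (mu s)) t
      = \sum_p err_coef s p * v p t by apply: eq_bigr => t _; rewrite E.
  rewrite index_point_true; [|exact: (sh (s, false))|exact: (sh (s, true))].
  rewrite sum_option_pair [RHS]addrC /residual mulrDr addrAC; congr (_ + _).
  rewrite (bigD1 s)//= [RHS](bigD1 s)//= eqxx mulrDr addrAC; congr (_ + _).
    by rewrite /layer_point; case: (two s); rewrite /= ?mulr1n ?mulr0n; ring.
  rewrite big_mkcondl mulr_sumr; apply: eq_bigr => s' ss'.
  rewrite (negPf ss') leq_eqVlt.
  (* The index determines a member of [sq], and a layer outside has index [size sq], which no member
     attains. *)
  have -> : (index s sq == index s' sq) = false.
    apply/negP => /eqP is'; move: ss'; rewrite -(nth_index s ssq) is'.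
    have [s'sq|/memNindex] := boolP (s' \in sq); first by rewrite nth_index ?eqxx.
    by move=> s'q; move: ssq; rewrite -index_mem is' s'q ltnn.
  case: (ltnP (index s sq)) => _ /=; last by ring.
  by rewrite /layer_point; case: (two s'); rewrite /= ?mulr1n ?mulr0n; ring.
rewrite /find_index; case: pickP => [a ta|/(_ (true_index (two s) (th s) (mu s)))]; last by rewrite pass.
apply/eqP; apply: contraNT nw => aN; apply/existsP; exists a; rewrite ta andbT; exact: aN.
Qed.

Lemma successive_decode_correct th mu z (e : R) : uniq sq -> 0 <= e ->
  near_orth e th mu ->
  (forall p : I * bool, `|dot (code_point (th p.1) p.2 (mu p.1 p.2)) z| <= nR * e) ->
  dot z z <= nR * (1 + e) ->
  (forall s, s \in sq -> g s != 0 -> threshold e s <= T s) ->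
  (forall s, s \in sq -> msg_sum mu s \in C s) ->
  (forall s, s \in sq -> g s = 0 -> msg_sum mu s = 0) ->
  (forall s, s \in sq -> g s != 0 -> ~~ wrong_index th mu z s) ->
  forall s, s \in sq -> successive_decode th sq (residual th mu z 0) s = msg_sum mu s.
Proof.
move=> uq e0 no oz zz Ts mC m0 nw.
have dec_out l r s : s \notin l -> successive_decode th l r s = 0.
  elim: l r => [r _|s1 l IH r] /=; first by rewrite ffunE.
  rewrite inE negb_or => /andP[/negPf ss1 /IH sl]; case: eqP => _; first exact: sl.
  by rewrite ffunE ss1 sl.
(* Induction on the layers still to be decoded; the length of the decoded prefix [p] tells which
   residual is left. *)
suff H : forall l p, p ++ l = sq ->
    forall s, s \in l -> successive_decode th l (residual th mu z (size p)) s = msg_sum mu s.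
  by move=> s ssq; apply: (H sq [::]).
elim=> [//|s0 l IH] p pq s.
have s0sq : s0 \in sq by rewrite -pq mem_cat mem_head orbT.
have is0 : index s0 sq = size p.
  rewrite -pq index_cat; move: uq; rewrite -pq cat_uniq => /and3P[_ /hasPn/(_ s0 (mem_head _ _))].
  by move=> /negPf -> _; rewrite /= eqxx addn0.
have pq' : rcons p s0 ++ l = sq by rewrite cat_rcons.
have step t : residual th mu z (size p) t
    = g s0 * layer_point th mu s0 t + residual th mu z (size (rcons p s0)) t.
  rewrite /residual addrA; congr (_ + _); rewrite (bigD1 s0) ?is0//=; congr (_ + _).
  apply: eq_bigl => s1; rewrite size_rcons ltn_neqAle andbC; congr (_ && _).
  rewrite -is0; apply/idP/idP => [ss|]; last by apply: contraNneq => ->.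
  apply: contraNneq ss => is1; rewrite -(nth_index s0 s0sq) is1.
  have [s'sq|/memNindex] := boolP (s1 \in sq); first by rewrite nth_index ?eqxx.
  by move=> s'q; move: s0sq; rewrite -index_mem is1 s'q ltnn.
rewrite inE /=; have [g0|g0] := eqVneq (g s0) 0.
  have -> : residual th mu z (size p) = residual th mu z (size (rcons p s0)).
    by apply/funext => t; rewrite step g0 mul0r add0r.
  case: (s =P s0) => [-> _|_ /= sl]; last exact: IH.
  have [sl|sl] := boolP (s0 \in l); first exact: IH.
  by rewrite m0 ?dec_out.
rewrite -is0 (find_index_true uq s0sq e0 no oz zz)//; try by [apply: Ts|apply: mC|apply: nw].
rewrite ffunE; case: (s =P s0) => [-> _//|_ /= sl].
rewrite -(IH (rcons p s0) pq' s sl); congr (successive_decode _ _ _ _).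
apply/funext => t; rewrite is0 step.
have /andP[/forallP sh _] := no.
rewrite index_point_true; [|exact: (sh (s0, false))|exact: (sh (s0, true))].
by rewrite [X in X - _]addrC addrK.
Qed.

Let LC_gt0 : (0 < #|lcode|)%N.
Proof. exact: layer_code_gt0 (lin_Gam_gt0 q n K kl). Qed.

Lemma avg_unshaped mu (p : I * bool) :
  avg (fun th => (unshaped (th p.1) p.2 (mu p.1 p.2))%:R) <= 4 / muS.
Proof.
apply: (avg_ffun_le (s := p.1)) LC_gt0 _ => th; under eq_avg do rewrite ffunE eqxx.
apply: avg_sparse; [exact: lin_Gam_gt0|exact: lin_evB|exact: lin_ev_unif|exact: S_gt0].
Qed.

Definition layer_shaped th mu s :=
  ~~ unshaped (th s) false (mu s false) && ~~ unshaped (th s) true (mu s true).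

Lemma avg_noise_far mu z (p : I * bool) (e : R) : 0 < e -> dot z z <= nR * 2 ->
  avg (fun th => (layer_shaped th mu p.1 &&
     (nR * e < `|dot (code_point (th p.1) p.2 (mu p.1 p.2)) z|)%R)%:R) <= 8 / (nR * e ^+ 2).
Proof.
move=> e0 zz; apply: (avg_ffun_le (s := p.1)) LC_gt0 _ => th.
under eq_avg do rewrite /layer_shaped ffunE eqxx.
apply: (le_trans (avg_codeword_vec p.2 z (mu p.1) (mulr_gt0 nR_gt0 e0))).
have -> : 8 / (nR * e ^+ 2) = 4 * (nR * 2 / (nR * e) ^+ 2) by field; rewrite !gt_eqF.
by rewrite ler_pM2l// ler_pM2r ?invr_gt0 ?exprn_gt0 ?mulr_gt0.
Qed.

(** For different layers the second codeword is frozen and plays the fixed vector of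
    [avg_codeword_vec]; two codewords of one layer are treated jointly. *)
Lemma avg_pair_far mu (p p' : I * bool) (e : R) : 0 < e -> p != p' ->
  avg (fun th => (layer_shaped th mu p.1 && layer_shaped th mu p'.1 &&
     (nR * e < `|dot (code_point (th p.1) p.2 (mu p.1 p.2)) (code_point (th p'.1) p'.2 (mu p'.1 p'.2))|)%R)%:R)
  <= 4 / (nR * e ^+ 2).
Proof.
move=> e0 pp'; have ne0 := mulr_gt0 nR_gt0 e0.
have E : 4 * (nR / (nR * e) ^+ 2) = 4 / (nR * e ^+ 2).
  by field; rewrite !gt_eqF.
have far (a b : I * bool) : a.1 != b.1 -> avg (fun th => (layer_shaped th mu a.1 && layer_shaped th mu b.1 &&
     (nR * e < `|dot (code_point (th a.1) a.2 (mu a.1 a.2)) (code_point (th b.1) b.2 (mu b.1 b.2))|)%R)%:R)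
     <= 4 / (nR * e ^+ 2).
  move=> ab; apply: (avg_ffun_le (s := a.1)) LC_gt0 _ => th.
  under eq_avg do rewrite /layer_shaped !ffunE eqxx eq_sym (negPf ab).
  have [/andP[h0 h1]|_] := boolP (~~ unshaped (th b.1) false (mu b.1 false) && ~~ unshaped (th b.1) true (mu b.1 true)); last first.
    under eq_avg do rewrite andbF.
    by rewrite avg_const// divr_ge0// mulr_ge0 ?sqr_ge0 ?ltW.
  under eq_avg do rewrite andbT.
  apply: (le_trans (avg_codeword_vec a.2 _ (mu a.1) ne0)); rewrite -[leRHS]E ler_pM2l//.
  rewrite ler_pM2r ?invr_gt0 ?exprn_gt0//; apply: code_point_dot.
  by case: (b.2).
have [p1|/far] := eqVneq p.1 p'.1; last exact.
have p2 : p.2 = ~~ p'.2.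
  case: p p' pp' p1 => [s i] [s' i'] /= pp' ss'; move: pp'; rewrite ss' xpair_eqE eqxx /=.
  by case: i; case: i'.
apply: (avg_ffun_le (s := p.1)) LC_gt0 _ => th; rewrite -p1.
under eq_avg do rewrite /layer_shaped !ffunE eqxx andbb p2.
rewrite -[leRHS]E; case: (p'.2); rewrite /negb; last first.
  by under eq_avg do rewrite dotC; exact: (avg_codeword_pair (mu p.1) ne0).
exact: (avg_codeword_pair (mu p.1) ne0).
Qed.

Lemma near_orthN mu th (e : R) : ~~ near_orth e th mu ->
  (exists p, unshaped (th p.1) p.2 (mu p.1 p.2)) \/
  (exists p p', [/\ p != p', layer_shaped th mu p.1, layer_shaped th mu p'.1 &
     nR * e < `|dot (code_point (th p.1) p.2 (mu p.1 p.2)) (code_point (th p'.1) p'.2 (mu p'.1 p'.2))|]).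
Proof.
rewrite /near_orth.
case: (boolP [forall p : I * bool, ~~ unshaped (th p.1) p.2 (mu p.1 p.2)]) => [/forallP sh|]; last first.
  by rewrite negb_forall => /existsP[p h] _; left; exists p; move: h; rewrite negbK.
rewrite negb_forall => /existsP[p]; rewrite negb_forall => /existsP[p'].
rewrite negb_imply -ltNge => /andP[pp' far]; right; exists p, p'; split => //.
  by rewrite /layer_shaped (sh (p.1, false)) (sh (p.1, true)).
by rewrite /layer_shaped (sh (p'.1, false)) (sh (p'.1, true)).
Qed.

Lemma near_orth_shaped mu th (e : R) s : near_orth e th mu -> layer_shaped th mu s.
Proof. by move=> /andP[/forallP sh _]; rewrite /layer_shaped (sh (s, false)) (sh (s, true)). Qed.

Lemma avg_wrong_residual mu z s (c : nat) :
  (forall y : 'I_n -> R, (#|[set v : V | (dot (fun t => (y t - g s * pt v t)%R)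
                                      (fun t => (y t - g s * pt v t)%R) <= T s)%R]| <= c)%N) ->
  avg (fun th => (layer_shaped th mu s && wrong_index th mu z s)%:R)
  <= 4 * (#|C s|%:R * #|{: L}|%:R * c%:R / #|{: V}|%:R) :> R.
Proof.
move=> cc; apply: (avg_ffun_le (s := s)) LC_gt0 _ => th.
(* With the other layers frozen, all but layer [s] is the fixed vector [rho]. So the centre of the
   decoding ball depends only on the two codewords of this layer, as [avg_wrong_index] permits. *)
pose rho t := \sum_(s' | (index s sq <= index s' sq)%N && (s' != s)) g s' * layer_point th mu s' t + z t.
pose X u v (t : 'I_n) : R := pt u t + pt v t *+ two s.
pose y u v t := alpha s * (g s * X u v t + rho t).
pose B u v := [set x : V | dot (fun t => (y u v t - g s * pt x t)%R) (fun t => (y u v t - g s * pt x t)%R) <= T s].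
have := @avg_wrong_index R _ _ _ _ (@lin_ev q n K kl)
  (@lin_evB q n K kl) (@lin_ev_unif R q n K kl) S S_gt0 (mu s false) (mu s true) (two s) (C s) B c
  (fun u v => cc _).
apply: le_trans; apply: ler_avg => w; rewrite -natrM mulnb; apply: ler_bool.
rewrite /layer_shaped ffunE eqxx => /andP[sh /existsP[a /andP[aN /andP[aC at_]]]].
apply/andP; split; first exact: sh.
apply/existsP; exists a.
rewrite aC /=; move: aN; rewrite /true_index ffunE eqxx => -> /=.
move: at_; rewrite ffunE eqxx.
have -> : residual [ffun x => if x == s then w else th x] mu z (index s sq)
    = fun t => g s * X (cw w false (mu s false)) (cw w true (mu s true)) t + rho t.
  apply/funext => t; rewrite /residual (bigD1 s)//= -addrA; congr (_ + _).
    by rewrite /layer_point ffunE eqxx.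
  congr (_ + _); apply: eq_bigr => s' /andP[_ ss'].
  by rewrite /layer_point ffunE (negPf ss').
by rewrite inE.
Qed.

(** A union bound over four kinds of failure: too few admissible indices, a codeword correlated with
    the noise, two correlated codewords, a wrong index that passes the test. The last three are
    counted only where shaping has succeeded. *)
Theorem avg_superposition_failure mu z (e : R) (c : I -> nat) : uniq sq -> 0 < e -> e <= 1 ->
  dot z z <= nR * (1 + e) ->
  (forall s, s \in sq -> g s != 0 -> threshold e s <= T s) ->
  (forall s, s \in sq -> msg_sum mu s \in C s) ->
  (forall s, s \in sq -> g s = 0 -> msg_sum mu s = 0) ->
  (forall s, s \in sq -> g s != 0 -> forall y : 'I_n -> R,
     (#|[set v : V | (dot (fun t => (y t - g s * pt v t)%R)
                       (fun t => (y t - g s * pt v t)%R) <= T s)%R]| <= c s)%N) ->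
  avg (fun th => (~~ (near_orth e th mu &&
     [forall s, (s \in sq) ==> (successive_decode th sq (residual th mu z 0) s == msg_sum mu s)]))%:R)
  <= #|{: I * bool}|%:R * (4 / muS + 8 / (nR * e ^+ 2)) + #|{: I * bool}|%:R ^+ 2 * (4 / (nR * e ^+ 2))
     + \sum_(s | (s \in sq) && (g s != 0)) 4 * (#|C s|%:R * #|{: L}|%:R * (c s)%:R / #|{: V}|%:R).
Proof.
move=> uq e0 e1 zz Ts mC m0 cc.
pose E1 p th := unshaped (th p.1) p.2 (mu p.1 p.2).
pose E2 p th := layer_shaped th mu p.1 && (nR * e < `|dot (code_point (th p.1) p.2 (mu p.1 p.2)) z|).
pose E3 (pp : (I * bool) * (I * bool)) th := layer_shaped th mu pp.1.1 && layer_shaped th mu pp.2.1 &&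
     (nR * e < `|dot (code_point (th pp.1.1) pp.1.2 (mu pp.1.1 pp.1.2)) (code_point (th pp.2.1) pp.2.2 (mu pp.2.1 pp.2.2))|).
pose E4 s th := layer_shaped th mu s && wrong_index th mu z s.
apply: (@le_trans _ _ (avg (fun th => \sum_p ((E1 p th)%:R + (E2 p th)%:R)
   + \sum_(pp | pp.1 != pp.2) (E3 pp th)%:R + \sum_(s | (s \in sq) && (g s != 0)) (E4 s th)%:R))).
  apply: ler_avg => th.
  have P1 : 0 <= \sum_p ((E1 p th)%:R + (E2 p th)%:R) :> R by rewrite sumr_ge0// => p _; rewrite addr_ge0.
  have P3 : 0 <= \sum_(pp | pp.1 != pp.2) (E3 pp th)%:R :> R by rewrite sumr_ge0.
  have P4 : 0 <= \sum_(s | (s \in sq) && (g s != 0)) (E4 s th)%:R :> R by rewrite sumr_ge0.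
  have H1 p : E1 p th -> 1 <= \sum_p ((E1 p th)%:R + (E2 p th)%:R) :> R.
    by move=> h; rewrite (bigD1 p)//= h -addrA lerDl addr_ge0 ?ler0n// sumr_ge0// => ? _; rewrite addr_ge0.
  have H2 p : E2 p th -> 1 <= \sum_p ((E1 p th)%:R + (E2 p th)%:R) :> R.
    by move=> h; rewrite (bigD1 p)//= h [_ + 1]addrC -addrA lerDl addr_ge0 ?ler0n// sumr_ge0// => ? _; rewrite addr_ge0.
  have H3 pp : pp.1 != pp.2 -> E3 pp th -> 1 <= \sum_(pp | pp.1 != pp.2) (E3 pp th)%:R :> R.
    by move=> ppN h; rewrite (bigD1 pp)//= h lerDl sumr_ge0.
  have H4 s : s \in sq -> g s != 0 -> E4 s th -> 1 <= \sum_(s | (s \in sq) && (g s != 0)) (E4 s th)%:R :> R.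
    by move=> ssq gs h; rewrite (bigD1 s) ?ssq//= h lerDl sumr_ge0.
  have [_|bad] := boolP (_ && _); first by rewrite !addr_ge0.
  have [no|/near_orthN[[p h]|[p [p' [h1 h2 h3 h4]]]]] := boolP (near_orth e th mu); last 2 first.
  - by have := H1 p h; rewrite /=; lra.
  - have : E3 (p, p') th by rewrite /E3 /= h2 h3 h4.
    by move=> /(H3 (p, p') h1); rewrite /=; lra.
  have [/existsP[p h]|] := boolP [exists p, E2 p th]; first by have := H2 p h; rewrite /=; lra.
  rewrite negb_exists => /forallP n2.
  have [/existsP[s /and3P[h1 h2 h3]]|] := boolP [exists s, [&& s \in sq, g s != 0 & E4 s th]].
    by have := H4 s h1 h2 h3; rewrite /=; lra.
  rewrite negb_exists => /forallP n4.
  move: bad; rewrite no negb_forall => /existsP[s]; rewrite negb_imply => /andP[ssq /negP[]].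
  apply/eqP; apply: (successive_decode_correct uq (ltW e0) no) => //.
  - move=> p; have := n2 p; rewrite /E2 (near_orth_shaped _ no) /= -leNgt.
    by [].
  - move=> s' s'q gs'; have := n4 s'; rewrite s'q gs' /= /E4 (near_orth_shaped _ no).
    by [].
rewrite avgD avgD !avg_sum; apply: lerD; first apply: lerD.
- rewrite -sum_cst; apply: ler_sum => p _; rewrite avgD; apply: lerD; first exact: avg_unshaped.
  by apply: avg_noise_far => //; apply: le_trans zz _; rewrite ler_pM2l//; lra.
- apply: (@le_trans _ _ (\sum_(pp : (I * bool) * (I * bool)) (4 / (nR * e ^+ 2)))); last first.
    by rewrite sum_cst card_prod natrM expr2.
  rewrite big_mkcond; apply: ler_sum => pp _; case: ifP => [ppN|_]; first exact: avg_pair_far.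
  by rewrite divr_ge0// mulr_ge0 ?sqr_ge0 ?ltW.
- by apply: ler_sum => s /andP[ssq gs]; apply: avg_wrong_residual => y; exact: cc.
Qed.

End Receiver.
End Superposition.

From mathcomp Require Import all_classical all_reals all_analysis measurable_realfun.

Local Open Scope classical_set_scope.
Local Open Scope ring_scope.

(** * Gaussian vectors *)

Section GaussianVector.
Context {R : realType} {d : measure_display} {Omega : measurableType d}.
Variable Pr : probability Omega R.

(** Independence is expressed on boxes only, as in [iid_std_gaussian]; the events below are compared
    with finite families of boxes. *)
Definition gaussian_vector (n : nat) (x : 'I_n -> Omega -> R) : Prop :=
  (forall t, measurable_fun setT (x t)) /\
  forall B : 'I_n -> set R, (forall t, measurable (B t)) ->
    Pr [set om | forall t, B t (x t om)] = (\prod_t normal_prob 0 1 (B t))%E.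

Definition nprob (s : R) (B : set R) : R := fine (normal_prob 0 s B).

Lemma nprobE s B : measurable B -> (nprob s B)%:E = normal_prob 0 s B.
Proof. by move=> mB; rewrite /nprob fineK// fin_num_measure. Qed.

Lemma nprob_ge0 s B : 0 <= nprob s B.
Proof. by rewrite /nprob fine_ge0. Qed.

Lemma normal_prob_cmp (s s' : R) (c : R) (A : set R) : measurable A -> 0 <= c ->
  (forall x, A x -> normal_pdf 0 s x <= c * normal_pdf 0 s' x) ->
  nprob s A <= c * nprob s' A.
Proof.
move=> mA c0 h; rewrite -lee_fin EFinM !nprobE// /normal_prob -ge0_integralZl//.
- apply: ge0_le_integral => //.
  + by move=> x _; rewrite lee_fin normal_pdf_ge0.
  + by apply/measurable_EFinP; apply: measurable_funTS; exact: measurable_normal_pdf.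
  + by apply: measurable_funeM; apply/measurable_EFinP; apply: measurable_funTS; exact: measurable_normal_pdf.
- by apply/measurable_EFinP; apply: measurable_funTS; exact: measurable_normal_pdf.
- by move=> x _; rewrite lee_fin normal_pdf_ge0.
Qed.

Lemma nprob_itv_le (a b c : R) : a <= b -> 0 <= c ->
  (forall x, a <= x < b -> normal_pdf 0 1 x <= c) -> nprob 1 `[a, b[ <= c * (b - a).
Proof.
move=> ab c0 h; rewrite -lee_fin nprobE// /normal_prob.
apply: (@le_trans _ _ (\int[lebesgue_measure]_(x in `[a, b[) (cst c%:E x)))%E.
  apply: ge0_le_integral => //.
  + by move=> x _; rewrite lee_fin normal_pdf_ge0.
  + by apply/measurable_EFinP; apply: measurable_funTS; exact: measurable_normal_pdf.
rewrite integral_cst//= lebesgue_measure_itv/= lte_fin.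
by case: ltP => [_|ba]; rewrite -?EFinD -EFinM lee_fin// mulr0 mulr_ge0// subr_ge0.
Qed.

Lemma nprob_itv_ge (a b c : R) : a <= b -> 0 <= c ->
  (forall x, a <= x < b -> c <= normal_pdf 0 1 x) -> c * (b - a) <= nprob 1 `[a, b[.
Proof.
move=> ab c0 h; rewrite -lee_fin nprobE// /normal_prob.
apply: (@le_trans _ _ (\int[lebesgue_measure]_(x in `[a, b[) (cst c%:E x)))%E; last first.
  apply: ge0_le_integral => //.
  by apply/measurable_EFinP; apply: measurable_funTS; exact: measurable_normal_pdf.
rewrite integral_cst//= lebesgue_measure_itv/= lte_fin.
by case: ltP => [_|ba]; rewrite -?EFinD -EFinM lee_fin// ler_wpM2l//; lra.
Qed.

End GaussianVector.

Section FiniteUnions.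
Context {R : realType} {d : measure_display} {T : measurableType d}.

Lemma measure_le_sum (Q : {measure set T -> \bar R}) (K : finType) (P : pred K)
    (A : set T) (B : K -> set T) : measurable A -> (forall k, P k -> measurable (B k)) ->
  (forall x, A x -> exists2 k, P k & B k x) -> (Q A <= \sum_(k | P k) Q (B k))%E.
Proof.
move=> mA mB AB.
have [mU QU] : measurable (\big[setU/set0]_(k | P k) B k) /\
    (Q (\big[setU/set0]_(k | P k) B k) <= \sum_(k | P k) Q (B k))%E.
  elim/big_rec2: _ => [|k S U Pk [mU QU]]; first by rewrite measure0.
  split; first by apply: measurableU => //; exact: mB.
  apply: (le_trans (measureU2 Q (mB k Pk) mU)); exact: leeD2l.
apply: le_trans QU; apply: le_measure; rewrite ?inE// => x /AB[k Pk Bk].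
by rewrite (bigD1 k)//=; left.
Qed.

Lemma sum_measure_disjoint_le (Q : {measure set T -> \bar R}) (K : finType) (P : pred K)
    (A : set T) (B : K -> set T) : measurable A -> (forall k, P k -> measurable (B k)) ->
  (forall k, P k -> B k `<=` A) -> (forall k k' x, B k x -> B k' x -> k = k') ->
  (\sum_(k | P k) Q (B k) <= Q A)%E.
Proof.
move=> mA mB BA dB.
suff H : forall r A', uniq r -> measurable A' ->
    (\sum_(k <- r | P k) Q (B k `&` A') <= Q A')%E.
  apply: le_trans (H (index_enum K) A (index_enum_uniq K) mA).
  by apply: lee_sum => k Pk; rewrite (setIidl (BA k Pk)).
elim=> [|k r IH] A' /=; first by move=> _ _; rewrite big_nil.
move=> /andP[kr ur] mA'; rewrite big_cons; case: ifP => [Pk|_]; last exact: IH.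
have mBk := mB k Pk.
rewrite [leRHS](measureDI _ mA' mBk) addeC [A' `&` _]setIC leeD2r//.
apply: le_trans (IH (A' `\` B k) ur (measurableD mA' mBk)).
rewrite big_seq_cond [leRHS]big_seq_cond; apply: lee_sum => j /andP[jr Pj].
apply: le_measure; rewrite ?inE; [exact: measurableI (mB j Pj) mA'| |].
  by apply: measurableI; [exact: mB|exact: measurableD].
move=> x [Bj A'x]; split => //; split => // Bk.
by move: kr; rewrite (dB _ _ _ Bk Bj) jr.
Qed.

End FiniteUnions.

Section FiniteQuantifiers.
Context {d : measure_display} {T : measurableType d}.

Lemma measurable_forall_fin (K : finType) (B : K -> set T) :
  (forall k, measurable (B k)) -> measurable [set x | forall k, B k x].
Proof.
move=> mB; rewrite (_ : [set x | _] = \bigcap_(k in setT) B k).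
  by apply: fin_bigcap_measurable => //; exact: finite_finset.
by apply/seteqP; split => x h k; [move=> _; exact: h|exact: h].
Qed.

Lemma measurable_exists_fin (K : finType) (P : K -> Prop) (B : K -> set T) :
  (forall k, measurable (B k)) -> measurable [set x | exists2 k, P k & B k x].
Proof.
move=> mB; rewrite (_ : [set x | _] = \bigcup_(k in [set k | P k]) B k).
  by apply: fin_bigcup_measurable => //; exact: finite_finset.
by apply/seteqP; split => x -[k]; exists k.
Qed.

Lemma measurable_set_lt {R : realType} (f g : T -> R) :
  measurable_fun setT f -> measurable_fun setT g -> measurable [set x | f x < g x].
Proof.
by move=> mf mg; have := measurable_fun_ltr mf mg measurableT (Y := [set true]) I; rewrite setTI.
Qed.

Lemma measurable_set_le {R : realType} (f g : T -> R) :
  measurable_fun setT f -> measurable_fun setT g -> measurable [set x | f x <= g x].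
Proof.
by move=> mf mg; have := measurable_fun_ler mf mg measurableT (Y := [set true]) I; rewrite setTI.
Qed.

End FiniteQuantifiers.

(** * Exponential tilting of Gaussian coordinates *)

Section ChernoffBound.
Context {R : realType} {d : measure_display} {Omega : measurableType d}.
Variable Pr : probability Omega R.

(** The constant [(Num.sqrt (1 - 2 * s))^-1] is the moment generating function of the square of a
    standard normal variable. Positive [s] serves the upper tail of the norm, negative [s] the lower
    one. *)
Lemma normal_pdf_tilt (s y : R) : s < 2^-1 ->
  expR (s * y ^+ 2) * normal_pdf 0 1 y
  = (Num.sqrt (1 - 2 * s))^-1 * normal_pdf 0 (Num.sqrt (1 - 2 * s))^-1 y.
Proof.
move=> s2; set v := Num.sqrt _; have v0 : 0 < v by rewrite sqrtr_gt0; lra.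
have vv : v ^+ 2 = 1 - 2 * s by rewrite sqr_sqrtr//; lra.
rewrite !normal_pdfE ?oner_neq0 ?invr_eq0 ?gt_eqF// /normal_peak /normal_fun.
rewrite expr1n mul1r !subr0 exprVn vv.
have -> : Num.sqrt ((1 - 2 * s)^-1 * pi *+ 2) = v^-1 * Num.sqrt (pi *+ 2).
  by rewrite -mulrnAr sqrtrM ?invr_ge0 -?vv ?sqr_ge0// sqrtrV ?sqr_ge0// sqrtr_sqr gtr0_norm.
set c := Num.sqrt (pi *+ 2); have c0 : c != 0.
  by rewrite gt_eqF// sqrtr_gt0 mulrn_wgt0// pi_gt0.
set X := expR (- y ^+ 2 / _); set Y := expR (- y ^+ 2 / _).
have -> : v^-1 * ((v^-1 * c)^-1 * Y) = c^-1 * Y by field; rewrite c0 gt_eqF.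
rewrite mulrCA -expRD; congr (_ * expR _).
by field; rewrite -vv expf_eq0/= gt_eqF.
Qed.

Lemma gaussian_box n (x : 'I_n -> Omega -> R) (B : 'I_n -> set R) :
  gaussian_vector Pr x -> (forall t, measurable (B t)) ->
  Pr [set om | forall t, B t (x t om)] = (\prod_t nprob 1 (B t))%:E.
Proof.
move=> [_ gx] mB; rewrite gx// (big_morph EFin EFinM erefl).
by apply: eq_bigr => t _; rewrite nprobE.
Qed.

Lemma measurable_box n (x : 'I_n -> Omega -> R) (B : 'I_n -> set R) :
  (forall t, measurable_fun setT (x t)) -> (forall t, measurable (B t)) ->
  measurable [set om | forall t, B t (x t om)].
Proof.
move=> mx mB; apply: (measurable_forall_fin (B := fun t => [set om | B t (x t om)])) => t.
by rewrite -[X in measurable X]setTI; exact: mx.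
Qed.

(* Exponential Markov inequality for a discretization of the coordinates into finitely many cells. *)
Lemma chernoff_cells n (x : 'I_n -> Omega -> R) (K : finType) (cell : R -> K) (e : K -> R)
    (s : R) (A : set Omega) (E : R) :
  gaussian_vector Pr x -> s < 2^-1 ->
  (forall k, measurable [set y | cell y = k]) -> (forall k, 0 <= e k) ->
  (forall y, e (cell y) <= expR (s * y ^+ 2)) -> measurable A -> 0 < E ->
  (forall om, A om -> E <= \prod_t e (cell (x t om))) ->
  (Pr A <= ((Num.sqrt (1 - 2 * s))^-1 ^+ n / E)%:E)%E.
Proof.
move=> gx s2 mc e0 ecell mA E0 AE; set v := (Num.sqrt _)^-1.
pose p k := nprob 1 [set y | cell y = k].
pose box (k : {ffun 'I_n -> K}) := [set om | forall t, cell (x t om) = k t].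
have boxE k : Pr (box k) = (\prod_t p (k t))%:E.
  exact: (gaussian_box (B := fun t => [set y | cell y = k t])).
have H : (Pr A <= \sum_(k : {ffun 'I_n -> K} | (E <= \prod_t e (k t))%R) Pr (box k))%E.
  apply: measure_le_sum => //.
    move=> k _; apply: (measurable_box (B := fun t => [set y | cell y = k t])) => //.
    by case: gx.
  move=> om Aom; exists [ffun t => cell (x t om)]; last by move=> t; rewrite ffunE.
  by under eq_bigr do rewrite ffunE; exact: AE.
apply: (le_trans H); under eq_bigr do rewrite boxE; rewrite sumEFin lee_fin.
rewrite ler_pdivlMr// mulr_suml.
apply: (@le_trans _ _ (\sum_(k : {ffun 'I_n -> K}) \prod_t (e (k t) * p (k t)))).
  rewrite [leLHS]big_mkcond; apply: ler_sum => k _.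
  have pp : 0 <= \prod_t p (k t) by rewrite prodr_ge0// => t _; rewrite nprob_ge0.
  case: ifP => [Ek|_]; last by rewrite prodr_ge0// => t _; rewrite mulr_ge0// nprob_ge0.
  by rewrite big_split/= mulrC ler_wpM2r.
rewrite -(bigA_distr_bigA (fun _ k => e k * p k)) /= prodr_const card_ord.
have v0 : 0 <= v by rewrite invr_ge0 sqrtr_ge0.
apply: lerXn2r; rewrite ?nnegrE//.
  by rewrite sumr_ge0// => k _; rewrite mulr_ge0 ?nprob_ge0.
apply: (@le_trans _ _ (\sum_k v * nprob v [set y | cell y = k])).
  apply: ler_sum => k _; have [ek|ek] := eqVneq (e k) 0.
    by rewrite ek mul0r mulr_ge0 ?nprob_ge0// invr_ge0 sqrtr_ge0.
  have ek0 : 0 < e k by rewrite lt_def ek e0.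
  rewrite -ler_pdivlMl// mulrA; apply: normal_prob_cmp => //.
    by rewrite mulr_ge0 ?invr_ge0 ?sqrtr_ge0.
  move=> y /= yk; rewrite -mulrA -normal_pdf_tilt// ler_pdivlMl//.
  by rewrite ler_wpM2r ?normal_pdf_ge0// -yk.
rewrite -mulr_sumr ler_piMr ?invr_ge0 ?sqrtr_ge0//.
rewrite -lee_fin -sumEFin; under eq_bigr do rewrite nprobE//.
rewrite -(@probability_setT _ _ _ (normal_prob 0 v)).
apply: sum_measure_disjoint_le.
- exact: measurableT.
- by move=> k _; exact: mc.
- by [].
- by move=> k k' y /= <- <-.
Qed.

End ChernoffBound.

(** * Concentration of the norm of a Gaussian vector *)

Section NormConcentration.
Context {R : realType} {d : measure_display} {Omega : measurableType d}.
Variable Pr : probability Omega R.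

(** Young's inequality, used against rounding errors: if [c] is of order [eta], then both the factor
    [1 + eta] and the term [(1 + eta^-1) * c ^+ 2] cost only order [eta]. *)
Lemma sqrD_le (eta a c : R) : 0 < eta ->
  (a + c) ^+ 2 <= (1 + eta) * a ^+ 2 + (1 + eta^-1) * c ^+ 2.
Proof.
move=> e0; rewrite -subr_ge0.
have -> : (1 + eta) * a ^+ 2 + (1 + eta^-1) * c ^+ 2 - (a + c) ^+ 2 = (eta * a - c) ^+ 2 / eta.
  by field; rewrite gt_eqF.
by rewrite divr_ge0 ?sqr_ge0 ?ltW.
Qed.

Lemma sqr_mono (a b : R) : 0 <= a -> a <= b -> a ^+ 2 <= b ^+ 2.
Proof. by move=> a0 ab; nra. Qed.

(** Absolute values are rounded down to multiples of [delta]. The last cell collects everything from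
    [delta * N] on, which makes the cells finite in number. *)
Definition abs_cell (delta : R) (N : nat) (y : R) : 'I_N.+1 :=
  inord (minn N (Num.truncn (`|y| / delta))).

Lemma val_abs_cell delta N y : val (abs_cell delta N y) = minn N (Num.truncn (`|y| / delta)).
Proof. by rewrite /abs_cell /= inordK// ltnS geq_minl. Qed.

Lemma measurable_abs_cell delta N (k : 'I_N.+1) : 0 < delta ->
  measurable [set y | abs_cell delta N y = k].
Proof.
move=> d0; have mf : measurable_fun [set: R] (fun y : R => `|y| / delta).
  by apply: measurable_funM => //; exact: measurable_normr.
have y0 (y : R) : 0 <= `|y| / delta by rewrite divr_ge0// ltW.
rewrite (_ : [set y | _] = (fun y : R => `|y| / delta) @^-1` `[k%:R, +oo[ `&`
    (if (k < N)%N then (fun y : R => `|y| / delta) @^-1` `]-oo, k.+1%:R[ else setT)).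
  apply: measurableI; last case: ifP => _ //.
    by rewrite -[X in measurable X]setTI; apply: mf => //; exact: measurable_itv.
  by rewrite -[X in measurable X]setTI; apply: mf => //; exact: measurable_itv.
apply/seteqP; split => y /=; rewrite in_itv /= andbT -truncn_ge_nat//.
  move=> yk; have := val_abs_cell delta N y; rewrite yk /= => kE.
  split; first by rewrite kE geq_minr.
  case: ifP => // kN; rewrite /= in_itv /= -truncn_lt_nat// ltnS.
  by move: kN; rewrite kE gtn_min ltnn /= => /ltnW/minn_idPr ->.
move=> [ky]; case: ifP => kN /= h; apply/val_inj; rewrite val_abs_cell.
  move: h; rewrite in_itv /= -truncn_lt_nat// ltnS => h.
  have /eqP <- : (val k == Num.truncn (`|y| / delta)) by rewrite eqn_leq ky h.
  exact/minn_idPr/ltnW.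
have kE : val k = N by apply/eqP; rewrite eqn_leq -ltnS ltn_ord leqNgt kN.
by rewrite kE; apply/minn_idPl; rewrite -[X in (X <= _)%N]kE.
Qed.

Lemma abs_cell_le delta N y : 0 < delta -> delta * (abs_cell delta N y)%:R <= `|y|.
Proof.
move=> d0; rewrite val_abs_cell mulrC -ler_pdivlMr//.
apply: (@le_trans _ _ (Num.truncn (`|y| / delta))%:R); first by rewrite ler_nat geq_minr.
by rewrite truncn_le divr_ge0// ltW.
Qed.

Lemma abs_cell_lt delta N y : 0 < delta -> (abs_cell delta N y < N)%N ->
  `|y| < delta * (abs_cell delta N y).+1%:R.
Proof.
move=> d0; rewrite val_abs_cell gtn_min ltnn => /= h.
rewrite (minn_idPr (ltnW h)) mulrC -ltr_pdivrMr//.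
by have /andP[_] := truncn_itv (divr_ge0 (normr_ge0 y) (ltW d0)).
Qed.

Lemma abs_cell_max delta N y : 0 < delta -> `|y| < delta * N%:R -> (abs_cell delta N y < N)%N.
Proof.
move=> d0 yN; rewrite val_abs_cell gtn_min ltnn /=.
by rewrite truncn_lt_nat ?divr_ge0 ?(ltW d0)// ltr_pdivrMr// mulrC.
Qed.

Lemma measurable_norm_sqr n (x : 'I_n -> Omega -> R) :
  (forall t, measurable_fun setT (x t)) -> measurable_fun setT (fun om => \sum_t x t om ^+ 2).
Proof. by move=> mx; apply: measurable_sum => t; apply: measurable_funX. Qed.

Lemma invsqrt_le_expR (s w : R) : s < 2^-1 -> 1 <= (1 - 2 * s) * expR (2 * w) ->
  (Num.sqrt (1 - 2 * s))^-1 <= expR w.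
Proof.
move=> s2 h; have v0 : 0 < Num.sqrt (1 - 2 * s) by rewrite sqrtr_gt0; lra.
rewrite -[leLHS]mul1r ler_pdivrMr//.
have : 1 ^+ 2 <= (expR w * Num.sqrt (1 - 2 * s)) ^+ 2.
  rewrite expr1n exprMn sqr_sqrtr; last lra.
  by rewrite mulrC -expRM_natl.
by rewrite ler_pXn2r ?nnegrE ?mulr_ge0 ?expR_ge0 ?sqrtr_ge0.
Qed.

Lemma gaussian_norm_upper (eps : R) : 0 < eps -> eps <= 1 -> exists2 c : R, 0 < c &
  forall n (x : 'I_n -> Omega -> R), gaussian_vector Pr x ->
    (Pr [set om | (n%:R * (1 + eps) < \sum_t x t om ^+ 2)%R] <= (expR (- c * n%:R))%:E)%E.
Proof.
(* Half of [eps] is reserved for rounding with step [eps / 8]. The tilt [s] is a small multiple of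
   [e2], so that the gain [s * e2] outweighs the terms quadratic in [s]; half of the gain remains as
   exponent. *)
move=> e0 e1; pose e2 := eps / 2; pose s := e2 / 8; pose delta := eps / 8.
have d0 : 0 < delta by rewrite /delta; lra.
have s0 : 0 < s by rewrite /s /e2; lra.
exists (s * e2 / 2); first by rewrite /s /e2; nra.
move=> n x gx; have mx := gx.1.
(* The cells reach up to [2 * n]: a single coordinate in the last one already exceeds the required
   norm, so rounding it down does no harm. *)
have [N N2] : exists N : nat, n%:R * 2 <= delta * N%:R.
  exists (Num.truncn (n%:R * 2 / delta)).+1; rewrite [leRHS]mulrC -ler_pdivrMr//.
  apply: ltW; by have /andP[_] := truncn_itv (divr_ge0 (mulr_ge0 (ler0n R n) (ler0n R 2)) (ltW d0)).
have s2 : s < 2^-1 by rewrite /s /e2; lra.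
have n0 : 0 <= n%:R :> R by [].
apply: (le_trans (@chernoff_cells _ _ _ _ _ x _ (abs_cell delta N)
   (fun k => expR (s * (delta * k%:R) ^+ 2)) s _ (expR (s * (n%:R * (1 + e2)))) gx s2 _ _ _ _ _ _)).
- by move=> k; exact: measurable_abs_cell.
- by move=> k; exact: expR_ge0.
- move=> y; rewrite ler_expR ler_pM2l// -[y ^+ 2]real_normK ?num_real//.
  by apply: sqr_mono; rewrite ?abs_cell_le// mulr_ge0// ltW.
- by apply: measurable_set_lt => //; exact: measurable_norm_sqr.
- exact: expR_gt0.
- move=> om /= A; rewrite -expR_sum ler_expR -mulr_sumr ler_pM2l//.
  have [/existsP[t tN]|] := boolP [exists t, abs_cell delta N (x t om) == ord_max].
    rewrite (bigD1 t)//= (eqP tN) /=; apply: (@le_trans _ _ ((delta * N%:R) ^+ 2)); last first.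
      by rewrite lerDl sumr_ge0// => i _; rewrite sqr_ge0.
    apply: (@le_trans _ _ ((n%:R * 2) ^+ 2)); last by apply: sqr_mono; rewrite ?mulr_ge0.
    have n1 : 1 <= n%:R :> R by rewrite ler1n; case: (t) => m /= /(leq_ltn_trans (leq0n _)).
    by rewrite /e2; nra.
  rewrite negb_exists => /forallP lt_cell.
  have H t : x t om ^+ 2 <= (1 + eps / 8) * (delta * (abs_cell delta N (x t om))%:R) ^+ 2
       + (1 + (eps / 8)^-1) * delta ^+ 2.
    apply: (le_trans _ (sqrD_le _ _ _)); last lra.
    rewrite -[x t om ^+ 2]real_normK ?num_real//; apply: sqr_mono => //.
    rewrite -[X in _ + X]mulr1 -mulrDr natr1 ltW// abs_cell_lt//.
    by rewrite ltn_neqAle -ltnS ltn_ord andbT; have := lt_cell t.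
  have : \sum_t x t om ^+ 2 <= (1 + eps / 8) * \sum_t (delta * (abs_cell delta N (x t om))%:R) ^+ 2
       + n%:R * ((1 + (eps / 8)^-1) * delta ^+ 2).
    rewrite mulr_sumr (_ : n%:R * _ = \sum_(t < n) (1 + (eps / 8)^-1) * delta ^+ 2).
      by rewrite -big_split; apply: ler_sum => t _; exact: H.
    by rewrite sum_cst card_ord.
  set S := \sum_(t < n) (delta * _) ^+ 2 => HS.
  have : (1 + (eps / 8)^-1) * delta ^+ 2 <= 9 * eps / 64.
    rewrite /delta (_ : (1 + (eps / 8)^-1) * (eps / 8) ^+ 2 = (eps / 8) ^+ 2 + eps / 8); first nra.
    by field; rewrite gt_eqF.
  move=> HD; rewrite -subr_ge0.
  have : 0 <= n%:R * (9 * eps / 64 - (1 + (eps / 8)^-1) * delta ^+ 2) by rewrite mulr_ge0// subr_ge0.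
  have : 0 <= n%:R * eps * (1 - eps) by rewrite mulr_ge0 ?subr_ge0// mulr_ge0// ltW.
  have : 0 <= n%:R * eps by rewrite mulr_ge0// ltW.
  rewrite /e2 => p1 p2 p3.
  have : 0 <= (1 + eps / 8) * (S - n%:R * (1 + eps / 2)) by nra.
  by rewrite pmulr_rge0//; lra.
rewrite lee_fin ler_pdivrMr ?expR_gt0// -expRD.
rewrite (_ : - _ * _ + _ = (s * (1 + e2 / 2)) * n%:R); last by field.
rewrite expRM_natr; apply: lerXn2r; rewrite ?nnegrE ?expR_ge0 ?invr_ge0 ?sqrtr_ge0//.
apply: invsqrt_le_expR => //.
apply: (@le_trans _ _ ((1 - 2 * s) * (1 + 2 * (s * (1 + e2 / 2))))).
  rewrite /s /e2; nra.
by rewrite ler_pM2l ?expR_ge1Dx//; lra.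
Qed.

Lemma gaussian_norm_lower (eps : R) : 0 < eps -> eps <= 1 -> exists2 c : R, 0 < c &
  forall n (x : 'I_n -> Omega -> R), gaussian_vector Pr x ->
    (Pr [set om | (\sum_t x t om ^+ 2 < n%:R * (1 - eps))%R] <= (expR (- c * n%:R))%:E)%E.
Proof.
move=> e0 e1; pose e2 := eps / 2; pose u := e2 / 4; pose delta := eps / 8.
have d0 : 0 < delta by rewrite /delta; lra.
have u0 : 0 < u by rewrite /u /e2; lra.
exists (u * e2 / 2); first by rewrite /u /e2; nra.
move=> n x gx; have mx := gx.1.
have [N N2] : exists N : nat, n%:R * 2 <= delta * N%:R.
  exists (Num.truncn (n%:R * 2 / delta)).+1; rewrite [leRHS]mulrC -ler_pdivrMr//.
  apply: ltW; by have /andP[_] := truncn_itv (divr_ge0 (mulr_ge0 (ler0n R n) (ler0n R 2)) (ltW d0)).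
have s2 : - u < 2^-1 by lra.
have n0 : 0 <= n%:R :> R by [].
(* The tilt is negative, so cells are rounded up. The last cell has no upper end and gets weight 0;
   on the event considered no coordinate lies in it. *)
pose e (k : 'I_N.+1) : R := if k == ord_max then 0 else expR (- u * (delta * k.+1%:R) ^+ 2).
have ltN (k : 'I_N.+1) : k != ord_max -> (k < N)%N.
  by move=> kN; rewrite ltn_neqAle -ltnS ltn_ord andbT.
apply: (le_trans (@chernoff_cells _ _ _ _ _ x _ (abs_cell delta N)
   e (- u) _ (expR (- u * (n%:R * (1 - e2)))) gx s2 _ _ _ _ _ _)).
- by move=> k; exact: measurable_abs_cell.
- by move=> k; rewrite /e; case: ifP => // _; exact: expR_ge0.
- move=> y; rewrite /e; case: eqVneq => [_|/ltN kN]; first exact: expR_ge0.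
  rewrite ler_expR ler_nM2l ?oppr_lt0// -[y ^+ 2]real_normK ?num_real//.
  by apply: sqr_mono; rewrite // ltW// abs_cell_lt.
- by apply: measurable_set_lt => //; exact: measurable_norm_sqr.
- exact: expR_gt0.
- move=> om /= A.
  have kN t : abs_cell delta N (x t om) != ord_max.
    have : (abs_cell delta N (x t om) < N)%N.
      apply: abs_cell_max => //; apply: lt_le_trans N2.
      have n1 : 1 <= n%:R :> R by rewrite ler1n; case: (t) => m /= /(leq_ltn_trans (leq0n _)).
      rewrite -(@ltr_pXn2r _ 2)// ?nnegrE ?mulr_ge0// real_normK ?num_real//.
      apply: (@le_lt_trans _ _ (\sum_t x t om ^+ 2)).
        by rewrite (bigD1 t)//= lerDl sumr_ge0// => i _; rewrite sqr_ge0.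
      by apply: (lt_le_trans A); nra.
    by apply: contraTneq => ->; rewrite ltnn.
  under eq_bigr do rewrite /e (negPf (kN _)).
  rewrite -expR_sum ler_expR -mulr_sumr ler_nM2l ?oppr_lt0//.
  have H t : (delta * (abs_cell delta N (x t om)).+1%:R) ^+ 2 <= (1 + eps / 8) * x t om ^+ 2
       + (1 + (eps / 8)^-1) * delta ^+ 2.
    rewrite -[x t om ^+ 2]real_normK ?num_real//.
    apply: (le_trans _ (sqrD_le _ _ _)); last lra.
    apply: sqr_mono; first by rewrite mulr_ge0// ltW.
    by rewrite -natr1 mulrDr mulr1 lerD2r abs_cell_le.
  have : \sum_t (delta * (abs_cell delta N (x t om)).+1%:R) ^+ 2 <= (1 + eps / 8) * \sum_t x t om ^+ 2
       + n%:R * ((1 + (eps / 8)^-1) * delta ^+ 2).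
    rewrite mulr_sumr (_ : n%:R * _ = \sum_(t < n) (1 + (eps / 8)^-1) * delta ^+ 2).
      by rewrite -big_split; apply: ler_sum => t _; exact: H.
    by rewrite sum_cst card_ord.
  have : (1 + (eps / 8)^-1) * delta ^+ 2 <= 9 * eps / 64.
    rewrite /delta (_ : (1 + (eps / 8)^-1) * (eps / 8) ^+ 2 = (eps / 8) ^+ 2 + eps / 8); first nra.
    by field; rewrite gt_eqF.
  move=> HD HS; apply: (le_trans HS).
  have : 0 <= n%:R * (9 * eps / 64 - (1 + (eps / 8)^-1) * delta ^+ 2) by rewrite mulr_ge0// subr_ge0.
  have : 0 <= n%:R * eps * (1 - eps) by rewrite mulr_ge0 ?subr_ge0// mulr_ge0// ltW.
  have : 0 <= n%:R * eps by rewrite mulr_ge0// ltW.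
  have : 0 <= n%:R * eps * eps by rewrite !mulr_ge0// ltW.
  have : 0 <= (1 + eps / 8) * (n%:R * (1 - eps) - \sum_t x t om ^+ 2) by rewrite mulr_ge0//; lra.
  by rewrite /e2 => p1 p2 p3 p4; lra.
rewrite lee_fin ler_pdivrMr ?expR_gt0// -expRD.
rewrite (_ : - _ * _ + _ = (- u * (1 - e2 / 2)) * n%:R); last by field.
rewrite expRM_natr; apply: lerXn2r; rewrite ?nnegrE ?expR_ge0 ?invr_ge0 ?sqrtr_ge0//.
apply: invsqrt_le_expR => //.
apply: (@le_trans _ _ ((1 - 2 * - u) * (1 + 2 * (- u * (1 - e2 / 2))))).
  rewrite /u /e2; nra.
by rewrite ler_pM2l ?expR_ge1Dx//; lra.
Qed.

End NormConcentration.

(** * Volume of the shaping set *)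

Section Volume.
Context {R : realType} {d : measure_display} {Omega : measurableType d}.
Variable Pr : probability Omega R.
Variables (n q : nat) (x : 'I_n -> Omega -> R) (eta : R).
Hypothesis gx : gaussian_vector Pr x.
Hypothesis q_pr : prime q.
Hypothesis eta_gt0 : 0 < eta.
Hypothesis eta_le1 : eta <= 1.

(** Gaussian coordinates are rounded to multiples of [eta], while the grid has the smaller step
    [delta]. The factor [1 + 5 * eta] makes up for the thickness of the shell and the rounding, so
    that rounded points of the shell land in the ball of squared radius [n]. *)
Definition grid_step : R := eta / Num.sqrt (1 + 5 * eta).
Local Notation delta := grid_step.
Local Notation V := 'rV['F_q]_n.

Hypothesis q_large : 16 * n%:R < (delta * q%:R) ^+ 2.

Definition shell : set Omega :=
  [set om | n%:R * (1 - eta) <= \sum_t x t om ^+ 2 <= n%:R * (1 + eta)].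

Hypothesis shell_prob : (2^-1%:E <= Pr shell)%E.

Let peak : R := normal_peak 1.
Let peak_gt0 : 0 < peak. Proof. by rewrite normal_peak_gt0// oner_neq0. Qed.

Lemma std_normal_pdfE y : normal_pdf 0 1 y = peak * expR (- y ^+ 2 / 2).
Proof. by rewrite normal_pdfE ?oner_neq0// /normal_fun subr0 expr1n. Qed.

Lemma grid_step_gt0 : 0 < delta.
Proof. by rewrite divr_gt0// sqrtr_gt0; move: eta_gt0; lra. Qed.

Lemma grid_step_sqr : delta ^+ 2 * (1 + 5 * eta) = eta ^+ 2.
Proof.
rewrite /delta expr_div_n sqr_sqrtr; last by move: eta_gt0; lra.
by rewrite divfK// gt_eqF//; move: eta_gt0; lra.
Qed.

Lemma measurable_shell : measurable shell.
Proof.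
have mx := gx.1.
rewrite (_ : shell = [set om | n%:R * (1 - eta) <= \sum_t x t om ^+ 2] `&`
   [set om | \sum_t x t om ^+ 2 <= n%:R * (1 + eta)]).
  by apply: measurableI; apply: measurable_set_le => //; exact: measurable_norm_sqr.
by apply/seteqP; split => om; [move=> /andP[]|move=> [h1 h2]; apply/andP].
Qed.

Let bc (u : V) t : set R := `[eta * (clift (u 0 t))%:~R, eta * (clift (u 0 t) + 1)%:~R[%classic.
Let box (u : V) : set Omega := [set om | forall t, bc u t (x t om)].

Let mbox u : measurable (box u).
Proof. by apply: (measurable_box (B := bc u)) => [|t]; [case: gx|exact: measurable_itv]. Qed.

Lemma shell_cover om : shell om -> exists2 u, u \in shaping q n delta & box u om.
Proof.
move=> /andP[_ sh].
pose k t : int := Num.floor (x t om / eta).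
have kx t : eta * (k t)%:~R <= x t om < eta * (k t + 1)%:~R.
  have := floor_itv (x t om / eta); rewrite -/(k t).
  by rewrite ler_pdivlMr// ltr_pdivrMr// ![_ * eta]mulrC.
have kS : \sum_t (delta * (k t)%:~R) ^+ 2 <= n%:R.
  have D1 : 0 < 1 + 5 * eta by move: eta_gt0; lra.
  rewrite -(ler_pM2r D1) mulr_suml.
  apply: (@le_trans _ _ (\sum_t ((1 + eta) * x t om ^+ 2 + (eta ^+ 2 + eta)))).
    apply: ler_sum => t _; rewrite exprMn mulrAC grid_step_sqr -exprMn.
    have := sqrD_le (x t om) (eta * (k t)%:~R - x t om) eta_gt0; rewrite addrC subrK.
    move=> /le_trans; apply; rewrite lerD2l.
    have -> : eta ^+ 2 + eta = (1 + eta^-1) * eta ^+ 2 by field; rewrite gt_eqF.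
    rewrite ler_wpM2l ?addr_ge0 ?invr_ge0 ?(ltW eta_gt0)// -[leLHS]real_normK ?num_real//.
    apply: sqr_mono => //; rewrite ler_norml; move: (kx t); rewrite intrD mulrDr mulr1.
    by move=> /andP[h1 h2]; apply/andP; split; move: eta_gt0; lra.
  rewrite big_split /= -mulr_sumr sum_cst card_ord.
  have := ler_wpM2l (ltW (addr_gt0 ltr01 eta_gt0)) sh.
  have : 0 <= n%:R * (eta * (1 - eta)) by rewrite !mulr_ge0 ?subr_ge0// ltW.
  by lra.
have kq t : (2 * `|k t| < q)%N.
  have : (delta * (k t)%:~R) ^+ 2 <= n%:R.
    by apply: le_trans kS; rewrite (bigD1 t)//= lerDl sumr_ge0// => i _; rewrite sqr_ge0.
  have ql : 16 * n%:R < delta ^+ 2 * q%:R ^+ 2 by rewrite -exprMn.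
  rewrite -[_ ^+ 2]/((delta * (k t)%:~R) ^+ 2) exprMn => h.
  have : delta ^+ 2 * (16 * (k t)%:~R ^+ 2) < delta ^+ 2 * q%:R ^+ 2.
    by apply: le_lt_trans ql; lra.
  rewrite ltr_pM2l ?exprn_gt0 ?grid_step_gt0// -[_%:~R ^+ 2]real_normK ?num_real//.
  rewrite -intr_norm -natr_absz => h2.
  rewrite -(ltr_nat R) -(@ltr_pXn2r _ 2) ?nnegrE ?ler0n//.
  by apply: le_lt_trans h2; rewrite natrM exprMn; have := sqr_ge0 (`|k t|%N%:R : R); lra.
exists (\row_t (k t)%:~R).
  rewrite inE dot_sqr; apply: le_trans kS; rewrite le_eqVlt; apply/orP; left; apply/eqP.
  by apply: eq_bigr => t _; rewrite /grid_point mxE clift_id.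
by move=> t; rewrite /bc /= mxE clift_id// in_itv /= kx.
Qed.

(** A bound for the geometric mean of the cell probabilities of a box that meets the shell;
    [4 * eta] collects the thickness of the shell and the variation of the density within a cell. *)
Let dens : R := eta * (peak * expR (- (1 - 4 * eta) / 2)).

Lemma shell_box_prob u : (Pr (shell `&` box u) <= (dens ^+ n)%:E)%E.
Proof.
have [->|/set0P[om [sh bo]]] := eqVneq (shell `&` box u) set0.
  by rewrite measure0 lee_fin exprn_ge0// mulr_ge0 ?mulr_ge0 ?expR_ge0 ?ltW.
apply: (@le_trans _ _ (Pr (box u))).
  apply: le_measure; rewrite ?inE; [|exact: mbox|exact: subIsetr].
  by apply: measurableI; [exact: measurable_shell|exact: mbox].
rewrite (gaussian_box (B := bc u) gx); last by move=> t; exact: measurable_itv.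
rewrite lee_fin.
pose z t := x t om.
pose b t : R := eta * (peak * expR (- ((z t ^+ 2 - (eta ^+ 2 + eta)) / (1 + eta)) / 2)).
have e1 : 0 < 1 + eta by move: eta_gt0; lra.
apply: (@le_trans _ _ (\prod_t b t)).
  apply: ler_prod => t _; rewrite nprob_ge0 /b mulrC /=.
  rewrite [X in _ <= _ * X](_ : eta = eta * (clift (u 0 t) + 1)%:~R - eta * (clift (u 0 t))%:~R); last first.
    by rewrite intrD mulrDr mulr1 addrC addKr.
  apply: nprob_itv_le.
  - by rewrite ler_pM2l// ler_int lerDl.
  - by rewrite mulr_ge0 ?expR_ge0 ?ltW.
  - move=> y ycell; rewrite std_normal_pdfE ler_pM2l// ler_expR.
    rewrite !mulNr lerN2 ler_pM2r ?invr_gt0// ler_pdivrMr//.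
    have := bo t; rewrite /bc /= in_itv /= -/(z t) => zcell.
    have := sqrD_le y (z t - y) eta_gt0; rewrite addrC subrK.
    suff : (z t - y) ^+ 2 <= eta ^+ 2.
      have -> : eta ^+ 2 + eta = (1 + eta^-1) * eta ^+ 2 by field; rewrite gt_eqF.
      move=> h; have := ler_wpM2l (_ : 0 <= 1 + eta^-1) h.
      by rewrite addr_ge0 ?invr_ge0 ?(ltW eta_gt0)// => /(_ isT); lra.
    rewrite -[leLHS]real_normK ?num_real//; apply: sqr_mono => //.
    move: zcell ycell; rewrite intrD mulrDr mulr1 ler_norml.
    by move=> /andP[h1 h2] /andP[h3 h4]; apply/andP; split; lra.
rewrite /b /dens !big_split /= !prodr_const !card_ord -expR_sum.
rewrite !exprMn ler_pM2l ?exprn_gt0// ler_pM2l ?exprn_gt0// -expRM_natr ler_expR.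
rewrite -mulr_suml [leRHS]mulrAC ler_pM2r ?invr_gt0// sumrN -mulr_suml mulNr lerN2.
rewrite ler_pdivlMr// sumrB sum_cst card_ord.
have /andP[h _] := sh.
have : 0 <= n%:R * (eta * (1 - eta)) by rewrite !mulr_ge0 ?subr_ge0// ltW.
have : 0 <= n%:R * (eta * eta) by rewrite !mulr_ge0// ltW.
have : 0 <= n%:R * eta by rewrite !mulr_ge0// ltW.
rewrite -/(z _) in h *; move: h; rewrite -/z => h p1 p2 p3.
by lra.
Qed.

(** The shell carries at least half of the mass and is covered by the boxes of the shaping points,
    each of mass at most [dens ^+ n]. So there must be many of them. *)
Lemma shaping_card_ge : 1 <= 2 * #|shaping q n delta|%:R * dens ^+ n.
Proof.
have H : (Pr shell <= \sum_(u in shaping q n delta) Pr (shell `&` box u))%E.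
  apply: measure_le_sum; first exact: measurable_shell.
    by move=> u _; apply: measurableI; [exact: measurable_shell|exact: mbox].
  by move=> om so; have [u uS bu] := shell_cover so; exists u.
have := le_trans shell_prob (le_trans H (lee_sum _ (fun u _ => shell_box_prob u))).
rewrite sumEFin lee_fin sumr_const -[leRHS]mulr_natl -mulrA.
by rewrite -(@ler_pM2l _ 2)// mulfV.
Qed.

(** The opposite count: after centring the ball and scaling it to squared radius [n], the boxes at
    its grid points are disjoint. Their masses add up to at most 1, and each is bounded below
    because its corner lies in the ball. *)
Lemma ball_card_le (y : 'I_n -> R) (g T : R) : 0 < g -> 0 < T ->
  #|[set v : V | dot (fun t => y t - g * grid_point delta v t) (fun t => y t - g * grid_point delta v t) <= n%:R * T]%SET|%:R
  * (g * delta / Num.sqrt T *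
     (peak * expR (- ((1 + eta) + (1 + eta^-1) * (g * delta / Num.sqrt T) ^+ 2) / 2))) ^+ n <= 1.
Proof.
move=> g0 T0; set A := [set v | _]%SET; set s := Num.sqrt T; set kap := g * delta / s.
have s0 : 0 < s by rewrite sqrtr_gt0.
have d0 := grid_step_gt0.
have kapE : kap = g * delta / s by [].
clearbody kap; have kap0 : 0 < kap by rewrite kapE divr_gt0// mulr_gt0.
pose a (v : V) t : R := (g * grid_point delta v t - y t) / s.
pose B (v : V) t : set R := `[a v t, a v t + kap[%classic.
pose bx v := [set om | forall t, B v t (x t om)].
have mbx v : measurable (bx v).
  by apply: (measurable_box (B := B v)) => [|t]; [case: gx|exact: measurable_itv].
have : (\sum_(v in A) Pr (bx v) <= 1)%E.
  rewrite -(@probability_setT _ _ _ Pr); apply: sum_measure_disjoint_le => //.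
  move=> v v' om bv bv'; apply/rowP => t; apply: (clift_inj q_pr).
  have aE w : a w t = kap * (clift (w 0 t))%:~R - y t / s.
    by rewrite /a /grid_point kapE; field; rewrite gt_eqF.
  have := bv t; have := bv' t; rewrite /B /= !in_itv /= !aE => /andP[h1 h2] /andP[h3 h4].
  have H (i j : int) : kap * i%:~R < kap * j%:~R + kap -> i <= j.
    by rewrite -[X in _ < _ + X]mulr1 -mulrDr ltr_pM2l// -(intrD _ _ 1) ltr_int ltzD1.
  by apply/eqP; rewrite eq_le; apply/andP; split; apply: H; lra.
move=> H; rewrite -lee_fin; apply: le_trans H; rewrite mulr_natl -sumr_const -sumEFin.
apply: lee_sum => v vA; rewrite (gaussian_box (B := B v) gx); last by move=> t; exact: measurable_itv.
rewrite lee_fin.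
have asum : \sum_t a v t ^+ 2 <= n%:R.
  move: vA; rewrite inE dot_sqr => vA.
  rewrite /a; under eq_bigr do rewrite expr_div_n sqr_sqrtr ?(ltW T0)// -sqrrN opprB.
  by rewrite -mulr_suml ler_pdivrMr.
pose b t : R := kap * (peak * expR (- ((1 + eta) * a v t ^+ 2 + (1 + eta^-1) * kap ^+ 2) / 2)).
have e1 : 0 < 1 + eta by move: eta_gt0; lra.
apply: (@le_trans _ _ (\prod_t b t)).
  rewrite /b !big_split /= !prodr_const !card_ord -expR_sum.
  rewrite !(exprMn n) ler_pM2l ?exprn_gt0// ler_pM2l ?exprn_gt0// -expRM_natr ler_expR.
  rewrite -mulr_suml [leLHS]mulrAC ler_pM2r ?invr_gt0// sumrN mulNr lerN2 big_split /=.
  rewrite sum_cst card_ord -mulr_sumr.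
  by have := ler_wpM2l (ltW e1) asum; lra.
apply: ler_prod => t _; rewrite /b mulr_ge0 ?mulr_ge0 ?expR_ge0 ?(ltW kap0) ?(ltW peak_gt0)//=.
rewrite mulrC [X in _ * X <= _](_ : kap = a v t + kap - a v t); last by rewrite addrC addKr.
apply: nprob_itv_ge.
- by rewrite lerDl ltW.
- by rewrite mulr_ge0 ?expR_ge0 ?(ltW peak_gt0).
move=> z zc; rewrite std_normal_pdfE ler_pM2l// ler_expR.
rewrite !mulNr lerN2 ler_pM2r ?invr_gt0//.
have := sqrD_le (a v t) (z - a v t) eta_gt0; rewrite addrC subrK => /le_trans; apply.
rewrite lerD2l ler_wpM2l ?addr_ge0 ?invr_ge0 ?(ltW eta_gt0)//.
by move: zc => /andP[h1 h2]; apply: sqr_mono; lra.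
Qed.

(* [T / g ^+ 2] is the squared decoding radius relative to the power of the shaping set. *)
Lemma ball_shaping_ratio (y : 'I_n -> R) (g T : R) : 0 < g -> 0 < T ->
  #|[set v : V | dot (fun t => y t - g * grid_point delta v t)
                     (fun t => y t - g * grid_point delta v t) <= n%:R * T]%SET|%:R
  <= 2 * #|shaping q n delta|%:R
     * (Num.sqrt (T / g ^+ 2) * expR (eta * (5 + g ^+ 2 / T))) ^+ n.
Proof.
move=> g0 T0; set A := [set v | _]%SET; set N := T / g ^+ 2.
have N0 : 0 < N by rewrite divr_gt0 ?exprn_gt0.
have s0 : 0 < Num.sqrt N by rewrite sqrtr_gt0.
have d0 := grid_step_gt0.
pose r := Num.sqrt (1 + 5 * eta).
have e5 : 0 < 1 + 5 * eta by move: eta_gt0; lra.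
have r0 : 0 < r by rewrite sqrtr_gt0.
have kE : g * delta / Num.sqrt T = eta / (r * Num.sqrt N).
  rewrite /N sqrtrM ?ltW// sqrtrV ?sqr_ge0// sqrtr_sqr gtr0_norm// /grid_step -/r.
  by field; rewrite !gt_eqF// sqrtr_gt0.
have := ball_card_le y g0 T0; rewrite -/A kE; set kap := eta / _.
set den := kap * _ => HA.
have kap0 : 0 < kap by rewrite divr_gt0// mulr_gt0.
have den0 : 0 < den by rewrite mulr_gt0// mulr_gt0// expR_gt0.
have dens0 : 0 < dens by rewrite mulr_gt0// mulr_gt0// expR_gt0.
apply: (@le_trans _ _ ((den ^+ n)^-1)); first by rewrite -[leRHS]mul1r ler_pdivlMr ?exprn_gt0.
apply: (@le_trans _ _ ((2 * #|shaping q n delta|%:R * dens ^+ n) / den ^+ n)).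
  by rewrite -[leLHS]mul1r ler_pM2r ?invr_gt0 ?exprn_gt0 ?shaping_card_ge.
rewrite -mulrA -expr_div_n ler_wpM2l ?mulr_ge0//.
apply: lerXn2r.
- by rewrite nnegrE divr_ge0// ltW.
- by rewrite nnegrE mulr_ge0 ?expR_ge0// ltW.
(* The normalizing constants cancel. What remains is the ratio [r * Num.sqrt N] of the cell widths
   and a difference of exponents of order [eta]. *)
have -> : dens / den = r * Num.sqrt N * (expR (- (1 - 4 * eta) / 2)
     / expR (- ((1 + eta) + (1 + eta^-1) * kap ^+ 2) / 2)).
  by rewrite /dens /den /kap; field; rewrite !gt_eqF ?expR_gt0// mulr_gt0.
rewrite -expRB [r * _]mulrC -mulrA ler_pM2l//.
apply: (@le_trans _ _ (expR (5 * eta / 2) *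
   expR (- (1 - 4 * eta) / 2 - - (1 + eta + (1 + eta^-1) * kap ^+ 2) / 2))).
  rewrite ler_pM2r ?expR_gt0// -[leLHS]ger0_norm ?(ltW r0)//.
  have : r ^+ 2 <= expR (5 * eta / 2) ^+ 2.
    rewrite sqr_sqrtr ?(ltW e5)// -expRM_natl.
    by apply: (le_trans (expR_ge1Dx (5 * eta))); rewrite ler_expR; lra.
  by rewrite ler_pXn2r ?nnegrE ?(ltW r0) ?expR_ge0// ger0_norm// ltW.
rewrite -expRD ler_expR.
have kk : kap ^+ 2 <= eta ^+ 2 / N.
  rewrite /kap expr_div_n exprMn [r ^+ 2]sqr_sqrtr ?(ltW e5)// sqr_sqrtr ?(ltW N0)//.
  rewrite ler_pM2l ?exprn_gt0// invfM ler_piMl ?invr_ge0 ?(ltW N0)// invf_le1//.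
  by move: eta_gt0; lra.
have : (1 + eta^-1) * kap ^+ 2 <= 2 * eta / N.
  apply: (@le_trans _ _ ((1 + eta^-1) * (eta ^+ 2 / N))).
    by rewrite ler_wpM2l// addr_ge0 ?invr_ge0 ?(ltW eta_gt0).
  rewrite mulrA ler_pM2r ?invr_gt0//.
  have -> : (1 + eta^-1) * eta ^+ 2 = eta ^+ 2 + eta by field; rewrite gt_eqF.
  by move: eta_gt0 eta_le1; nra.
have -> : g ^+ 2 / T = N^-1 by rewrite /N invfM invrK mulrC.
by move=> h; move: eta_gt0; lra.
Qed.

End Volume.

Local Close Scope classical_set_scope.

(** * Achievable layer rates *)

Section Reliability.
Context {R : realType}.

Lemma finite_lower_bound (K : finType) (P : pred K) (v : K -> R) :
  (forall k, P k -> 0 < v k) -> exists2 v0, 0 < v0 & forall k, P k -> v0 <= v k.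
Proof.
move=> v0; exists (\big[Order.min/1]_(k | P k) v k).
  by elim/big_ind: _ => // x y x0 y0; rewrite lt_min x0.
by move=> k Pk; rewrite (bigD1 k)//= ge_min lexx.
Qed.

Lemma mul_expRN_le (v : R) (n : nat) : 0 < v -> (0 < n)%N ->
  n%:R * expR (- v * n%:R) <= 2 / v ^+ 2 / n%:R.
Proof.
move=> v0 n0; have nR : 0 < n%:R :> R by rewrite ltr0n.
rewrite mulNr expRN ler_pdivrMr ?expR_gt0// mulrAC ler_pdivlMr//.
have := expR_ge1Dxn 1 (ltW (mulr_gt0 v0 nR)) => h.
have h2 : (v * n%:R) ^+ 2 / 2 <= expR (v * n%:R) by apply: le_trans h; rewrite lerDr.
have -> : n%:R * n%:R = 2 / v ^+ 2 * ((v * n%:R) ^+ 2 / 2) :> R by field; rewrite gt_eqF.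
by rewrite ler_pM2l// divr_gt0 ?exprn_gt0.
Qed.

(** What the coding argument needs at accuracy [v]. With at least [n] admissible indices on average,
    shaping fails with probability of order [1 / n]; the upper bounds on [q] and on the mean limit
    the loss from integer dimensions to a rate of order [v]. *)
Record good_params (n q kl : nat) (v : R) : Prop := GoodParams {
  gp_n : (0 < n)%N;
  gp_prime : prime q;
  gp_odd : odd q;
  gp_large : 16 * n%:R < (grid_step v * q%:R) ^+ 2;
  gp_small : q%:R <= expR (v * n%:R);
  gp_mean_ge : n%:R <= mean_shaped (R := R) (L := 'rV['F_q]_kl) (shaping q n (grid_step v));
  gp_mean_le : mean_shaped (R := R) (L := 'rV['F_q]_kl) (shaping q n (grid_step v)) <= q%:R * n%:R;
  gp_volume : forall (y : 'I_n -> R) (g T : R), 0 < g -> 0 < T ->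
    #|[set u : 'rV['F_q]_n | dot (fun t => y t - g * grid_point (grid_step v) u t)
                     (fun t => y t - g * grid_point (grid_step v) u t) <= n%:R * T]|%:R
    <= 2 * #|shaping q n (grid_step v)|%:R
       * (Num.sqrt (T / g ^+ 2) * expR (v * (5 + g ^+ 2 / T))) ^+ n }.

Section Layers.
Variables (I : finType) (two : I -> bool) (g : I -> R) (sq : seq I) (rho : I -> R).
Hypothesis g_ge0 : forall s, 0 <= g s.
Hypothesis sq_uniq : uniq sq.

Definition copies s : R := 1 + (two s)%:R.
Definition noise_level s : R :=
  1 + \sum_(s' | (index s sq < index s' sq)%N) g s' ^+ 2 * copies s'.
(** The scaling that minimizes the error energy for a signal of power [copies s * g s ^+ 2] in noise
    of power [noise_level s]. *)
Definition mmse_coef s : R := copies s * g s ^+ 2 / (copies s * g s ^+ 2 + noise_level s).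
Definition mmse s : R := \sum_p err_coef two g mmse_coef sq s p ^+ 2.
Definition mmse_slack s : R := mmse s + (\sum_p `|err_coef two g mmse_coef sq s p|) ^+ 2.

Lemma copies_ge1 s : 1 <= copies s.
Proof. by rewrite /copies lerDl. Qed.

Lemma noise_level_ge1 s : 1 <= noise_level s.
Proof.
rewrite /noise_level lerDl sumr_ge0// => s' _.
by rewrite mulr_ge0 ?sqr_ge0// (le_trans ler01 (copies_ge1 s')).
Qed.

Lemma mmseE s : mmse s
  = copies s * g s ^+ 2 * noise_level s / (copies s * g s ^+ 2 + noise_level s).
Proof.
have c1 := copies_ge1 s; have n1 := noise_level_ge1 s.
have den : copies s * g s ^+ 2 + noise_level s != 0.
  by rewrite gt_eqF// ltr_wpDl ?(lt_le_trans _ n1)// mulr_ge0 ?sqr_ge0//; lra.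
rewrite /mmse sum_option_pair /=.
have -> : \sum_s' ((g s' * (if s' == s then mmse_coef s - 1 else if (index s sq < index s' sq)%N
    then mmse_coef s else 0) * (~~ false || two s')%:R) ^+ 2 +
   (g s' * (if s' == s then mmse_coef s - 1 else if (index s sq < index s' sq)%N
    then mmse_coef s else 0) * (~~ true || two s')%:R) ^+ 2)
   = g s ^+ 2 * (mmse_coef s - 1) ^+ 2 * copies s + mmse_coef s ^+ 2 * (noise_level s - 1).
  rewrite (bigD1 s)//= eqxx; congr (_ + _).
    by rewrite /copies; case: (two s) => /=; ring.
  rewrite /noise_level [1 + _]addrC addrK mulr_sumr [RHS]big_mkcond [RHS](bigD1 s)//= ltnn add0r.
  apply: eq_bigr => s' /negPf ->; case: ifP => _; last by ring.
  by rewrite /copies; case: (two s') => /=; ring.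
by rewrite /mmse_coef; field.
Qed.

Lemma mmse_gt0 s : 0 < g s -> 0 < mmse s.
Proof.
move=> g0; have c1 := copies_ge1 s; have n1 := noise_level_ge1 s.
have n0 := lt_le_trans ltr01 n1; have c0 := lt_le_trans ltr01 c1.
have cg := mulr_gt0 c0 (exprn_gt0 2 g0).
by rewrite mmseE; exact: divr_gt0 (mulr_gt0 cg n0) (addr_gt0 cg n0).
Qed.

(** The origin of [1 / c]: the error energy [c * g ^+ 2 * N / (c * g ^+ 2 + N)] is that of a signal
    of power [c * g ^+ 2], but the code is only as dense as for one transmitter, of power [g ^+ 2].
    The quotient of error energy and [g ^+ 2] is the inverse of [c^-1 + g ^+ 2 / N]. *)
Lemma ln_mmse s : 0 < g s ->
  ln (mmse s / g s ^+ 2) = - ln ((copies s)^-1 + g s ^+ 2 / noise_level s).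
Proof.
move=> g0; have c1 := copies_ge1 s; have n1 := noise_level_ge1 s.
have n0 := lt_le_trans ltr01 n1; have c0 := lt_le_trans ltr01 c1.
have cg := mulr_gt0 c0 (exprn_gt0 2 g0).
have gn := divr_gt0 (exprn_gt0 2 g0) n0; have ci : 0 < (copies s)^-1 by rewrite invr_gt0.
rewrite -lnV ?posrE ?(addr_gt0 ci gn)//; congr ln.
rewrite mmseE; field.
have cn : noise_level s + g s ^+ 2 * copies s != 0 by rewrite addrC mulrC gt_eqF// (addr_gt0 cg n0).
by rewrite cn !gt_eqF.
Qed.

Hypothesis rate_lt : forall s, s \in sq -> 0 < g s ->
  rho s < 2^-1 * ln ((copies s)^-1 + g s ^+ 2 / noise_level s).

(** The reserve [3 * v] in the exponent: two parts pay for the factors [q] in the size of [C s] and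
    in the mean number of indices, the third leaves [expR (- v * n)]. *)
Lemma small_parameter : exists2 v0, 0 < v0 & forall v s, 0 < v -> v <= v0 -> s \in sq -> 0 < g s ->
  let T := mmse s + v * mmse_slack s in
  rho s + 2^-1 * ln (T / g s ^+ 2) + v * (5 + g s ^+ 2 / T) <= - (3 * v).
Proof.
pose gap s := 2^-1 * ln ((copies s)^-1 + g s ^+ 2 / noise_level s) - rho s.
(* The price per unit of [v]: the enlarged decoding radius, the error of the volume estimate, and
   the reserve 3. *)
pose c s := mmse_slack s / mmse s + 5 + g s ^+ 2 / mmse s + 3.
have slack0 s : 0 < g s -> 0 <= mmse_slack s by move=> g0; rewrite addr_ge0 ?sqr_ge0 ?ltW ?mmse_gt0.
have c0 s : 0 < g s -> 0 < c s.
  move=> g0; have m0 := mmse_gt0 g0.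
  have := divr_ge0 (slack0 s g0) (ltW m0); have := divr_ge0 (sqr_ge0 (g s)) (ltW m0).
  by rewrite /c; lra.
have gap0 s : (s \in sq) && (0 < g s) -> 0 < gap s / c s.
  by move=> /andP[ssq g0]; rewrite divr_gt0 ?c0// /gap subr_gt0 rate_lt.
have [v0 v00 hv0] := finite_lower_bound gap0.
exists v0; first exact: v00.
move=> v s v1 vv ssq g0 /=; set T := mmse s + v * mmse_slack s.
have m0 := mmse_gt0 g0; have sl := slack0 s g0.
have mT : mmse s <= T by rewrite lerDl mulr_ge0// ltW.
have T0 : 0 < T by exact: lt_le_trans mT.
have /(le_trans vv) := hv0 s (introT andP (conj ssq g0)); rewrite ler_pdivlMr ?c0// => vc.
have lnT : ln (T / g s ^+ 2) <= ln (mmse s / g s ^+ 2) + v * (mmse_slack s / mmse s).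
  have -> : T / g s ^+ 2 = mmse s / g s ^+ 2 * (1 + v * (mmse_slack s / mmse s)).
    by rewrite /T; field; rewrite !gt_eqF.
  have p0 : 0 <= v * (mmse_slack s / mmse s) by rewrite mulr_ge0 ?(ltW v1)// divr_ge0// ltW.
  rewrite lnM ?posrE ?divr_gt0 ?exprn_gt0//; last by lra.
  rewrite lerD2l -ler_expR lnK ?posrE; [exact: expR_ge1Dx|by lra].
have gT : g s ^+ 2 / T <= g s ^+ 2 / mmse s by rewrite ler_wpM2l ?sqr_ge0// lef_pV2 ?posrE.
move: lnT; rewrite ln_mmse// => lnT.
have p1 := ler_wpM2l (ltW v1) gT.
have p2 : 0 <= v * (mmse_slack s / mmse s) by rewrite mulr_ge0 ?(ltW v1)// divr_ge0// ltW.
by move: vc; rewrite /c /gap; lra.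
Qed.

(** The constant [D] is fixed before the length, the alphabet, the messages and the noise vector, so
    that one bound serves in all blocks. *)
Theorem superposition_reliable : exists2 v0, 0 < v0 & forall v, 0 < v -> v <= v0 -> v <= 1 ->
  exists D : R, forall n q K kl, good_params n q kl v ->
  forall (C : I -> {set 'rV['F_q]_K}) (mu : I -> bool -> 'rV['F_q]_K) (z : 'I_n -> R),
  (forall s, s \in sq -> #|C s|%:R <= q%:R * expR (n%:R * rho s)) ->
  (forall s, s \in sq -> msg_sum two mu s \in C s) ->
  (forall s, s \in sq -> g s = 0 -> msg_sum two mu s = 0) ->
  dot z z <= n%:R * (1 + v) ->
  avg (fun th : {ffun I -> lcode q n K kl} => (~~ (near_orth (grid_step v) v th mu &&
     [forall s, (s \in sq) ==>
       (successive_decode (grid_step v) two g mmse_coef (threshold n two g mmse_coef sq v) C th sq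
          (residual (grid_step v) two g sq th mu z 0) s == msg_sum two mu s)]))%:R) <= D / n%:R.
Proof.
have [v0 v00 hv0] := small_parameter; exists v0 => // v v1 vv ve.
exists (#|{: I * bool}|%:R * (4 + 8 / v ^+ 2) + #|{: I * bool}|%:R ^+ 2 * (4 / v ^+ 2)
   + #|I|%:R * (8 * (2 / v ^+ 2))) => n q K kl gp C mu z cC mC m0 zz.
have [n0 qp qo ql qs mg ml vol] := gp.
have nR : 0 < n%:R :> R by rewrite ltr0n.
have d0 : 0 < grid_step v by apply: grid_step_gt0.
have S0 := shaping0 n (grid_step v) qp.
set mus := mean_shaped _ in mg ml.
pose T := threshold n two g mmse_coef sq v.
have TE s : T s = n%:R * (mmse s + v * mmse_slack s) by [].
pose c s := #|shaping q n (grid_step v)|%:R * (2 * (Num.sqrt ((mmse s + v * mmse_slack s) / g s ^+ 2)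
   * expR (v * (5 + g s ^+ 2 / (mmse s + v * mmse_slack s)))) ^+ n).
have T0 s : 0 < g s -> 0 < mmse s + v * mmse_slack s.
  move=> g0; rewrite ltr_pwDl ?mmse_gt0// mulr_ge0 ?(ltW v1)// addr_ge0 ?sqr_ge0// ltW//.
  exact: mmse_gt0.
have g0 s : g s != 0 -> 0 < g s by move=> gs; rewrite lt_def gs g_ge0.
have cc s : s \in sq -> g s != 0 -> forall y : 'I_n -> R,
     (#|[set u : 'rV['F_q]_n | (dot (fun t => (y t - g s * grid_point (grid_step v) u t)%R)
                       (fun t => (y t - g s * grid_point (grid_step v) u t)%R) <= T s)%R]| <= Num.truncn (c s))%N.
  move=> _ gs y; rewrite truncn_ge_nat; last first.
    by rewrite mulr_ge0// mulr_ge0// exprn_ge0// mulr_ge0 ?sqrtr_ge0 ?expR_ge0.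
  by rewrite TE /c mulrCA mulrA; apply: vol; [exact: g0|apply: T0; exact: g0].
apply: (le_trans (avg_superposition_failure kl qp qo n0 d0 ql (T := T) sq_uniq v1 ve zz
  (fun s _ _ => lexx (T s)) mC m0 cc)).
set NI : R := #|{: I * bool}|%:R; set nI : R := #|I|%:R.
have -> : (NI * (4 + 8 / v ^+ 2) + NI ^+ 2 * (4 / v ^+ 2) + nI * (8 * (2 / v ^+ 2))) / n%:R
   = NI * (4 / n%:R + 8 / (n%:R * v ^+ 2)) + NI ^+ 2 * (4 / (n%:R * v ^+ 2)) + nI * (8 * (2 / v ^+ 2) / n%:R).
  by field; rewrite !gt_eqF.
apply: lerD; first apply: lerD => //.
- rewrite ler_wpM2l// lerD2r ler_pM2l// lef_pV2 ?posrE//.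
  exact: (lt_le_trans nR mg).
- have term s : s \in sq -> g s != 0 ->
    4 * (#|C s|%:R * #|{: 'rV['F_q]_kl}|%:R * (Num.truncn (c s))%:R / #|{: 'rV['F_q]_n}|%:R)
     <= 8 * (2 / v ^+ 2) / n%:R.
    move=> ssq gs; have gs0 := g0 s gs.
    have V0 : 0 < #|{: 'rV['F_q]_n}|%:R :> R by rewrite ltr0n card_zmod_gt0.
    pose E := rho s + 2^-1 * ln ((mmse s + v * mmse_slack s) / g s ^+ 2)
       + v * (5 + g s ^+ 2 / (mmse s + v * mmse_slack s)).
    have cE : c s <= #|shaping q n (grid_step v)|%:R * (2 * expR ((E - rho s) * n%:R)).
      rewrite ler_pM2l ?ltr0n// ler_pM2l// expRM_natr; apply: lerXn2r.
      - by rewrite nnegrE mulr_ge0 ?sqrtr_ge0 ?expR_ge0.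
      - by rewrite nnegrE expR_ge0.
      have -> : E - rho s = 2^-1 * ln ((mmse s + v * mmse_slack s) / g s ^+ 2)
         + v * (5 + g s ^+ 2 / (mmse s + v * mmse_slack s)) by rewrite /E; ring.
      rewrite expRD ler_pM2r ?expR_gt0//.
      have D0 : 0 < (mmse s + v * mmse_slack s) / g s ^+ 2 by rewrite divr_gt0 ?T0 ?exprn_gt0.
      rewrite -[leLHS]ger0_norm ?sqrtr_ge0// -[leRHS]ger0_norm ?expR_ge0//.
      rewrite -ler_sqr ?nnegrE// !real_normK ?num_real// sqr_sqrtr ?(ltW D0)//.
      by rewrite -expRM_natl mulrA divff// mul1r lnK.
    have ct : (Num.truncn (c s))%:R <= c s.
      by rewrite truncn_le mulr_ge0// mulr_ge0// exprn_ge0// mulr_ge0 ?sqrtr_ge0 ?expR_ge0.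
    apply: (@le_trans _ _ (4 * (q%:R * expR (n%:R * rho s) * mus * (2 * expR ((E - rho s) * n%:R))))).
      rewrite ler_pM2l//.
      have -> : #|C s|%:R * #|{: 'rV['F_q]_kl}|%:R * (Num.truncn (c s))%:R / #|{: 'rV['F_q]_n}|%:R
         = #|C s|%:R * (#|{: 'rV['F_q]_kl}|%:R / #|{: 'rV['F_q]_n}|%:R * (Num.truncn (c s))%:R) :> R by ring.
      rewrite -[leRHS]mulrA; apply: ler_pM; rewrite ?mulr_ge0 ?invr_ge0// ?cC//.
      apply: (@le_trans _ _ (#|{: 'rV['F_q]_kl}|%:R / #|{: 'rV['F_q]_n}|%:R *
         (#|shaping q n (grid_step v)|%:R * (2 * expR ((E - rho s) * n%:R))))).
        by rewrite ler_wpM2l ?divr_ge0// (le_trans ct).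
      have mE : #|{: 'rV['F_q]_kl}|%:R / #|{: 'rV['F_q]_n}|%:R * #|shaping q n (grid_step v)|%:R = mus.
        by rewrite /mus /mean_shaped mulrAC.
      by rewrite [leLHS]mulrA mE.
    apply: (@le_trans _ _ (8 * (n%:R * expR (- v * n%:R)))); last first.
      by rewrite -[leRHS]mulrA ler_pM2l// mul_expRN_le.
    have -> : 4 * (q%:R * expR (n%:R * rho s) * mus * (2 * expR ((E - rho s) * n%:R)))
      = 8 * (q%:R * mus * expR (E * n%:R)).
      rewrite (_ : E * n%:R = n%:R * rho s + (E - rho s) * n%:R); last by ring.
      by rewrite expRD; ring.
    rewrite ler_pM2l//.
    apply: (@le_trans _ _ (expR (v * n%:R) * (expR (v * n%:R) * n%:R) * expR (- (3 * v) * n%:R))).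
      have mus0 : 0 < mus by rewrite (lt_le_trans nR mg).
      apply: ler_pM; rewrite ?mulr_ge0 ?expR_ge0 ?(ltW mus0)//.
        apply: ler_pM => //; first exact: ltW.
        by apply: (le_trans ml); rewrite ler_pM2r.
      by rewrite ler_expR ler_pM2r//; exact: hv0.
    rewrite (_ : _ * _ * expR _ = n%:R * (expR (v * n%:R) * expR (v * n%:R) * expR (- (3 * v) * n%:R))); last by ring.
    by rewrite -!expRD ler_pM2l// ler_expR; lra.
  apply: (@le_trans _ _ (\sum_(s : I) 8 * (2 / v ^+ 2) / n%:R)); last by rewrite sum_cst.
  rewrite big_mkcond; apply: ler_sum => s _; case: ifP => [/andP[ssq gs]|_]; first exact: term.
  by rewrite divr_ge0// mulr_ge0// divr_ge0// sqr_ge0.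
Qed.

End Layers.
End Reliability.

(** * Choice of the alphabet and of the dimensions *)

Local Open Scope classical_set_scope.
Local Open Scope ring_scope.

(** Euclid's argument. The crude upper bound is good enough, since for [m] of the order of the
    square root of [n] even the factorial of [m] is subexponential in [n]. *)
Lemma prime_between m : exists q, [/\ prime q, (m < q)%N & (q <= m`!.+1)%N].
Proof.
have m1 : (1 < m`!.+1)%N by rewrite ltnS fact_gt0.
have := pdiv_prime m1; have := pdiv_dvd m`!.+1; have := pdiv_leq (ltnW m1).
set p := pdiv _ => pm pd pp; exists p; split => //.
rewrite ltnNge; apply/negP => pm'.
have pf : (p %| m`!)%N by rewrite dvdn_fact// prime_gt0.
have : (p %| 1)%N by rewrite -(dvdn_addr _ pf) addn1.
by rewrite dvdn1 => /eqP p1; move: pp; rewrite p1.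
Qed.

Lemma fact_le_expn m : (m`! <= m ^ m)%N.
Proof.
elim: m => // m IH; rewrite factS expnS leq_mul//.
by apply: (leq_trans IH); case: m {IH} => // m; rewrite leq_exp2r.
Qed.

Section CodeParameters.
Context {R : realType}.

Lemma card_rV_F q k : prime q -> #|{: 'rV['F_q]_k}| = (q ^ k)%N.
Proof. by move=> qp; rewrite card_mx mul1n card_Fp. Qed.

Lemma small_exp (c : R) : 0 < c -> exists N, forall n, (N <= n)%N -> expR (- c * n%:R) <= 4^-1.
Proof.
move=> c0; exists (Num.truncn (3 / c)).+1 => n Nn.
rewrite mulNr expRN lef_pV2 ?posrE ?expR_gt0//.
apply: le_trans (expR_ge1Dx _).
have : 3 / c <= n%:R.
  apply: (@le_trans _ _ (Num.truncn (3 / c)).+1%:R); last by rewrite ler_nat.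
  by apply: ltW; have /andP[] := truncn_itv (divr_ge0 (ler0n R 3) (ltW c0)).
by rewrite ler_pdivrMr// mulrC; lra.
Qed.

Lemma prime_alphabet (v delta : R) : 0 < v -> 0 < delta ->
  exists N, forall n, (N <= n)%N -> exists q, [/\ prime q, odd q,
    16 * n%:R < (delta * q%:R) ^+ 2 & q%:R <= expR (v * n%:R)].
Proof.
move=> v0 d0; pose c : R := 4 / delta + 4; have c0 : 0 < c by rewrite addr_gt0// divr_gt0.
(* The logarithm of [q] is at most of order [m * Num.sqrt m] with [m <= c * Num.sqrt n], so it grows
   like [n] to the power 3/4. From [B] on this is below [v * n]. *)
pose B := (9 * c ^+ 3 / v ^+ 2) ^+ 2.
exists (Num.truncn B).+2 => n Nn.
have Bn : B <= n%:R.
  apply: (@le_trans _ _ (Num.truncn B).+1%:R); last by rewrite ler_nat ltnW.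
  by apply: ltW; have /andP[] := truncn_itv (sqr_ge0 (9 * c ^+ 3 / v ^+ 2)).
have n1 : 1 <= n%:R :> R by rewrite ler1n (leq_trans _ Nn).
set sn := Num.sqrt (n%:R : R); have snn : sn ^+ 2 = n%:R by rewrite sqr_sqrtr.
have sn1 : 1 <= sn by rewrite -sqrtr1 ler_wsqrtr.
(* Adding 3 rounds up and also makes [q] larger than 2, hence odd. *)
pose m := (Num.truncn (4 * sn / delta)).+3.
have mgt : 4 * sn / delta < m%:R.
  have s4 : 0 <= 4 * sn / delta by rewrite divr_ge0 ?mulr_ge0 ?(ltW d0)//; lra.
  by have /andP[_ /lt_trans] := truncn_itv s4; apply; rewrite ltr_nat.
have mle : m%:R <= c * sn.
  have s4 : 0 <= 4 * sn / delta by rewrite divr_ge0 ?mulr_ge0 ?(ltW d0)//; lra.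
  have : (Num.truncn (4 * sn / delta))%:R <= 4 * sn / delta by rewrite truncn_le.
  have e : c * sn = 4 * sn / delta + 4 * sn by rewrite /c mulrDl [_ / _ * _]mulrAC.
  by rewrite e /m -addn3 natrD; lra.
have [q [qp mq qm]] := prime_between m.
exists q; split => //.
- by have [|//] := even_prime qp; move=> q2; move: mq; rewrite q2.
- have : 4 * sn < delta * q%:R.
    rewrite -ltr_pdivrMl// [ltLHS]mulrC; apply: (lt_trans mgt).
    by rewrite ltr_nat.
  rewrite -snn; set w := delta * _ => h.
  have : 0 <= (w - 4 * sn) * (w + 4 * sn) by rewrite mulr_ge0//; lra.
  have : 0 < (w - 4 * sn) * (w + 4 * sn) by rewrite mulr_gt0//; lra.
  by lra.
set sm := Num.sqrt (m%:R : R); have smm : sm ^+ 2 = m%:R by rewrite sqr_sqrtr.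
have sm1 : 1 <= sm by rewrite -sqrtr1 ler_wsqrtr// ler1n.
have mexp : m%:R <= expR (2 * sm).
  rewrite -smm expRM_natl; apply: lerXn2r; rewrite ?nnegrE ?expR_ge0//; first lra.
  by apply: le_trans (expR_ge1Dx sm); lra.
have m3 : 1 <= m%:R :> R by rewrite ler1n.
apply: (@le_trans _ _ (expR (3 * (m%:R * sm)))).
  apply: (@le_trans _ _ (2 * (m ^ m)%:R)).
    rewrite -natrM ler_nat (leq_trans qm)// mul2n -addnn -addn1 leq_add ?fact_le_expn//.
    by rewrite expn_gt0.
  rewrite natrX (_ : 3 * (m%:R * sm) = m%:R * sm + m%:R * (2 * sm)); last by ring.
  rewrite expRD; apply: ler_pM => //.
    apply: (@le_trans _ _ (expR 1)); first by apply: le_trans (expR_ge1Dx 1); lra.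
    by rewrite ler_expR; nra.
  by rewrite [X in expR X]mulrC expRM_natr; apply: lerXn2r; rewrite ?nnegrE ?expR_ge0.
rewrite ler_expR.
have h : (3 * (m%:R * sm)) ^+ 2 <= (v * n%:R) ^+ 2.
  rewrite (_ : (3 * (m%:R * sm)) ^+ 2 = 9 * m%:R ^+ 3); last by rewrite !exprMn smm; ring.
  apply: (@le_trans _ _ (9 * (c * sn) ^+ 3)).
    by rewrite ler_pM2l//; apply: lerXn2r; rewrite ?nnegrE// mulr_ge0//; lra.
  have sB : 9 * c ^+ 3 / v ^+ 2 <= sn.
    have b0 : 0 <= 9 * c ^+ 3 / v ^+ 2 by rewrite divr_ge0 ?mulr_ge0 ?exprn_ge0 ?(ltW c0) ?(ltW v0).
    have : (9 * c ^+ 3 / v ^+ 2) ^+ 2 <= sn ^+ 2 by rewrite snn.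
    by rewrite ler_pXn2r ?nnegrE//; lra.
  rewrite ler_pdivrMr ?exprn_gt0// in sB.
  rewrite !exprMn -snn (_ : 9 * (c ^+ 3 * sn ^+ 3) = 9 * c ^+ 3 * sn ^+ 3); last by ring.
  apply: (@le_trans _ _ (sn * v ^+ 2 * sn ^+ 3)); last by rewrite le_eqVlt; apply/orP; left; apply/eqP; ring.
  by rewrite ler_pM2r// exprn_gt0//; lra.
rewrite ler_pXn2r ?nnegrE// in h; first by rewrite mulr_ge0 ?mulr_ge0//; lra.
by rewrite mulr_ge0// ltW.
Qed.

(** Each further coordinate of the index multiplies the mean by [q], so the least dimension whose
    mean reaches [n] overshoots by at most the factor [q]. *)
Lemma coset_size n q (S : {set 'rV['F_q]_n}) : prime q -> (0 < #|S|)%N -> (0 < n)%N ->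
  exists kl, n%:R <= mean_shaped (R := R) (L := 'rV['F_q]_kl) S
     /\ mean_shaped (R := R) (L := 'rV['F_q]_kl) S <= q%:R * n%:R.
Proof.
move=> qp S0 n0.
have mE k : mean_shaped (R := R) (L := 'rV['F_q]_k) S = q%:R ^+ k * #|S|%:R / q%:R ^+ n.
  by rewrite /mean_shaped !card_rV_F// !natrX.
have q1 : 1 < q%:R :> R by rewrite ltr1n prime_gt1.
have q0 : 0 < q%:R :> R by lra.
have qn0 : 0 < q%:R ^+ n :> R by rewrite exprn_gt0.
pose P k := n%:R <= mean_shaped (R := R) (L := 'rV['F_q]_k) S.
have exP : exists k, P k.
  exists (n + n)%N; rewrite /P mE exprD.
  have -> : q%:R ^+ n * q%:R ^+ n * #|S|%:R / q%:R ^+ n = q%:R ^+ n * #|S|%:R :> R.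
    by field; rewrite gt_eqF.
  apply: (@le_trans _ _ (q%:R ^+ n)); last by rewrite ler_peMr ?(ltW qn0)// ler1n.
  by rewrite -natrX ler_nat ltnW// ltn_expl// prime_gt1.
case: (ex_minnP exP) => k Pk kmin; exists k; split => //.
case: k Pk kmin => [|k] Pk kmin.
  rewrite mE expr0 mul1r; apply: (@le_trans _ _ 1).
    by rewrite ler_pdivrMr// mul1r -natrX -card_rV_F// ler_nat max_card.
  by rewrite -natrM ler1n muln_gt0 prime_gt0.
have : ~~ P k by apply/negP => /kmin; rewrite ltnn.
rewrite /P -ltNge !mE exprS => /ltW h.
by rewrite -!mulrA ler_pM2l// mulrA.
Qed.

Context {d : measure_display} {Omega : measurableType d}.
Variable Pr : probability Omega R.

(** The Gaussian vector is a device for counting grid points; the properties obtained do not refer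
    to it. *)
Theorem good_params_exist (v : R) : 0 < v -> v <= 1 -> exists N, forall n, (N <= n)%N ->
  forall x : 'I_n -> Omega -> R, gaussian_vector Pr x -> exists q kl, good_params n q kl v.
Proof.
move=> v0 v1.
have [c1 c10 up] := gaussian_norm_upper Pr v0 v1.
have [c2 c20 low] := gaussian_norm_lower Pr v0 v1.
have [N1 h1] := small_exp c10; have [N2 h2] := small_exp c20.
have d0 : 0 < grid_step v by exact: grid_step_gt0.
have [N3 h3] := prime_alphabet v0 d0.
exists (maxn 1 (maxn N1 (maxn N2 N3))) => n; rewrite !geq_max => /and4P[n0 n1 n2 n3] x gx.
have [q [qp qo ql qs]] := h3 n n3.
have [kl [k1 k2]] := coset_size qp (shaping0 n (grid_step v) qp) n0.
exists q, kl; split => // y g T g0 T0.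
apply: (ball_shaping_ratio gx) => //.
have mx := gx.1.
have mS := measurable_shell v gx.
have := up n x gx; have := low n x gx.
set Lo := [set om | _]; set Up := [set om | _] => lo' up'.
have mL : measurable Lo by apply: measurable_set_lt => //; exact: measurable_norm_sqr.
have mU : measurable Up by apply: measurable_set_lt => //; exact: measurable_norm_sqr.
have tot : (1 <= Pr (shell x v) + (Pr Lo + Pr Up))%E.
  rewrite -(@probability_setT _ _ _ Pr).
  apply: (@le_trans _ _ (Pr (shell x v `|` (Lo `|` Up)))).
    apply: le_measure; rewrite ?inE//; first exact: measurableU mS (measurableU _ _ mL mU).
    move=> om _; rewrite /shell /Lo /Up /=.
    case: (ltP (\sum_t x t om ^+ 2) (n%:R * (1 - v))) => h; first by right; left.
    case: (ltP (n%:R * (1 + v)) (\sum_t x t om ^+ 2)) => h'; first by right; right.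
    by left.
  apply: (le_trans (measureU2 Pr mS (measurableU _ _ mL mU))).
  by apply: leeD2l; exact: measureU2.
have fS : Pr (shell x v) \is a fin_num by rewrite fin_num_measure.
have lo4 : (Pr Lo <= 4^-1%:E)%E by apply: (le_trans lo'); rewrite lee_fin h2.
have up4 : (Pr Up <= 4^-1%:E)%E by apply: (le_trans up'); rewrite lee_fin h1.
have : (1 <= Pr (shell x v) + (4^-1%:E + 4^-1%:E))%E.
  by apply: (le_trans tot); apply: leeD2l; exact: leeD.
by rewrite -(fineK fS) -!EFinD !lee_fin; lra.
Qed.

End CodeParameters.

(** * Block-Markov codes *)

Section FiniteValued.
Context {d : measure_display} {Omega : measurableType d}.

(** Decoders take values in finite types, regarded as discrete: the preimage of every set of values
    has to be measurable. *)
Definition fmeas (X : Type) (f : Omega -> X) : Prop :=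
  forall A : set X, measurable (f @^-1` A).

Lemma fmeas_comp (X Y : Type) (f : Omega -> X) (g : X -> Y) : fmeas f -> fmeas (fun om => g (f om)).
Proof. by move=> mf A; exact: (mf (g @^-1` A)). Qed.

Lemma fmeas_bind (X : finType) (Y : Type) (f : Omega -> X) (F : X -> Omega -> Y) :
  fmeas f -> (forall x, fmeas (F x)) -> fmeas (fun om => F (f om) om).
Proof.
move=> mf mF A.
rewrite (_ : _ @^-1` _ = [set om | exists2 x, True & (f @^-1` [set x] `&` F x @^-1` A) om]).
  apply: (measurable_exists_fin (fun=> True)) => x; apply: measurableI; [exact: mf|exact: mF].
apply/seteqP; split => om /=; first by exists (f om).
by move=> [x _ [<-]].
Qed.

Lemma fmeas_cst (X : Type) (c : X) : fmeas (fun=> c).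
Proof.
move=> A; have [q|nq] := pselect (A c).
  by rewrite (_ : _ @^-1` A = setT) //; apply/seteqP; split.
by rewrite (_ : _ @^-1` A = set0) //; apply/seteqP; split.
Qed.

Lemma fmeas_bool (b : Omega -> bool) : measurable [set om | b om] -> fmeas b.
Proof.
move=> mb A; pose At := A true; pose Af := A false.
rewrite (_ : _ @^-1` _ = ([set om | b om] `&` [set _ | At]) `|` (~` [set om | b om] `&` [set _ | Af])).
  have mc (Q : Prop) : measurable [set _ : Omega | Q] by exact: (fmeas_cst Q id).
  by apply: measurableU; apply: measurableI => //; exact: measurableC.
apply/seteqP; split => om /=; rewrite /At /Af.
  by have [bt|bf] := boolP (b om); [left|right].
by move=> [[bt Abt]|[/negP/negbTE bf Abf]]; [rewrite bt|rewrite bf].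
Qed.

Lemma fmeas_ffun (I X : finType) (f : Omega -> {ffun I -> X}) :
  (forall i, fmeas (fun om => f om i)) -> fmeas f.
Proof.
move=> mf A.
rewrite (_ : _ @^-1` _ = [set om | exists2 g, A g & (forall i, f om i = g i)]).
  apply: (measurable_exists_fin A (B := fun g => [set om | forall i, f om i = g i])) => g.
  by apply: (measurable_forall_fin (B := fun i => [set om | f om i = g i])) => i; exact: (mf i [set g i]).
apply/seteqP; split => om /=; first by exists (f om).
by move=> [g Ag fg]; rewrite (_ : f om = g)//; apply/ffunP.
Qed.

Lemma fmeas_measurable_fun {R : realType} (X : Type) (f : Omega -> X) (g : X -> R) :
  fmeas f -> measurable_fun setT (fun om => g (f om)).
Proof. by move=> mf _ Y mY; rewrite setTI; exact: (mf (g @^-1` Y)). Qed.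

End FiniteValued.

Section History.
Context {R : realType} {d : measure_display} {Omega : measurableType d}.
Variables (h : 'I_3 -> R) (z : node * nat -> Omega -> R).

Lemma hist_stable n (c : ycode n) w om t k s : (s < t)%N ->
  hist h z c w om t k s = hist h z c w om s.+1 k s.
Proof.
elim: t => // t IH; rewrite ltnS leq_eqVlt => /orP[/eqP->//|st].
by rewrite {1}/hist -/hist ltn_eqF//= -/(hist _ _ _ _ _ _) IH.
Qed.

Lemma hist_relay n (c : ycode n) w om t s : (s < t)%N ->
  hist h z c w om t None s
  = \sum_i h i * uenc _ c i s w (hist h z c w om s (Some i)) + z (None, s) om.
Proof. by move=> st; rewrite hist_stable//= eqxx. Qed.

Lemma hist_user n (c : ycode n) w om t j s : (s < t)%N ->
  hist h z c w om t (Some j) s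
  = h j * renc _ c s (hist h z c w om s None) + z (Some j, s) om.
Proof. by move=> st; rewrite hist_stable//= eqxx. Qed.

End History.

Section BlockCode.
Context {R : realType} {d : measure_display} {Omega : measurableType d}.
Variables (Pr : probability Omega R) (h : 'I_3 -> R) (z : node * nat -> Omega -> R) (P : R).
Hypothesis mz : forall k, measurable_fun setT (z k).
Hypothesis P_ge0 : 0 <= P.
Variables (B n0 n : nat) (X S : finType).
Hypothesis n0_gt0 : (0 < n0)%N.
Hypothesis n_ge : (B.+1 * n0 <= n)%N.
Variables (Vs : pair3 -> {set X}) (x0 : pair3 -> X).
Hypothesis x0_in : forall p, x0 p \in Vs p.

Local Notation bmsg := {ffun pair3 -> X}.
Local Notation vec := ('I_n0 -> R).

Variables (xu : 'I_3 -> bmsg -> vec) (xr : S -> vec) (decR : vec -> S)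
  (decU : 'I_3 -> bmsg -> vec -> bmsg) (st : bmsg -> S).
Hypothesis xu_own : forall i (m m' : bmsg), (forall p : pair3, (val p).1 = i -> m p = m' p) -> xu i m = xu i m'.
Hypothesis decU_own : forall j (m m' : bmsg), (forall p : pair3, (val p).1 = j -> m p = m' p) -> decU j m = decU j m'.
Hypothesis xu_power : forall i m, \sum_t xu i m t ^+ 2 <= n0%:R * P.
Hypothesis xr_power : forall s, \sum_t xr s t ^+ 2 <= n0%:R * P.
Hypothesis decR_meas : forall Y : Omega -> vec, (forall t, measurable_fun setT (fun om => Y om t)) ->
  fmeas (fun om => decR (Y om)).
Hypothesis decU_meas : forall j m (Y : Omega -> vec), (forall t, measurable_fun setT (fun om => Y om t)) ->
  fmeas (fun om => decU j m (Y om)).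

Definition msg_set p : {set {ffun 'I_B -> X}} := [set f in ffun_on (mem (Vs p))]%SET.

Lemma msg_set0 p : [ffun=> x0 p] \in msg_set p.
Proof. by rewrite inE; apply/ffun_onP => b; rewrite ffunE. Qed.

Lemma card_msg_set p : #|msg_set p| = (#|Vs p| ^ B)%N.
Proof. by rewrite cardsE card_ffun_on card_ord. Qed.

Definition bsz (p : pair3) : nat := #|msg_set p|.

Definition blk (w : Msg bsz) (b : 'I_B) : bmsg := [ffun p => (enum_val (w p) : {ffun 'I_B -> X}) b].

Definition pos (t : nat) : 'I_n0 := Ordinal (ltn_pmod t n0_gt0).
Definition window (y : nat -> R) (b : nat) : vec := fun i => y (b * n0 + i)%N.

(** Users ignore what they receive. They send message block [b] in time block [b] and are silent
    from block [B] on. *)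
Definition block_uenc (i : 'I_3) (t : nat) (w : Msg bsz) (y : nat -> R) : R :=
  if insub (t %/ n0)%N is Some b then xu i (blk w b) (pos t) else 0.

(** In each of the time blocks 1 to [B] the relay forwards what it decodes from the preceding block,
    which is complete by then; this gives causality. *)
Definition block_renc (t : nat) (y : nat -> R) : R :=
  if (0 < t %/ n0 <= B)%N then xr (decR (window y (t %/ n0).-1)) (pos t) else 0.

(** Message block [b] reaches the users in window [b.+1]. An estimate outside the message set is
    replaced by a default through [enum_rank_in]. *)
Definition block_udec (j : 'I_3) (w : Msg bsz) (y : nat -> R) : Msg bsz :=
  finfun (fun p : pair3 => enum_rank_in (msg_set0 p)
    [ffun b : 'I_B => decU j (blk w b) (window y b.+1) p]).

Definition block_code : ycode n := YCode n bsz block_uenc block_renc block_udec.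

Lemma time_div b (i : 'I_n0) : ((b * n0 + i) %/ n0 = b)%N.
Proof. by rewrite divnMDl// divn_small ?addn0. Qed.

Lemma time_pos b (i : 'I_n0) : pos (b * n0 + i) = i.
Proof. by apply/val_inj; rewrite /= modnMDl modn_small. Qed.

Lemma time_lt b b' (i : 'I_n0) t : (b < b')%N -> (b' * n0 <= t)%N -> (b * n0 + i < t)%N.
Proof.
move=> bb; apply: leq_trans; apply: (@leq_trans (b.+1 * n0)); last by rewrite leq_mul2r bb orbT.
by rewrite mulSn addnC ltn_add2r.
Qed.

Lemma blk_own (w w' : Msg bsz) i b : (forall p : pair3, (val p).1 = i -> w p = w' p) ->
  forall p : pair3, (val p).1 = i -> blk w b p = blk w' b p.
Proof. by move=> ww p pi; rewrite !ffunE ww. Qed.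

Lemma block_code_wf : ycode_wf block_code.
Proof.
split; [|split] => /=.
- move=> i t w w' y y' ww _; rewrite /block_uenc; case: insub => // b.
  by rewrite (xu_own (blk_own b ww)).
- move=> t y y' yy; rewrite /block_renc; case: ifP => // /andP[t0 tB].
  congr (xr (decR _) _); apply/funext => i; apply: yy.
  apply: (@time_lt _ (t %/ n0)%N); last by rewrite leq_trunc_div.
  by rewrite prednK.
- move=> j w w' y y' ww yy; apply/ffunP => p; rewrite !ffunE; congr enum_rank_in.
  apply/ffunP => b; rewrite !ffunE (decU_own (blk_own b ww)).
  congr (decU _ _ _ _); apply/funext => i; apply: yy.
  apply: (@time_lt _ B.+1); last exact: n_ge.
  by rewrite ltnS ltn_ord.
Qed.

Definition relay_obs (w : Msg bsz) (b : 'I_B) (om : Omega) : vec :=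
  fun i => \sum_k h k * xu k (blk w b) i + z (None, (b * n0 + i)%N) om.

Definition user_obs (j : 'I_3) (s : S) (b : nat) (om : Omega) : vec :=
  fun i => h j * xr s i + z (Some j, (b.+1 * n0 + i)%N) om.

Local Notation H := (hist h z block_code).

Lemma window_relay w om t (b : 'I_B) : (b.+1 * n0 <= t)%N ->
  window (H w om t None) b = relay_obs w b om.
Proof.
move=> bt; apply/funext => i; rewrite /window hist_relay; last exact: (@time_lt _ b.+1).
rewrite /relay_obs; congr (_ + _); apply: eq_bigr => k _; congr (_ * _).
rewrite /= /block_uenc time_div time_pos; case: insubP => [b' _ /val_inj->//|].
by rewrite ltn_ord.
Qed.

Lemma window_user w om j (b : 'I_B) :
  window (H w om n (Some j)) b.+1 = user_obs j (decR (relay_obs w b om)) b om.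
Proof.
apply/funext => i; rewrite /window hist_user; last first.
  apply: (@time_lt _ B.+1); last exact: n_ge.
  by rewrite ltnS ltn_ord.
rewrite /user_obs; congr (_ * _ + _).
rewrite /= /block_renc time_div time_pos /= ltn_ord window_relay//.
by rewrite leq_addr.
Qed.

Lemma measurable_relay_obs w b t : measurable_fun setT (fun om => relay_obs w b om t).
Proof. by apply: measurable_funD. Qed.

Lemma fmeas_relay w b : fmeas (fun om => decR (relay_obs w b om)).
Proof. by apply: decR_meas => t; exact: measurable_relay_obs. Qed.

Lemma measurable_user_obs j s b t : measurable_fun setT (fun om => user_obs j s b om t).
Proof. by apply: measurable_funD. Qed.

Lemma block_xsym_user w i t om :
  xsym h z block_code w (Some i) t om = block_uenc i t w (fun=> 0).
Proof. by []. Qed.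

Lemma block_xsym_relay w t om : xsym h z block_code w None t om =
  if insub (t %/ n0).-1 is Some b then
    if (0 < t %/ n0)%N then xr (decR (relay_obs w b om)) (pos t) else 0
  else 0.
Proof.
rewrite /= /block_renc; case: (posnP (t %/ n0)) => [->|t0] /=; first by case: insub.
case: insubP => [b bB bE|].
  have -> : (t %/ n0 <= B)%N by rewrite -(prednK t0).
  rewrite -bE window_relay// bE prednK//; exact: leq_trunc_div.
by rewrite -leqNgt => Bt; rewrite leqNgt -{1}(prednK t0) ltnS Bt.
Qed.

Lemma block_xsym_measurable w k t : measurable_fun setT (xsym h z block_code w k t).
Proof.
case: k => [i|].
  rewrite (_ : xsym _ _ _ _ _ _ = cst (block_uenc i t w (fun=> 0))); first exact: measurable_cst.
  by apply/funext => om; rewrite block_xsym_user.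
rewrite (_ : xsym _ _ _ _ _ _ = fun om => if insub (t %/ n0).-1 is Some b then
    if (0 < t %/ n0)%N then xr (decR (relay_obs w b om)) (pos t) else 0
  else 0); last by apply/funext => om; rewrite block_xsym_relay.
case: insub => [b|]; last exact: measurable_cst.
case: (0 < t %/ n0)%N; last exact: measurable_cst.
exact: (fmeas_measurable_fun (fun s => xr s (pos t)) (fmeas_relay w b)).
Qed.

Definition user_est w om j p : {ffun 'I_B -> X} :=
  [ffun b => decU j (blk w b) (user_obs j (decR (relay_obs w b om)) b om) p].

Lemma block_udec_hist w om j p :
  block_udec j w (H w om n (Some j)) p = enum_rank_in (msg_set0 p) (user_est w om j p).
Proof.
rewrite ffunE; congr enum_rank_in.
by apply/ffunP => b; rewrite !ffunE window_user.
Qed.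

Lemma block_err_measurable w : measurable (err_event h z block_code w).
Proof.
pose V om : {ffun 'I_3 * 'I_B -> bmsg} :=
  [ffun jb => decU jb.1 (blk w jb.2) (user_obs jb.1 (decR (relay_obs w jb.2 om)) jb.2 om)].
have mV : fmeas V.
  apply: fmeas_ffun => -[j b]; rewrite /V.
  rewrite (_ : (fun om => _) = fun om => decU j (blk w b) (user_obs j (decR (relay_obs w b om)) b om)); last first.
    by apply/funext => om; rewrite ffunE.
  apply: (fmeas_bind (F := fun s om => decU j (blk w b) (user_obs j s b om)) (fmeas_relay w b)) => s.
  by apply: decU_meas => t; exact: measurable_user_obs.
pose E : set {ffun 'I_3 * 'I_B -> bmsg} := [set v : {ffun 'I_3 * 'I_B -> bmsg} | exists (j : 'I_3) (p : pair3), (val p).2 = j /\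
   enum_rank_in (msg_set0 p) [ffun b : 'I_B => v (j, b) p] != w p].
rewrite (_ : err_event h z block_code w = V @^-1` E); first exact: mV.
have VE om j p : [ffun b => V om (j, b) p] = user_est w om j p.
  by apply/ffunP => b; rewrite !ffunE.
apply/seteqP; split => om [j [p [pj e]]]; exists j, p; split => //; move: e => /=.
  by rewrite block_udec_hist VE.
by rewrite block_udec_hist VE.
Qed.

Definition relay_err (m : bmsg) (b : nat) : set Omega :=
  [set om | decR (fun i => \sum_k h k * xu k m i + z (None, (b * n0 + i)%N) om) <> st m].
(** The downlink is analysed for the state [st m] that the relay should have decoded, which
    separates it from the uplink. *)
Definition user_err (m : bmsg) (b : nat) (j : 'I_3) : set Omega :=
  [set om | exists p : pair3, (val p).2 = j /\ decU j m (user_obs j (st m) b om) p <> m p].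

Lemma block_err_sub w om : err_event h z block_code w om ->
  exists b, relay_err (blk w b) b om \/ exists j, user_err (blk w b) b j om.
Proof.
move=> [j [p [pj e]]]; apply: contrapT => none.
have ok b : decR (relay_obs w b om) = st (blk w b) /\
    decU j (blk w b) (user_obs j (st (blk w b)) b om) p = blk w b p.
  split; apply: contrapT => bad; apply: none; exists b; first by left.
  by right; exists j, p.
move: e => /negP[]; apply/eqP; rewrite /= block_udec_hist.
suff -> : user_est w om j p = enum_val (w p) by exact: enum_valK_in.
apply/ffunP => b; rewrite ffunE.
by have [-> ->] := ok b; rewrite ffunE.
Qed.

Lemma sum_time (F : nat -> R) (N : nat) :
  \sum_(0 <= t < N * n0) F t = \sum_(b < N) \sum_(i < n0) F (b * n0 + i)%N.
Proof.
elim: N => [|N IH]; first by rewrite mul0n big_geq// big_ord0.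
rewrite mulSn addnC (@big_cat_nat _ _ _ (N * n0)) ?leq_addr//= IH big_ord_recr /=; congr (_ + _).
rewrite -{1}[(N * n0)%N]add0n big_addn addKn big_mkord.
by apply: eq_bigr => i _; rewrite addnC.
Qed.

Lemma block_energy w k om : \sum_(t < n) xsym h z block_code w k t om ^+ 2 <= n%:R * P.
Proof.
set F := fun t => xsym h z block_code w k t om ^+ 2.
rewrite -(big_mkord xpredT F) (@big_cat_nat _ _ _ (B.+1 * n0))//=.
have zero t : (B.+1 * n0 <= t)%N -> F t = 0.
  move=> Bt; have Bd : (B < t %/ n0)%N by rewrite leq_divRL.
  rewrite /F; case: (k) => [i|].
    rewrite block_xsym_user /block_uenc insubF ?expr0n//.
    by apply/negbTE; rewrite -leqNgt ltnW.
  rewrite block_xsym_relay insubF ?expr0n//.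
  by apply/negbTE; rewrite -leqNgt -ltnS prednK// (leq_ltn_trans _ Bd).
rewrite [X in _ + X]big_nat_cond [X in _ + X]big1 ?addr0; last first.
  by move=> t /andP[/andP[/zero]].
rewrite sum_time.
have bound (b : 'I_B.+1) : \sum_(i < n0) F (b * n0 + i)%N <= n0%:R * P.
  rewrite /F; case: (k) => [i|].
    under eq_bigr do rewrite block_xsym_user /block_uenc time_div time_pos.
    case: (insub (val b) : option 'I_B) => [b'|]; first exact: xu_power.
    by rewrite big1 ?mulr_ge0// => t _; rewrite expr0n.
  under eq_bigr do rewrite block_xsym_relay time_div time_pos.
  case: (insub (val b).-1 : option 'I_B) => [b'|]; last by rewrite big1 ?mulr_ge0// => t _; rewrite expr0n.
  case: (0 < b)%N; first exact: xr_power.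
  by rewrite big1 ?mulr_ge0// => t _; rewrite expr0n.
apply: (@le_trans _ _ (\sum_(b < B.+1) n0%:R * P)); first by apply: ler_sum => b _; exact: bound.
rewrite sum_cst card_ord mulrA -natrM ler_wpM2r// ler_nat.
exact: n_ge.
Qed.

Lemma block_power k :
  (((#|{: Msg bsz}|%:R * n%:R)^-1)%:E *
    \sum_(w : Msg bsz) \sum_(t < n) \int[Pr]_om (xsym h z block_code w k t om ^+ 2)%:E <= P%:E)%E.
Proof.
have each w : (\sum_(t < n) \int[Pr]_om (xsym h z block_code w k t om ^+ 2)%:E <= (n%:R * P)%:E)%E.
  have mx t : measurable_fun setT (fun om => (xsym h z block_code w k t om ^+ 2)%:E).
    by apply/measurable_EFinP; apply: measurable_funX; exact: block_xsym_measurable.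
  rewrite -ge0_integral_sum//; last by move=> t om _; rewrite lee_fin sqr_ge0.
  apply: (@le_trans _ _ (\int[Pr]_om (cst (n%:R * P)%:E om)))%E.
    apply: ge0_le_integral => //.
    - by move=> om _; rewrite sume_ge0// => t _; rewrite lee_fin sqr_ge0.
    - exact: emeasurable_sum.
    - by move=> om _; rewrite sumEFin lee_fin block_energy.
  have := @integral_cst _ _ R Pr setT measurableT (n%:R * P)%:E.
  by rewrite [X in (_ * X)%E]probability_setT mule1 => ->.
have [W0|W0] := posnP #|{: Msg bsz}|.
  by rewrite W0 mul0r invr0 mul0e lee_fin.
have n_gt0 : (0 < n)%N by apply: leq_trans n_ge; rewrite muln_gt0 n0_gt0.
apply: (@le_trans _ _ (((#|{: Msg bsz}|%:R * n%:R)^-1)%:E * \sum_(w : Msg bsz) (n%:R * P)%:E))%E.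
  by rewrite lee_wpmul2l ?lee_fin ?invr_ge0 ?mulr_ge0//; apply: lee_sum => w _; exact: each.
rewrite sumEFin -EFinM lee_fin sum_cst [X in _ * X]mulrA mulrA mulVf ?mul1r//.
by rewrite mulf_neq0// pnatr_eq0 -lt0n.
Qed.

End BlockCode.

(** * Averaging over the codes and the noise *)

Section Derandomization.
Context {R : realType} {d : measure_display} {Omega : measurableType d}.
Variable Pr : probability Omega R.

Lemma fine_prob (W : set Omega) : measurable W -> (fine (Pr W))%:E = Pr W.
Proof. by move=> mW; rewrite fineK// fin_num_measure. Qed.

(** The sum over the codes is exchanged with the integral over the noise. For each noise outside [N]
    the finite average over the codes is at most [beta], and [N] itself adds at most [nu]. *)
Lemma avg_prob_le (Th : finType) (W : Th -> set Omega) (N : set Omega)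
    (bad : Th -> Omega -> bool) (beta nu : R) : (0 < #|Th|)%N -> 0 <= beta ->
  (forall th, measurable (W th)) -> measurable N -> (Pr N <= nu%:E)%E ->
  (forall th om, ~ N om -> W th om -> bad th om) ->
  (forall om, ~ N om -> avg (fun th => (bad th om)%:R : R) <= beta) ->
  avg (fun th => fine (Pr (W th))) <= beta + nu.
Proof.
move=> T0 b0 mW mN PN Wbad hb.
have TR : 0 < #|Th|%:R :> R by rewrite ltr0n.
rewrite /avg ler_pdivrMr// -lee_fin -sumEFin.
under eq_bigr do rewrite fine_prob//.
have mi (A : set Omega) : measurable A -> measurable_fun setT (EFin \o (\1_A : Omega -> R)).
  by move=> mA; apply/measurable_EFinP; exact: measurable_indic.
have E (A : set Omega) : measurable A -> Pr A = (\int[Pr]_om (\1_A om)%:E)%E.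
  by move=> mA; rewrite integral_indic// setIT.
under eq_bigr do rewrite E//.
rewrite -(@ge0_integral_sum _ _ _ Pr setT measurableT _ (fun th om => (\1_(W th) om)%:E))//; last by move=> th; exact: mi.
pose G (om : Omega) : \bar R := ((#|Th|%:R * beta)%:E + #|Th|%:R%:E * (\1_N om)%:E)%E.
have mG : measurable_fun setT G.
  by apply: emeasurable_funD => //; apply: measurable_funeM; exact: mi.
apply: (@le_trans _ _ (\int[Pr]_om G om))%E.
  apply: ge0_le_integral => //.
  - by move=> om _; rewrite sume_ge0// => th _; rewrite lee_fin.
  - by apply: emeasurable_sum => th; exact: mi.
  - move=> om _; rewrite sumEFin /G -EFinM -EFinD lee_fin -mulrDr.
    have [omN|omN] := pselect (N om).
      rewrite indicE mem_set// -(sum_cst Th (beta + 1)); apply: ler_sum => th _.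
      by rewrite indicE (@le_trans _ _ 1) ?lerDr//; case: (om \in _).
    rewrite indicE memNset// addr0 -ler_pdivrMl// mulrC.
    apply: le_trans (hb om omN); apply: ler_avg => th.
    rewrite indicE; apply: ler_bool; rewrite inE; exact: Wbad.
have h0 om : (0 <= #|Th|%:R%:E * ((\1_N om)%:E : \bar R))%E.
  by apply: mule_ge0; rewrite lee_fin.
rewrite /G (ge0_integralD _ _ (fun _ _ => _) _ (fun om _ => h0 om))//; last 2 first.
- by rewrite lee_fin mulr_ge0.
- by apply: measurable_funeM; exact: mi.
have -> : (\int[Pr]_om (#|Th|%:R * beta)%:E = (#|Th|%:R * beta)%:E)%E.
  have := @integral_cst _ _ R Pr setT measurableT (#|Th|%:R * beta)%:E.
  by rewrite [X in (_ * X)%E]probability_setT mule1 => ->.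
rewrite ge0_integralZl//; last 2 first.
all: try exact: mi.
all: try by rewrite lee_fin.

rewrite -E// mulrDl EFinD [(beta * _)%R]mulrC leeD2l// mulrC EFinM lee_wpmul2l// lee_fin.
Qed.

Lemma gaussian_window (z : node * nat -> Omega -> R) k s n : iid_std_gaussian Pr z ->
  gaussian_vector Pr (fun i : 'I_n => z (k, (s + i)%N)).
Proof.
move=> [mz prodz]; split=> [t|B mB]; first exact: mz.
pose key (i : 'I_n) : node * nat := (k, (s + i)%N).
have key_inj : injective key by move=> i j [] /addnI/val_inj.
pose B' (kt : node * nat) : set R := if [pick i | key i == kt] is Some i then B i else setT.
have B'E i : B' (key i) = B i.
  rewrite /B'; case: pickP => [j /eqP/key_inj->//|/(_ i)]; by rewrite eqxx.
have mB' kt : measurable (B' kt) by rewrite /B'; case: pickP.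
have := prodz [seq key i | i <- enum 'I_n] B' _ mB'.
rewrite map_inj_uniq// enum_uniq big_map big_enum /= => /(_ isT).
under [X in _ = X -> _]eq_bigr do rewrite B'E.
move=> <-; congr (Pr _); apply/seteqP; split => om /= h.
  by move=> _ /mapP[i _ ->]; rewrite B'E; exact: h.
by move=> t; have := h (key t) (map_f key (mem_enum _ t)); rewrite B'E.
Qed.

End Derandomization.

Section RandomBlockCode.
Context {R : realType} {d : measure_display} {Omega : measurableType d}.
Variables (Pr : probability Omega R) (h : 'I_3 -> R) (z : node * nat -> Omega -> R) (P : R).
Hypothesis mz : forall k, measurable_fun setT (z k).
Hypothesis P_ge0 : 0 <= P.
Variables (B n0 n : nat) (X S Th : finType).
Hypothesis Th_gt0 : (0 < #|Th|)%N.
Hypothesis n0_gt0 : (0 < n0)%N.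
Hypothesis n_ge : (B.+1 * n0 <= n)%N.
Variables (Vs : pair3 -> {set X}) (x0 : pair3 -> X).
Hypothesis x0_in : forall p, x0 p \in Vs p.

Local Notation bmsg := {ffun pair3 -> X}.
Local Notation vec := ('I_n0 -> R).

Variables (xu : Th -> 'I_3 -> bmsg -> vec) (xr : Th -> S -> vec) (decR : Th -> vec -> S)
  (decU : Th -> 'I_3 -> bmsg -> vec -> bmsg) (st : bmsg -> S).
Hypothesis xu_own : forall th i (m m' : bmsg),
  (forall p : pair3, (val p).1 = i -> m p = m' p) -> xu th i m = xu th i m'.
Hypothesis decU_own : forall th j (m m' : bmsg),
  (forall p : pair3, (val p).1 = j -> m p = m' p) -> decU th j m = decU th j m'.
Hypothesis xu_power : forall th i m, \sum_t xu th i m t ^+ 2 <= n0%:R * P.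
Hypothesis xr_power : forall th s, \sum_t xr th s t ^+ 2 <= n0%:R * P.
Hypothesis decR_meas : forall th (Y : Omega -> vec), (forall t, measurable_fun setT (fun om => Y om t)) ->
  fmeas (fun om => decR th (Y om)).
Hypothesis decU_meas : forall th j m (Y : Omega -> vec), (forall t, measurable_fun setT (fun om => Y om t)) ->
  fmeas (fun om => decU th j m (Y om)).
Variable a : R.
Hypothesis relay_avg : forall (m : bmsg) b, (forall p, m p \in Vs p) ->
  avg (fun th => fine (Pr (relay_err h z (xu th) (decR th) st m b))) <= a.
Hypothesis user_avg : forall (m : bmsg) b j, (forall p, m p \in Vs p) ->
  avg (fun th => fine (Pr (user_err h z (xr th) (decU th) st m b j))) <= a.

Lemma exists_block_code : exists c : ycode n,
  ycode_wf c /\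
  [/\ (forall p, msz _ c p = (#|Vs p| ^ B)%N),
      (forall w k t, measurable_fun setT (xsym h z c w k t)),
      (forall w, measurable (err_event h z c w)),
      (forall k, (((#|{: Msg (msz _ c)}|%:R * n%:R)^-1)%:E *
          \sum_(w : Msg (msz _ c)) \sum_(t < n) \int[Pr]_om (xsym h z c w k t om ^+ 2)%:E <= P%:E)%E) &
      ((#|{: Msg (msz _ c)}|%:R^-1)%:E * \sum_(w : Msg (msz _ c)) Pr (err_event h z c w)
         <= (B%:R * (4 * a))%:E)%E].
Proof.
pose code th := @block_code R B n0 n X S n0_gt0 Vs x0 x0_in (xu th) (xr th) (decR th) (decU th).
have mR th m b : measurable (relay_err h z (xu th) (decR th) st m b).
  rewrite /relay_err; apply: (@decR_meas th (fun om i => _) _ (fun s => s <> st m)) => t.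
  exact: measurable_funD.
have mU th m b j : measurable (user_err h z (xr th) (decU th) st m b j).
  rewrite /user_err.
  apply: (@decU_meas th j m (fun om => user_obs h z (xr th) j (st m) b om) _
    (fun e => exists p : pair3, (val p).2 = j /\ e p <> m p)) => t.
  exact: measurable_funD.
have mE th w : measurable (err_event h z (code th) w).
  apply: block_err_measurable => //; last by move=> j m; exact: decU_meas.
  exact: decR_meas.
pose bound th (m : bmsg) (b : nat) : R := fine (Pr (relay_err h z (xu th) (decR th) st m b))
  + \sum_j fine (Pr (user_err h z (xr th) (decU th) st m b j)).
have errb th w : fine (Pr (err_event h z (code th) w)) <= \sum_(b < B) bound th (blk w b) b.
  rewrite -lee_fin fine_prob// -sumEFin.
  (* Four events per block: index 0 stands for the relay, the others for the three users. This is
     the factor 4. *)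
  pose BK (k : 'I_B * 'I_4) := match unlift ord0 k.2 with
    | None => relay_err h z (xu th) (decR th) st (blk w k.1) k.1
    | Some j => user_err h z (xr th) (decU th) st (blk w k.1) k.1 j end.
  have mBK k : measurable (BK k) by rewrite /BK; case: unlift => [j|]; [exact: mU|exact: mR].
  apply: (le_trans (measure_le_sum Pr (P := xpredT) (mE th w) (fun k _ => mBK k) _)).
    move=> om /(block_err_sub n_ge st)[b [r|[j u]]].
      by exists (b, ord0) => //; rewrite /BK unlift_none.
    by exists (b, lift ord0 j) => //; rewrite /BK liftK.
  rewrite -(pair_bigA _ (fun b o => Pr (BK (b, o)))) /=; apply: lee_sum => b _.
  rewrite /bound EFinD fine_prob// -sumEFin big_ord_recl {1}/BK unlift_none leeD2l//.
  by apply: lee_sum => j _; rewrite /BK liftK fine_prob.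
have bound_avg (m : bmsg) b : (forall p, m p \in Vs p) -> avg (fun th => bound th m b) <= 4 * a.
  move=> mV; rewrite /bound avgD avg_sum.
  have -> : 4 * a = a + \sum_(j < 3) a by rewrite sum_cst card_ord; ring.
  by apply: lerD; [exact: relay_avg|apply: ler_sum => j _; exact: user_avg].
have blkV (w : Msg (bsz B Vs)) b p : blk w b p \in Vs p.
  by rewrite ffunE; have := enum_valP (w p); rewrite inE => /ffun_onP.
(* Averages over codes and messages commute, so some code is good on average over uniformly
   distributed messages. *)
pose tot th := avg (fun w : Msg (bsz B Vs) => fine (Pr (err_event h z (code th) w))).
have [th htot] : exists th, tot th <= B%:R * (4 * a).
  apply: avg_le_exists => //; rewrite /tot avg_exchange.
  have W0 : (0 < #|{: Msg (bsz B Vs)}|)%N.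
    by apply/card_gt0P; exists (finfun (fun p => enum_rank_in (msg_set0 B x0_in p) [ffun=> x0 p])).
  rewrite -(avg_const (B%:R * (4 * a)) W0); apply: ler_avg => w.
  apply: (@le_trans _ _ (avg (fun th => \sum_(b < B) bound th (blk w b) b))).
    by apply: ler_avg => th; exact: errb.
  have -> : B%:R * (4 * a) = \sum_(b < B) (4 * a) by rewrite sum_cst card_ord.
  by rewrite avg_sum; apply: ler_sum => b _; apply: bound_avg => p; exact: blkV.
exists (code th); split; first by apply: block_code_wf => //; [exact: xu_own|exact: decU_own].
split.
- by move=> p; rewrite /= /bsz card_msg_set.
- by move=> w k t; apply: block_xsym_measurable => //; exact: decR_meas.
- exact: mE.
- by move=> k; apply: block_power => //; exact: decR_meas.
- apply: le_trans (_ : ((tot th)%:E <= _)%E); last by rewrite lee_fin.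
  rewrite /tot /avg mulrC EFinM -sumEFin lee_wpmul2l// ?lee_fin ?invr_ge0//.
  by apply: lee_sum => w _; rewrite fine_prob.
Qed.

End RandomBlockCode.

(** * The network code *)

Section DecoderMeasurability.
Context {R : realType} {d : measure_display} {Omega : measurableType d}.
Variables (q n K kl : nat) (delta : R) (I : finType) (two : I -> bool).
Variables (g alpha T : I -> R) (C : I -> {set 'rV['F_q]_K}).
Local Notation lcode := (lcode q n K kl).

Lemma fmeas_find_index s (w : lcode) (Y : Omega -> 'I_n -> R) :
  (forall t, measurable_fun setT (fun om => Y om t)) ->
  fmeas (fun om => find_index delta two g alpha T C s w (Y om)).
Proof.
move=> mY.
pose F om : {ffun 'rV['F_q]_K * 'rV['F_q]_kl -> bool} :=
  [ffun a => index_test delta two g alpha T C s w (Y om) a].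
have mF : fmeas F.
  apply: fmeas_ffun => a; rewrite (_ : (fun om => _) = fun om => index_test delta two g alpha T C s w (Y om) a); last first.
    by apply/funext => om; rewrite ffunE.
  rewrite /index_test; case: (a.1 \in C s) => /=; last exact: fmeas_cst.
  apply: fmeas_bool; apply: measurable_set_le; last exact: measurable_cst.
  apply: measurable_sum => t; have m : measurable_fun setT (fun om => alpha s * Y om t - g s * index_point delta (two s) w a t).
    by apply: measurable_funB => //; apply: measurable_funM.
  exact: measurable_funM.
rewrite (_ : (fun om => _) = fun om => odflt (0, 0) [pick a | F om a]); last first.
  by apply/funext => om; rewrite /find_index; congr odflt; apply: eq_pick => a; rewrite ffunE.
exact: (fmeas_comp (fun f : {ffun 'rV['F_q]_K * 'rV['F_q]_kl -> bool} => odflt (0, 0) [pick a | f a])).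
Qed.

Lemma fmeas_successive_decode (th : {ffun I -> lcode}) (l : seq I) (Y : Omega -> 'I_n -> R) :
  (forall t, measurable_fun setT (fun om => Y om t)) ->
  fmeas (fun om => successive_decode delta two g alpha T C th l (Y om)).
Proof.
move: Y; elim: l => [|s l IH] Y mY /=; first exact: fmeas_cst.
case: (g s == 0); first exact: IH.
pose F a om : {ffun I -> 'rV['F_q]_K} := [ffun s' => if s' == s then a.1 else
  successive_decode delta two g alpha T C th l
    (fun t => Y om t - g s * index_point delta (two s) (th s) a t) s'].
apply: (fmeas_bind (F := F) (fmeas_find_index s (th s) mY)) => a.
apply: (fmeas_comp (fun D : {ffun I -> 'rV['F_q]_K} => [ffun s' => if s' == s then a.1 else D s'])
  (f := fun om => successive_decode delta two g alpha T C th l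
    (fun t => Y om t - g s * index_point delta (two s) (th s) a t))).
by apply: IH => t; apply: measurable_funB.
Qed.

End DecoderMeasurability.

Section Network.
Context {R : realType} {d : measure_display} {Omega : measurableType d}.
Variables (Pr : probability Omega R) (h : 'I_3 -> R) (z : node * nat -> Omega -> R) (P : R).
Hypothesis Hz : iid_std_gaussian Pr z.
Hypothesis P_ge0 : 0 <= P.
Variables (B n0 n q K kl : nat) (v beta nu : R).
Hypothesis gp : good_params n0 q kl v.
Hypothesis v_ge0 : 0 <= v.
Hypothesis beta_ge0 : 0 <= beta.
Hypothesis n_ge : (B.+1 * n0 <= n)%N.
Hypothesis tail : forall x : 'I_n0 -> Omega -> R, gaussian_vector Pr x ->
  (Pr [set om | (n0%:R * (1 + v) < \sum_t x t om ^+ 2)%R] <= nu%:E)%E.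

Variables (I X : finType) (Vs : pair3 -> {set X}) (x0 : pair3 -> X).
Hypothesis x0_in : forall p, x0 p \in Vs p.
Local Notation bmsg := {ffun pair3 -> X}.
Local Notation vec := ('I_n0 -> R).
Local Notation T := 'rV['F_q]_K.
Local Notation code := {ffun I -> lcode q n0 K kl}.
Local Notation delta := (grid_step v).

Variables (two : I -> bool) (mu : bmsg -> I -> bool -> T) (tx : I -> bool -> 'I_3).
Variables (amp : I -> bool -> R) (ramp : I -> R) (gU : I -> R) (sqU : seq I) (sqD : 'I_3 -> seq I).
Variables (C : I -> {set T}) (est : 'I_3 -> bmsg -> {ffun I -> T} -> bmsg).

Definition decode (tw : I -> bool) (g : I -> R) (sq : seq I) (th : code) (y : vec) : {ffun I -> T} :=
  successive_decode delta tw g (mmse_coef tw g sq) (threshold n0 tw g (mmse_coef tw g sq) sq v) C th sq y.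

Definition decoded (tw : I -> bool) (g : I -> R) (sq : seq I) (m : I -> bool -> T) (zt : vec) (th : code) : bool :=
  near_orth delta v th m &&
  [forall s, (s \in sq) ==> (decode tw g sq th (residual delta tw g sq th m zt 0) s == msg_sum tw m s)].

Definition reliable (tw : I -> bool) (g : I -> R) (sq : seq I) (m : I -> bool -> T) : Prop :=
  forall zt : vec, dot zt zt <= n0%:R * (1 + v) ->
  avg (fun th : code => (~~ decoded tw g sq m zt th)%:R : R) <= beta.

Definition sums (m : bmsg) : {ffun I -> T} := [ffun s => msg_sum two (mu m) s].
(* The relay uses only the first codeword of each layer. *)
Definition single (s0 : {ffun I -> T}) (s : I) (i : bool) : T := if i then 0 else s0 s.
Local Notation one := (fun _ : I => false).
(** The decoder works with nonnegative gains: each user multiplies its received vector by the sign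
    of its channel gain, which does not increase the norm of the noise. *)
Definition gD (j : 'I_3) (s : I) : R := `|h j| * ramp s.

Hypothesis mu_own : forall s i (m m' : bmsg), (forall p : pair3, (val p).1 = tx s i -> m p = m' p) ->
  mu m s i = mu m' s i.
Hypothesis est_own : forall j (m m' : bmsg) s0, (forall p : pair3, (val p).1 = j -> m p = m' p) ->
  est j m s0 = est j m' s0.
Hypothesis est_correct : forall j (m : bmsg) (s0 : {ffun I -> T}), (forall s, s \in sqD j -> s0 s = sums m s) ->
  forall p : pair3, (val p).2 = j -> est j m s0 p = m p.
Hypothesis amp_gain : forall s i, h (tx s i) * amp s i = gU s * (~~ i || two s)%:R.
Hypothesis amp_power : forall k, let c (p : I * bool) := (tx p.1 p.2 == k)%:R * amp p.1 p.2 in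
  \sum_p c p ^+ 2 + v * (\sum_p c p ^+ 2 + (\sum_p `|c p|) ^+ 2) <= P.
Hypothesis ramp_power : \sum_s ramp s ^+ 2 + v * (\sum_s ramp s ^+ 2 + (\sum_s `|ramp s|) ^+ 2) <= P.
Hypothesis sqU_all : forall s, s \in sqU.
Hypothesis uplink : forall m : bmsg, (forall p, m p \in Vs p) -> reliable two gU sqU (mu m).
Hypothesis downlink : forall (m : bmsg) j, (forall p, m p \in Vs p) ->
  reliable one (gD j) (sqD j) (single (sums m)).

Let n0_gt0 : (0 < n0)%N := gp_n gp.
Let qp : prime q := gp_prime gp.

(* Only a negligible fraction of the codes ever needs this; it enforces the power constraint surely. *)
Definition trunc (x : vec) : vec := if \sum_t x t ^+ 2 <= n0%:R * P then x else fun=> 0.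

Lemma trunc_power x : \sum_t trunc x t ^+ 2 <= n0%:R * P.
Proof.
rewrite /trunc; case: ifP => // _; rewrite big1 ?mulr_ge0// => t _; exact: expr0n.
Qed.

Definition user_signal (th : code) k m : vec := fun t =>
  \sum_(p : I * bool) (tx p.1 p.2 == k)%:R * amp p.1 p.2 * code_point delta (th p.1) p.2 (mu m p.1 p.2) t.
Definition relay_signal (th : code) (s0 : {ffun I -> T}) : vec := fun t =>
  \sum_s ramp s * code_point delta (th s) false (s0 s) t.

Definition Th : finType := (code * code)%type.

Lemma Th_gt0 : (0 < #|Th|)%N.
Proof.
have c0 : (0 < #|code|)%N.
  rewrite card_ffun expn_gt0 (layer_code_gt0 (lin_Gam_gt0 q n0 K kl))//.
by rewrite card_prod muln_gt0 c0.
Qed.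

Definition net_xu (th : Th) k m : vec := trunc (user_signal th.1 k m).
Definition net_xr (th : Th) s0 : vec := trunc (relay_signal th.2 s0).
Definition net_decR (th : Th) (y : vec) := decode two gU sqU th.1 y.
Definition net_decU (th : Th) j m (y : vec) :=
  est j m (decode one (gD j) (sqD j) th.2 (fun t => Num.sg (h j) * y t)).

(** For a nearly orthogonal code the truncation is inactive. The map [key] lets one estimate cover
    the users, indexed by both codewords of every layer, and the relay, which uses one codeword per
    layer. *)
Lemma near_orth_power (J : finType) (key : J -> I * bool) (c : J -> R) (th : code) m : injective key ->
  \sum_p c p ^+ 2 + v * (\sum_p c p ^+ 2 + (\sum_p `|c p|) ^+ 2) <= P -> near_orth delta v th m ->
  \sum_t (\sum_p c p * code_point delta (th (key p).1) (key p).2 (m (key p).1 (key p).2) t) ^+ 2 <= n0%:R * P.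
Proof.
move=> kinj cP /andP[/forallP sh /forallP orth].
rewrite -dot_sqr; apply: le_trans (ler_wpM2l (ler0n _ _) cP).
apply: (@dot_near_orthonormal _ _ _ c (fun p => code_point delta (th (key p).1) (key p).2 (m (key p).1 (key p).2))) => //.
- move=> p; apply: le_trans (code_point_dot qp (sh (key p))) _.
  by rewrite ler_peMr// lerDl.
- move=> p p' pp'; have /forallP/(_ (key p'))/implyP := orth (key p); apply.
  by rewrite (inj_eq kinj).
Qed.

Lemma user_trunc th k m : near_orth delta v th.1 (mu m) -> net_xu th k m = user_signal th.1 k m.
Proof.
move=> no; rewrite /net_xu /trunc ifT//.
exact: (near_orth_power (key := id) (fun _ _ => id) (amp_power k) no).
Qed.

Lemma relay_trunc th s0 : near_orth delta v th.2 (single s0) -> net_xr th s0 = relay_signal th.2 s0.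
Proof.
move=> no; rewrite /net_xr /trunc ifT//.
have kinj : injective (fun s : I => (s, false)) by move=> s s' [].
exact: (near_orth_power kinj ramp_power no).
Qed.

Lemma relay_receives th m zt t : near_orth delta v th.1 (mu m) ->
  \sum_k h k * net_xu th k m t + zt t = residual delta two gU sqU th.1 (mu m) zt 0 t.
Proof.
move=> no; rewrite /residual; congr (_ + _).
under eq_bigr do rewrite user_trunc// /user_signal mulr_sumr.
rewrite exchange_big /= -(pair_bigA _ (fun s i => \sum_k h k * ((tx s i == k)%:R * amp s i * code_point delta (th.1 s) i (mu m s i) t))) /=.
apply: eq_bigr => s _.
have E i : \sum_k h k * ((tx s i == k)%:R * amp s i * code_point delta (th.1 s) i (mu m s i) t)
   = gU s * (~~ i || two s)%:R * code_point delta (th.1 s) i (mu m s i) t.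
  rewrite -amp_gain (bigD1 (tx s i))//= eqxx mul1r big1 ?addr0 ?mulrA// => k kt.
  by rewrite eq_sym (negbTE kt) !mul0r mulr0.
rewrite big_bool /= !E /layer_point /=; case: (two s); rewrite ?mulr1n ?mulr0n; ring.
Qed.

Lemma user_receives th j m (zt : vec) : near_orth delta v th.2 (single (sums m)) ->
  (fun t => Num.sg (h j) * (h j * net_xr th (sums m) t + zt t))
  = residual delta one (gD j) (sqD j) th.2 (single (sums m)) (fun t => Num.sg (h j) * zt t) 0.
Proof.
move=> no; apply/funext => t; rewrite mulrDr relay_trunc// /residual; congr (_ + _).
rewrite mulrA -normrEsg /relay_signal mulr_sumr; apply: eq_bigr => s _.
by rewrite /layer_point /= mulr0n addr0 /gD mulrA.
Qed.

Lemma dot_sgM (a : R) (x : vec) : dot (fun t => Num.sg a * x t) (fun t => Num.sg a * x t) <= dot x x.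
Proof.
apply: ler_sum => t _; rewrite mulrACA ler_piMl -?expr2 ?sqr_ge0//.
by rewrite sqr_sg; case: (a != 0).
Qed.

Lemma avg_fst_code (f : code -> R) : avg (fun th : Th => f th.1) = avg f.
Proof.
have := Th_gt0; rewrite card_prod muln_gt0 => /andP[c0 _].
by rewrite avg_pair; apply: eq_avg => x /=; rewrite avg_const.
Qed.

Lemma avg_snd_code (f : code -> R) : avg (fun th : Th => f th.2) = avg f.
Proof.
have := Th_gt0; rewrite card_prod muln_gt0 => /andP[c0 _].
by rewrite avg_pair /= avg_const.
Qed.

Lemma single_sums m s : msg_sum one (single (sums m)) s = sums m s.
Proof. by rewrite /msg_sum /single mulr0n addr0. Qed.

Lemma eq_bool_mul (b : bool) (a x y : R) : (b -> x = y) -> b%:R * a * x = b%:R * a * y.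
Proof. by case: b => [->//|_]; rewrite !mul0r. Qed.

Lemma network_code : exists c : ycode n,
  ycode_wf c /\
  [/\ (forall p, msz _ c p = (#|Vs p| ^ B)%N),
      (forall w k t, measurable_fun setT (xsym h z c w k t)),
      (forall w, measurable (err_event h z c w)),
      (forall k, (((#|{: Msg (msz _ c)}|%:R * n%:R)^-1)%:E *
          \sum_(w : Msg (msz _ c)) \sum_(t < n) \int[Pr]_om (xsym h z c w k t om ^+ 2)%:E <= P%:E)%E) &
      ((#|{: Msg (msz _ c)}|%:R^-1)%:E * \sum_(w : Msg (msz _ c)) Pr (err_event h z c w)
         <= (B%:R * (4 * (beta + nu)))%:E)%E].
Proof.
have mz k : measurable_fun setT (z k) by case: Hz.
pose N k b : set Omega := [set om | (n0%:R * (1 + v) < \sum_(t < n0) z (k, (b * n0 + t)%N) om ^+ 2)%R].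
have mN k b : measurable (N k b).
  apply: measurable_set_lt; first exact: measurable_cst.
  by apply: measurable_sum => t; apply: measurable_funX.
have PN k b : (Pr (N k b) <= nu%:E)%E by apply: tail; exact: gaussian_window.
have mdR th (Y : Omega -> vec) : (forall t, measurable_fun setT (fun om => Y om t)) ->
    fmeas (fun om => net_decR th (Y om)) by move=> mY; exact: fmeas_successive_decode.
have mdU th j m (Y : Omega -> vec) : (forall t, measurable_fun setT (fun om => Y om t)) ->
    fmeas (fun om => net_decU th j m (Y om)).
  move=> mY; apply: (fmeas_comp (est j m)).
  pose Y' om t := Num.sg (h j) * Y om t.
  have mY' t : measurable_fun setT (fun om => Y' om t) by apply: measurable_funM.
  exact: (fmeas_successive_decode delta _ _ _ _ C th.2 (sqD j) mY').
have own1 th i (m m' : bmsg) : (forall p : pair3, (val p).1 = i -> m p = m' p) -> net_xu th i m = net_xu th i m'.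
  move=> mm; have E : user_signal th.1 i m = user_signal th.1 i m'.
    apply/funext => t; apply: eq_bigr => p _.
    apply: eq_bool_mul => /eqP txp.
    have -> : mu m p.1 p.2 = mu m' p.1 p.2 by apply: mu_own => p' p'i; apply: mm; rewrite p'i.
    reflexivity.
  by rewrite /net_xu E.
have own2 th j (m m' : bmsg) : (forall p : pair3, (val p).1 = j -> m p = m' p) -> net_decU th j m = net_decU th j m'.
  by move=> mm; apply/funext => y; rewrite /net_decU (est_own _ mm).
have pw1 th i m : \sum_t net_xu th i m t ^+ 2 <= n0%:R * P by exact: trunc_power.
have pw2 th s0 : \sum_t net_xr th s0 t ^+ 2 <= n0%:R * P by exact: trunc_power.
have rav (m : bmsg) b : (forall p, m p \in Vs p) ->
    avg (fun th => fine (Pr (relay_err h z (net_xu th) (net_decR th) sums m b))) <= beta + nu.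
  move=> mV.
  (* The bad event contains the codes that are not nearly orthogonal. Outside it nothing is
     truncated, and the relay receives exactly the superposition that its decoder is analysed
     for. *)
  pose bad (th : Th) om := ~~ decoded two gU sqU (mu m) (fun t => z (None, (b * n0 + t)%N) om) th.1.
  apply: (@avg_prob_le _ _ _ _ _ _ (N None b) bad _ _ Th_gt0 beta_ge0 _ (mN None b) (PN None b)).
  + move=> th; apply: (@mdR th (fun om i => _) _ (fun s => s <> sums m)) => t.
    exact: measurable_funD.
  + move=> th om _ err; apply/negP => /andP[no /forallP ok]; apply: err.
    apply/ffunP => s; rewrite ffunE; have /implyP/(_ (sqU_all s))/eqP <- := ok s.
    rewrite /net_decR; congr (decode _ _ _ _ _ _); apply/funext => t; exact: relay_receives.
  + move=> om omN; rewrite (avg_fst_code (fun th => (~~ decoded two gU sqU (mu m) _ th)%:R)).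
    by apply: uplink => //; rewrite dot_sqr leNgt; apply/negP.
have uav (m : bmsg) b j : (forall p, m p \in Vs p) ->
    avg (fun th => fine (Pr (user_err h z (net_xr th) (net_decU th) sums m b j))) <= beta + nu.
  move=> mV.
  pose zt om : vec := fun t => Num.sg (h j) * z (Some j, (b.+1 * n0 + t)%N) om.
  pose bad (th : Th) om := ~~ decoded one (gD j) (sqD j) (single (sums m)) (zt om) th.2.
  apply: (@avg_prob_le _ _ _ _ _ _ (N (Some j) b.+1) bad _ _ Th_gt0 beta_ge0 _ (mN _ _) (PN _ _)).
  + move=> th; apply: (@mdU th j m (fun om => user_obs h z (net_xr th) j (sums m) b om) _
      (fun e => exists p : pair3, (val p).2 = j /\ e p <> m p)) => t.
    exact: measurable_funD.
  + move=> th om _ [p [pj err]]; apply/negP => /andP[no /forallP ok]; apply: err.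
    apply: est_correct => // s sj; have /implyP/(_ sj)/eqP := ok s.
    rewrite single_sums => <-; rewrite /zt -user_receives//.
  + move=> om omN; rewrite (avg_snd_code (fun th => (~~ decoded one (gD j) (sqD j) _ _ th)%:R)).
    apply: downlink => //; apply: le_trans (dot_sgM _ _) _; rewrite dot_sqr leNgt; apply/negP.
    exact: omN.
exact: (exists_block_code mz P_ge0 Th_gt0 n0_gt0 n_ge x0_in own1 own2 pw1 pw2 mdR mdU rav uav).
Qed.

End Network.

(** * Layers and messages of the Y-channel *)

Definition U1 : 'I_3 := @Ordinal 3 0 isT.
Definition U2 : 'I_3 := @Ordinal 3 1 isT.
Definition U3 : 'I_3 := @Ordinal 3 2 isT.
Definition p12 : pair3 := exist _ (U1, U2) isT.
Definition p13 : pair3 := exist _ (U1, U3) isT.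
Definition p21 : pair3 := exist _ (U2, U1) isT.
Definition p23 : pair3 := exist _ (U2, U3) isT.
Definition p31 : pair3 := exist _ (U3, U1) isT.
Definition p32 : pair3 := exist _ (U3, U2) isT.

Lemma pair3_ind (Q : pair3 -> Prop) :
  Q p12 -> Q p13 -> Q p21 -> Q p23 -> Q p31 -> Q p32 -> forall p, Q p.
Proof.
move=> q12 q13 q21 q23 q31 q32 [[[i i3] [j j3]] ne].
case: i i3 ne => [|[|[|//]]] i3; case: j j3 => [|[|[|//]]] j3 ne.
- by exfalso; move: ne; rewrite eqE.
- by rewrite (_ : exist _ _ _ = p12)//; apply/val_inj; congr pair; apply/val_inj.
- by rewrite (_ : exist _ _ _ = p13)//; apply/val_inj; congr pair; apply/val_inj.
- by rewrite (_ : exist _ _ _ = p21)//; apply/val_inj; congr pair; apply/val_inj.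
- by exfalso; move: ne; rewrite eqE.
- by rewrite (_ : exist _ _ _ = p23)//; apply/val_inj; congr pair; apply/val_inj.
- by rewrite (_ : exist _ _ _ = p31)//; apply/val_inj; congr pair; apply/val_inj.
- by rewrite (_ : exist _ _ _ = p32)//; apply/val_inj; congr pair; apply/val_inj.
- by exfalso; move: ne; rewrite eqE.
Qed.

Definition layer := 'I_13.
Local Notation "''L_' n" := (@Ordinal 13 n isT) (at level 8, n at level 2).

Lemma layer_ind (Q : layer -> Prop) :
  Q 'L_0 -> Q 'L_1 -> Q 'L_2 -> Q 'L_3 -> Q 'L_4 -> Q 'L_5 -> Q 'L_6 -> Q 'L_7 -> Q 'L_8 ->
  Q 'L_9 -> Q 'L_10 -> Q 'L_11 -> Q 'L_12 -> forall s, Q s.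
Proof.
move=> q0 q1 q2 q3 q4 q5 q6 q7 q8 q9 q10 q11 q12 [s s13].
have Qeq (a b : layer) : val a = val b -> Q b -> Q a by move=> /val_inj ->.
case: s s13 => [|[|[|[|[|[|[|[|[|[|[|[|[|s]]]]]]]]]]]]] s13.
- exact: Qeq q0.
- exact: Qeq q1.
- exact: Qeq q2.
- exact: Qeq q3.
- exact: Qeq q4.
- exact: Qeq q5.
- exact: Qeq q6.
- exact: Qeq q7.
- exact: Qeq q8.
- exact: Qeq q9.
- exact: Qeq q10.
- exact: Qeq q11.
- exact: Qeq q12.
- by exfalso; move: s13; rewrite !ltnS ltn0.
Qed.

(* The layers are numbered in the order in which the relay decodes them; the
   two entries of a lattice layer are the aligned signals whose sum is decoded.
   The parts 0, 1, 2 of a message are those with superscript b, c, u. *)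
Definition src (s : layer) (i : bool) : pair3 * nat :=
  match val s with
  | 0 => (p12, 2) | 1 => (p13, 2) | 2 => (p21, 2) | 3 => (p23, 2)
  | 4 => if i then (p21, 1) else (p13, 1)
  | 5 => if i then (p23, 1) else (p12, 1)
  | 6 => if i then (p21, 0) else (p12, 0)
  | 7 => (p31, 2) | 8 => (p32, 2)
  | 9 => if i then (p32, 1) else (p13, 1)
  | 10 => if i then (p23, 1) else (p31, 1)
  | 11 => if i then (p31, 0) else (p13, 0)
  | _ => if i then (p32, 0) else (p23, 0)
  end.

Definition two (s : layer) : bool := val s \in [:: 4; 5; 6; 9; 10; 11; 12].
Definition tx (s : layer) (i : bool) : 'I_3 := (val (src s i).1).1.

Definition part (T : Type) (x : T * T * T) (k : nat) : T :=
  match k with 0 => x.1.1 | 1 => x.1.2 | _ => x.2 end.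

Definition layers : seq layer :=
  [:: 'L_0; 'L_1; 'L_2; 'L_3; 'L_4; 'L_5; 'L_6; 'L_7; 'L_8; 'L_9; 'L_10; 'L_11; 'L_12].
(** The orders of [U2] and [U3] are prefixes of the order of [U1]: a stronger user decodes all that
    a weaker one decodes, and then more. *)
Definition downlink_order (j : 'I_3) : seq layer :=
  match val j with
  | 0 => [:: 'L_1; 'L_3; 'L_9; 'L_10; 'L_11; 'L_12; 'L_0; 'L_8; 'L_5; 'L_4; 'L_6; 'L_2; 'L_7]
  | 1 => [:: 'L_1; 'L_3; 'L_9; 'L_10; 'L_11; 'L_12; 'L_0; 'L_8; 'L_5; 'L_4; 'L_6]
  | _ => [:: 'L_1; 'L_3; 'L_9; 'L_10; 'L_11; 'L_12]
  end.

Section Messages.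
Variable T : zmodType.
Local Notation bmsg := {ffun pair3 -> T * T * T}.

Definition mu (m : bmsg) (s : layer) (i : bool) : T :=
  if ~~ i || two s then part (m (src s i).1) (src s i).2 else 0.

Lemma mu_own s i (m m' : bmsg) : (forall p : pair3, (val p).1 = tx s i -> m p = m' p) ->
  mu m s i = mu m' s i.
Proof. by move=> mm; rewrite /mu; case: ifP => // _; rewrite mm. Qed.

Definition est_at (m : bmsg) (x : layer -> T) (p : pair3) : T * T * T :=
  let b p' := (m p').1.1 in let c p' := (m p').1.2 in
  match val (val p).1, val (val p).2 with
  | 0, 1 => (x 'L_6 - b p21, x 'L_5 - c p23, x 'L_0)
  | 0, _ => (x 'L_11 - b p31, x 'L_9 - c p32, x 'L_1)
  | 1, 0 => (x 'L_6 - b p12, x 'L_4 - c p13, x 'L_2)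
  | 1, _ => (x 'L_12 - b p32, x 'L_10 - c p31, x 'L_3)
  | _, 0 => (x 'L_11 - b p13, x 'L_10 - (x 'L_5 - c p12), x 'L_7)
  | _, _ => (x 'L_12 - b p23, x 'L_9 - (x 'L_4 - c p21), x 'L_8)
  end.

Definition est (j : 'I_3) (m : bmsg) (x : {ffun layer -> T}) : bmsg :=
  [ffun p : pair3 => if (val p).2 == j then est_at m x p else (0, 0, 0)].

Lemma est_own j (m m' : bmsg) x : (forall p : pair3, (val p).1 = j -> m p = m' p) ->
  est j m x = est j m' x.
Proof.
move=> mm; apply/ffunP => p; rewrite !ffunE; case: eqP => // pj.
by move: p pj; apply: pair3_ind => /= pj; rewrite /est_at /= !mm.
Qed.

Definition sumsm (m : bmsg) (s : layer) : T := mu m s false + mu m s true *+ two s.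

Lemma est_correct j (m : bmsg) (x : {ffun layer -> T}) :
  (forall s, s \in downlink_order j -> x s = sumsm m s) ->
  forall p : pair3, (val p).2 = j -> est j m x p = m p.
Proof.
move=> xE p pj; rewrite ffunE pj eqxx.
have xL s : s \in downlink_order (val p).2 -> x s = sumsm m s by rewrite pj; exact: xE.
move: {xE pj} p xL; apply: pair3_ind => xL; rewrite /est_at /= !xL ?inE// /sumsm /mu /= !mulr1n ?mulr0n ?addr0;
  rewrite ?addrK ?[_ + _ - (m _).1.1]addrAC ?[_ + _ - (m _).1.2]addrAC ?subrr ?add0r ?addrK;
  try by case: (m _) => [[]].
Qed.

End Messages.

Section Subspaces.
Variables (q K : nat).
Local Notation T := 'rV['F_q]_K.

(* All sub-messages live in one space; a sub-message of smaller rate uses only its first [k] coordinates. *)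
Definition head_space (k : nat) : {set T} := [set m : T | [forall j : 'I_K, (k <= j)%N ==> (m 0 j == 0)]]%SET.

Lemma head_space0 k : 0 \in head_space k.
Proof. by rewrite inE; apply/forallP => j; rewrite mxE eqxx implybT. Qed.

Lemma head_spaceD k m m' : m \in head_space k -> m' \in head_space k -> m + m' \in head_space k.
Proof.
rewrite !inE => /forallP h /forallP h'; apply/forallP => j; apply/implyP => kj.
by rewrite mxE (eqP (implyP (h j) kj)) (eqP (implyP (h' j) kj)) addr0.
Qed.

Lemma head_space_eq0 m : m \in head_space 0 -> m = 0.
Proof. by rewrite inE => /forallP h; apply/rowP => j; rewrite (eqP (h j)) mxE. Qed.

Lemma card_head_space k : prime q -> (k <= K)%N -> #|head_space k| = (q ^ k)%N.
Proof.
move=> qp kK; pose f (u : 'rV['F_q]_k) : T := \row_j (if insub (val j) is Some i then u 0 (i : 'I_k) else 0).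
have finj : injective f.
  move=> u u' uu; apply/rowP => i; have := congr1 (fun m : T => m 0 (widen_ord kK i)) uu.
  by rewrite !mxE /= insubT//= => lt; rewrite (_ : Sub _ _ = i)//; exact: val_inj.
rewrite -(card_rV_F k qp) -cardsT -(card_imset _ finj); congr (#|pred_of_set _|).
apply/setP => m; rewrite inE; apply/forallP/imsetP.
  move=> h; exists (\row_i m 0 (widen_ord kK i)); first by rewrite inE.
  apply/rowP => j; rewrite mxE; case: insubP => [i _ ij|].
    by rewrite mxE; congr (m 0 _); apply/val_inj.
  by rewrite -leqNgt => kj; apply/eqP/(implyP (h j)).
move=> [u _ ->] j; apply/implyP => kj; rewrite mxE insubF//.
by apply/negbTE; rewrite -leqNgt.
Qed.

End Subspaces.

Section Dimension.
Context {R : realType}.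

(* A layer of rate 0 carries no message, so that its transmitters may stay silent. *)
Definition dimension (q n : nat) (rho : R) : nat :=
  if rho == 0 then 0%N else (Num.truncn (n%:R * rho / ln q%:R)).+1.

Lemma dimension_bounds q n rho : (1 < q)%N -> 0 <= rho ->
  expR (n%:R * rho) <= (q ^ dimension q n rho)%:R /\ (q ^ dimension q n rho)%:R <= q%:R * expR (n%:R * rho).
Proof.
move=> q1 r0; rewrite /dimension; have [->|rn0] := eqVneq rho 0.
  by rewrite mulr0 expR0 expn0 mulr1; split; rewrite ?ler1n// ltnW.
have qR : 1 < q%:R :> R by rewrite ltr1n.
have lq : 0 < ln q%:R :> R by rewrite ln_gt0.
set x := _ / ln _; have x0 : 0 <= x by rewrite divr_ge0 ?mulr_ge0// ltW.
have xE : n%:R * rho = x * ln q%:R by rewrite /x divfK// gt_eqF.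
have qE k : (q ^ k)%:R = expR (k%:R * ln q%:R) :> R.
  by rewrite expRM_natl lnK ?natrX// posrE (lt_trans _ qR).
have /andP[tl th] := truncn_itv x0.
have qe : q%:R = expR (ln q%:R) :> R by rewrite lnK// posrE (lt_trans _ qR).
have -> : q%:R * expR (n%:R * rho) = expR (ln q%:R + n%:R * rho) by rewrite expRD -qe.
rewrite qE xE !ler_expR; split; first by rewrite ler_pM2r// ltW.
by rewrite -natr1 mulrDl mul1r addrC lerD2l ler_pM2r.
Qed.

End Dimension.

(** * Asymptotics *)

Section SmallParameters.
Context {R : realType}.

Definition for_small (Q : R -> Prop) : Prop :=
  exists2 v0, 0 < v0 & forall v, 0 < v -> v <= v0 -> Q v.

Lemma for_smallI Q Q' : for_small Q -> for_small Q' -> for_small (fun v => Q v /\ Q' v).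
Proof.
move=> [a a0 ha] [b b0 hb]; exists (Num.min a b); first by rewrite lt_min a0.
by move=> v v0; rewrite le_min => /andP[va vb]; split; [exact: ha|exact: hb].
Qed.

Lemma for_small_forall (J : finType) (Q : J -> R -> Prop) :
  (forall j, for_small (Q j)) -> for_small (fun v => forall j, Q j v).
Proof.
move=> h; have /choice[w hw] j : exists w, 0 < w /\ forall v, 0 < v -> v <= w -> Q j v.
  by have [w w0 hw] := h j; exists w.
have [v0 v00 hv] := @finite_lower_bound R J xpredT w (fun j _ => (hw j).1).
by exists v0 => // v vp vv j; apply: (hw j).2 => //; apply: le_trans vv (hv j _).
Qed.

(** The alternative of vanishing coefficients covers [P = 0], where no strict inequality is
    possible. *)
Lemma power_slack (J : finType) (c : J -> R) (P : R) : 0 <= P ->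
  \sum_p c p ^+ 2 < P \/ (forall p, c p = 0) ->
  for_small (fun v => \sum_p c p ^+ 2 + v * (\sum_p c p ^+ 2 + (\sum_p `|c p|) ^+ 2) <= P).
Proof.
move=> P0 [cP|c0]; last first.
  have z1 : \sum_p c p ^+ 2 = 0 by rewrite big1// => p _; rewrite c0 expr0n.
  have z2 : \sum_p `|c p| = 0 by rewrite big1// => p _; rewrite c0 normr0.
  by exists 1 => // v _ _; rewrite z1 z2 expr0n /= !addr0 mulr0 addr0.
set S := \sum_p _ in cP *; set A := _ ^+ 2.
have S0 : 0 <= S by rewrite sumr_ge0// => p _; exact: sqr_ge0.
have A0 : 0 <= A by exact: sqr_ge0.
have d0 : 0 < S + A + 1 by rewrite ltr_wpDl// addr_ge0.
exists ((P - S) / (S + A + 1)); first by rewrite divr_gt0// subr_gt0.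
move=> v v0; rewrite ler_pdivlMr// => h.
by rewrite -lerBrDl; apply: le_trans h; rewrite ler_pM2l// lerDl.
Qed.

End SmallParameters.

Section BlockLength.
Context {R : realType}.

(** Two losses, each at most half of [xi]: the additional block costs one part in [B.+1], and the
    remainder of [n] modulo [B.+1] is at most [B]. *)
Lemma block_fraction (xi : R) (B n : nat) : 0 < xi -> 2 / xi <= B.+1%:R -> 2 * B%:R / xi <= n%:R ->
  (1 - xi) * n%:R <= B%:R * (n %/ B.+1)%N%:R.
Proof.
move=> xi0; rewrite !ler_pdivrMr// => hB hn.
have := leq_trunc_div n B.+1; rewrite -(ler_nat R) natrM => h2.
set y : R := (n %/ B.+1)%N%:R in h2 *; set b : R := B%:R in hn *.
have y0 : 0 <= y by rewrite ler0n.
rewrite -[B.+1%:R]natr1 -/b in hB h2.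
have h3 : n%:R <= y * (b + 1) + b.
  have h := ltn_ceil n (ltn0Sn B).
  have : (n <= (n %/ B.+1) * B.+1 + B)%N by rewrite mulSn addSn ltnS addnC in h.
  by rewrite -(ler_nat R) natrD natrM -[B.+1%:R]natr1.
have h4 : 2 * y <= xi * n%:R.
  apply: (@le_trans _ _ (xi * (b + 1) * y)); first by rewrite ler_wpM2r// mulrC.
  by rewrite -mulrA ler_pM2l// mulrC.
nra.
Qed.

End BlockLength.

Section LayeredScheme.
Context {R : realType} {d : measure_display} {Omega : measurableType d}.
Variables (Pr : probability Omega R) (h : 'I_3 -> R) (z : node * nat -> Omega -> R) (P : R).
Hypothesis Hz : iid_std_gaussian Pr z.
Hypothesis P_ge0 : 0 <= P.
Variables (amp : layer -> bool -> R) (ramp gU : layer -> R) (rho : pair3 -> nat -> R).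
Local Notation one := (fun _ : layer => false).
Definition rhoL (s : layer) : R := rho (src s false).1 (src s false).2.

Hypothesis rho_ge0 : forall p k, 0 <= rho p k.
Hypothesis rho_src : forall s, two s -> rho (src s true).1 (src s true).2 = rhoL s.
Hypothesis gU_ge0 : forall s, 0 <= gU s.
Hypothesis ramp_ge0 : forall s, 0 <= ramp s.
Hypothesis amp_gain : forall s i, h (tx s i) * amp s i = gU s * (~~ i || two s)%:R.
Hypothesis amp_power : forall k, let c (p : layer * bool) := (tx p.1 p.2 == k)%:R * amp p.1 p.2 in
  \sum_p c p ^+ 2 < P \/ forall p, c p = 0.
Hypothesis ramp_power : \sum_s ramp s ^+ 2 < P \/ forall s, ramp s = 0.
Hypothesis gU0 : forall s, gU s = 0 -> rhoL s = 0.
Hypothesis gD0 : forall j s, s \in downlink_order j -> gD h ramp j s = 0 -> rhoL s = 0.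
Hypothesis rateU : forall s, 0 < gU s ->
  rhoL s < 2^-1 * ln ((copies two s)^-1 + gU s ^+ 2 / noise_level two gU layers s).
Hypothesis rateD : forall j s, s \in downlink_order j -> 0 < gD h ramp j s ->
  rhoL s < 2^-1 * ln ((copies one s)^-1 + gD h ramp j s ^+ 2 / noise_level one (gD h ramp j) (downlink_order j) s).

Section MessageSets.
Variables (q n0 K : nat).
Local Notation T := 'rV['F_q]_K.
Local Notation dimp p k := (dimension q n0 (rho p k)).

Definition message_box (p : pair3) : {set T * T * T} :=
  finset.setX (finset.setX (head_space q K (dimp p 0)) (head_space q K (dimp p 1))) (head_space q K (dimp p 2)).

Definition layer_space (s : layer) : {set T} := head_space q K (dimension q n0 (rhoL s)).

Lemma message_box0 p : (0, 0, 0) \in message_box p.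
Proof. by rewrite /message_box !finset.in_setX !head_space0. Qed.

Lemma src_kind s i : ((src s i).2 < 3)%N.
Proof. by move: s; apply: layer_ind; case: i. Qed.

Lemma part_message_box (m : {ffun pair3 -> T * T * T}) p k : (k < 3)%N -> m p \in message_box p ->
  part (m p) k \in head_space q K (dimp p k).
Proof. rewrite /message_box; case: (m p) => [[b c] u]; rewrite !finset.in_setX; by case: k => [|[|[|]]]// _ /andP[/andP[]]. Qed.

Lemma msg_sum_layer_space (m : {ffun pair3 -> T * T * T}) s : (forall p, m p \in message_box p) ->
  msg_sum two (mu m) s \in layer_space s.
Proof.
move=> mV; have m0 : mu m s false \in layer_space s.
  by rewrite /mu /=; apply: part_message_box; [exact: src_kind|exact: mV].
rewrite /msg_sum; case ts : (two s); last by rewrite mulr0n addr0.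
apply: head_spaceD => //; rewrite mulr1n /mu /= ts /layer_space -rho_src//.
by apply: part_message_box; [exact: src_kind|exact: mV].
Qed.

Lemma msg_sum_rate0 (m : {ffun pair3 -> T * T * T}) s : (forall p, m p \in message_box p) ->
  rhoL s = 0 -> msg_sum two (mu m) s = 0.
Proof.
move=> mV r0; apply: head_space_eq0.
by have := msg_sum_layer_space s mV; rewrite /layer_space r0 /dimension eqxx.
Qed.

Lemma layer_space_card s : prime q -> #|layer_space s|%:R <= q%:R * expR (n0%:R * rhoL s).
Proof.
move=> qp; have q1 := prime_gt1 qp.
have [_ h2] := dimension_bounds n0 q1 (rho_ge0 (src s false).1 (src s false).2).
apply: le_trans h2; rewrite ler_nat.
have [le|/ltnW gt] := leqP (dimension q n0 (rhoL s)) K; first by rewrite /layer_space card_head_space.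
apply: (@leq_trans (q ^ K)); last by rewrite leq_exp2l.
by rewrite -(card_rV_F K qp) max_card.
Qed.

Lemma card_message_box p : prime q -> (forall k, (k < 3)%N -> (dimp p k <= K)%N) ->
  expR (n0%:R * (rho p 0 + rho p 1 + rho p 2)) <= #|message_box p|%:R.
Proof.
move=> qp dK; have q1 := prime_gt1 qp.
rewrite /message_box !cardsX !card_head_space ?dK// !natrM !mulrDr !expRD.
have b k := (dimension_bounds n0 q1 (rho_ge0 p k)).1.
by rewrite !ler_pM ?mulr_ge0 ?expR_ge0.
Qed.

End MessageSets.

Variables (xi : R) (r : 'I_3 -> 'I_3 -> R).
Hypothesis xi_gt0 : 0 < xi.
Hypothesis r_le : forall p : pair3,
  r (val p).1 (val p).2 * ln 2 <= (1 - xi) * (rho p 0 + rho p 1 + rho p 2).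

Definition reliable_at (tw : layer -> bool) (g : layer -> R) (sq : seq layer) (v D : R) : Prop :=
  forall n q K kl, good_params (R := R) n q kl v ->
  forall (C : layer -> {set 'rV['F_q]_K}) (m : layer -> bool -> 'rV['F_q]_K),
  (forall s, s \in sq -> #|C s|%:R <= q%:R * expR (n%:R * rhoL s)) ->
  (forall s, s \in sq -> msg_sum tw m s \in C s) ->
  (forall s, s \in sq -> g s = 0 -> msg_sum tw m s = 0) ->
  reliable n kl v (D / n%:R) C tw g sq m.

Lemma reliable_for_small tw g sq : (forall s, 0 <= g s) -> uniq sq ->
  (forall s, s \in sq -> 0 < g s -> rhoL s < 2^-1 * ln ((copies tw s)^-1 + g s ^+ 2 / noise_level tw g sq s)) ->
  for_small (fun v => exists D, reliable_at tw g sq v D).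
Proof.
move=> g0 usq rt; have [v0 v00 hv] := superposition_reliable g0 usq rt.
exists (Num.min v0 1); first by rewrite lt_min v00 ltr01.
move=> v vp; rewrite le_min => /andP[vv v1]; have [D hD] := hv v vp vv v1.
exists D => n q K kl gp C m cC mC m0 zt ztn.
exact: (hD n q K kl gp C m zt cC mC m0 ztn).
Qed.

Lemma reliable_at_le tw g sq v D D' : D <= D' -> reliable_at tw g sq v D -> reliable_at tw g sq v D'.
Proof.
move=> DD h1 n q K kl gp C m cC mC m0 zt ztn; apply: le_trans (h1 n q K kl gp C m cC mC m0 zt ztn) _.
by rewrite ler_wpM2r// invr_ge0.
Qed.

Lemma layers_uniq : uniq layers.
Proof. by []. Qed.

Lemma downlink_order_uniq j : uniq (downlink_order j).
Proof. by case: j => [[|[|[|]]]]. Qed.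

Lemma small_parameters : exists v, [/\ 0 < v, v <= 1,
  (forall k, let c (p : layer * bool) := (tx p.1 p.2 == k)%:R * amp p.1 p.2 in
     \sum_p c p ^+ 2 + v * (\sum_p c p ^+ 2 + (\sum_p `|c p|) ^+ 2) <= P),
  \sum_s ramp s ^+ 2 + v * (\sum_s ramp s ^+ 2 + (\sum_s `|ramp s|) ^+ 2) <= P &
  exists2 D, 0 <= D & reliable_at two gU layers v D /\
    forall j, reliable_at one (gD h ramp j) (downlink_order j) v D].
Proof.
have s1 : for_small (fun v => forall k : 'I_3, let c (p : layer * bool) := (tx p.1 p.2 == k)%:R * amp p.1 p.2 in
     \sum_p c p ^+ 2 + v * (\sum_p c p ^+ 2 + (\sum_p `|c p|) ^+ 2) <= P).
  by apply: for_small_forall => k; apply: power_slack; [exact: P_ge0|exact: amp_power].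
have s2 := power_slack P_ge0 ramp_power.
have s3 := reliable_for_small gU_ge0 layers_uniq (fun s _ => rateU (s := s)).
have s4 : for_small (fun v => forall j, exists D, reliable_at one (gD h ramp j) (downlink_order j) v D).
  apply: for_small_forall => j; apply: reliable_for_small; last exact: rateD.
    by move=> s; rewrite mulr_ge0.
  exact: downlink_order_uniq.
have [v0 v00 hv] := for_smallI (for_smallI s1 s2) (for_smallI s3 s4).
pose v := Num.min v0 1; have vp : 0 < v by rewrite lt_min v00 ltr01.
have [] := hv v vp; first by rewrite ge_min lexx.
move=> [h1 h2] [[D1 hD1] /choice[D2 hD2]].
exists v; split=> //; first by rewrite ge_min lexx orbT.
exists (`|D1| + \sum_j `|D2 j|); first by rewrite addr_ge0// sumr_ge0.
split; first by apply: reliable_at_le hD1; rewrite (le_trans (ler_norm _))// lerDl sumr_ge0.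
move=> j; apply: reliable_at_le (hD2 j); rewrite (le_trans (ler_norm _))// (bigD1 j)//= addrCA lerDl.
by rewrite addr_ge0// sumr_ge0.
Qed.

Theorem layered_achievable : achievable Pr z h P r.
Proof.
have [v [v0 v1 ampP rampP [D D0 [relU relD]]]] := small_parameters.
have [c c0 tail] := gaussian_norm_upper Pr v0 v1.
have [N1 hN1] := good_params_exist Pr v0 v1.
move=> eps eps0.
pose B := (Num.truncn (2 / xi)).+1.
have truncS (x : R) : 0 <= x -> x <= (Num.truncn x).+1%:R.
  by move=> x0; have /andP[_ /ltW] := truncn_itv x0.
have B2 : 2 / xi <= B%:R by apply: truncS; rewrite divr_ge0// ltW.
(* Uplink, downlink and noise failures are all of order [1 / n0], and the number of blocks is fixed;
   the total error is at most [A / n0]. *)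
pose A := B%:R * (4 * (D + c^-1)).
have A0 : 0 <= A by rewrite mulr_ge0// mulr_ge0// addr_ge0// invr_ge0 ltW.
pose N0 := maxn N1 (Num.truncn (A / eps)).+1.
exists (maxn (N0 * B.+1) (Num.truncn (2 * B%:R / xi)).+1) => n; rewrite gtn_max => /andP[nN0 nB].
pose n0 := (n %/ B.+1)%N.
have n0N : (N0 <= n0)%N by rewrite leq_divRL// ltnW.
have n0_gt0 : (0 < n0)%N by apply: leq_trans n0N; rewrite leq_max orbT.
have n0R : 0 < n0%:R :> R by rewrite ltr0n.
have n_ge : (B.+1 * n0 <= n)%N by rewrite mulnC leq_trunc_div.
have [q [kl gp]] := hN1 n0 (leq_trans (leq_maxl _ _) n0N) _ (gaussian_window None 0 n0 Hz).
have qp := gp_prime gp.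
pose K := (\max_(p : pair3) \max_(k < 3) dimension q n0 (rho p k))%N.
pose bmsg := {ffun pair3 -> 'rV['F_q]_K * 'rV['F_q]_K * 'rV['F_q]_K}.
have dK p k : (k < 3)%N -> (dimension q n0 (rho p k) <= K)%N.
  move=> k3; apply: leq_trans (leq_bigmax p).
  exact: (leq_bigmax (Ordinal k3)).
have tail_n0 (x : 'I_n0 -> Omega -> R) : gaussian_vector Pr x -> (Pr [set om | (n0%:R * (1 + v) < \sum_t x t om ^+ 2)%R]
    <= ((c * n0%:R)^-1)%:E)%E.
  move=> gx; apply: (le_trans (tail n0 x gx)); rewrite lee_fin mulNr expRN lef_pV2 ?posrE ?expR_gt0 ?mulr_gt0//.
  by apply: le_trans (expR_ge1Dx _); rewrite lerDr.
have beta0 : 0 <= D / n0%:R by rewrite divr_ge0// ltW.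
have up (m : bmsg) : (forall p, m p \in message_box q n0 K p) ->
    reliable n0 kl v (D / n0%:R) (layer_space q n0 K) two gU layers (mu m).
  move=> mV; apply: relU => // s _.
  - exact: layer_space_card.
  - exact: msg_sum_layer_space.
  - by move=> /gU0; exact: msg_sum_rate0.
have down (m : bmsg) j :
    (forall p, m p \in message_box q n0 K p) ->
    reliable n0 kl v (D / n0%:R) (layer_space q n0 K) one (gD h ramp j) (downlink_order j)
      (single (sums two (@mu _) m)).
  move=> mV; have sE s : msg_sum one (single (sums two (@mu _) m)) s = msg_sum two (mu m) s.
    by rewrite single_sums ffunE.
  apply: relD => // s sj.
  - exact: layer_space_card.
  - by rewrite sE; exact: msg_sum_layer_space.
  - by move=> /(gD0 sj); rewrite sE; exact: msg_sum_rate0.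
have estc j (m : bmsg) (s0 : {ffun layer -> 'rV['F_q]_K}) :
    (forall s, s \in downlink_order j -> s0 s = sums two (@mu _) m s) ->
    forall p : pair3, (val p).2 = j -> est j m s0 p = m p.
  by move=> hs; apply: est_correct => s sj; rewrite hs// ffunE.
have all_up s : s \in layers by move: s; apply: layer_ind.
have [code [wf [sz mx me pw er]]] := network_code Hz P_ge0 gp (ltW v0) beta0 n_ge tail_n0
  (message_box0 q n0 K) (fun s i => @mu_own _ s i) (fun j => @est_own _ j) estc amp_gain ampP rampP all_up up down.
exists code; split => //; split => //.
- move=> p; rewrite sz natrX /powR ifF; last by apply/negbTE; rewrite pnatr_eq0.
  apply: (@le_trans _ _ (expR (n0%:R * (rho p 0 + rho p 1 + rho p 2)) ^+ B)); last first.
    apply: lerXn2r; [by rewrite nnegrE expR_ge0|by rewrite nnegrE|].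
    by apply: card_message_box => // k; exact: dK.
  rewrite -expRM_natl ler_expR -mulrA.
  set S := rho p 0 + _ + _.
  have S0 : 0 <= S by rewrite !addr_ge0.
  apply: (@le_trans _ _ (n%:R * ((1 - xi) * S))); first by rewrite ler_wpM2l// r_le.
  rewrite !mulrA ler_wpM2r// mulrC block_fraction//.
    by apply: le_trans B2 _; rewrite ler_nat.
  apply: le_trans (truncS _ _) _; first by rewrite divr_ge0 ?mulr_ge0// ltW.
  by rewrite ler_nat ltnW.

- apply: (le_trans er); rewrite lee_fin.
  rewrite (_ : _ * _ = A / n0%:R); last by rewrite /A invfM; ring.
  rewrite ler_pdivrMr// mulrC -ler_pdivrMr//; apply: le_trans (truncS _ _) _; first by rewrite divr_ge0// ltW.
  by rewrite ler_nat (leq_trans _ n0N)// leq_maxr.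
Qed.

End LayeredScheme.

(** * Rates and powers *)

Section ScaledRates.
Context {R : realType}.
Implicit Types (r c G I N lam xi : R).

Let ln2_gt0 : 0 < ln 2 :> R. Proof. by rewrite ln_gt0// ltr1n. Qed.

Lemma gain_gt0 r c G I : 0 < r -> 1 <= c -> 0 <= I ->
  r <= Num.max 0 (2^-1 * log2 (c^-1 + G / (1 + I))) -> 0 < G.
Proof.
move=> r0 c1 I0; rewrite le_max leNgt r0 /= => h; rewrite ltNge; apply/negP => G0.
suff : 2^-1 * log2 (c^-1 + G / (1 + I)) <= 0 by move=> /(le_trans h); rewrite leNgt r0.
rewrite pmulr_rle0 ?invr_gt0// /log2 pmulr_lle0 ?invr_gt0//; apply: ln_le0.
have : G / (1 + I) <= 0 by rewrite pmulr_lle0// invr_gt0; lra.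
have : c^-1 <= 1 by rewrite invf_le1//; lra.
by lra.
Qed.

(** Scaling the powers by [lam] scales the interference but not the noise, so the argument of the
    logarithm shrinks at most by the factor [lam]. The loss is half of [- ln lam], strictly less
    than the share [xi] of the rate. *)
Lemma rate_scaled r c G I N lam xi : 0 < r -> 1 <= c -> 0 <= I -> 0 < xi ->
  0 < lam -> lam <= 1 -> - ln lam <= xi * (r * ln 2) ->
  1 <= N -> N <= 1 + lam * I ->
  r <= Num.max 0 (2^-1 * log2 (c^-1 + G / (1 + I))) ->
  (1 - xi) * (r * ln 2) < 2^-1 * ln (c^-1 + lam * G / N).
Proof.
move=> r0 c1 I0 xi0 l0 l1 hl N1 N2 h; have G0 := gain_gt0 r0 c1 I0 h.
move: h; rewrite le_max leNgt r0 /= /log2 mulrA ler_pdivlMr// => h.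
have ci : 0 < c^-1 by rewrite invr_gt0; lra.
have N0 : 0 < N by lra.
have I1 : 0 < 1 + I by lra.
have GI : 0 < G / (1 + I) by rewrite divr_gt0.
have le : lam * (c^-1 + G / (1 + I)) <= c^-1 + lam * G / N.
  rewrite mulrDr; apply: lerD; first by rewrite ler_piMl// ltW.
  rewrite -[leRHS]mulrA ler_pM2l// ler_pM2l// lef_pV2 ?posrE//.
  by apply: (le_trans N2); rewrite lerD2l ler_piMl.
have s0 : 0 < c^-1 + G / (1 + I) by rewrite addr_gt0.
have : ln (lam * (c^-1 + G / (1 + I))) <= ln (c^-1 + lam * G / N).
  by rewrite ler_ln ?posrE// ?mulr_gt0//; apply: lt_le_trans le; rewrite mulr_gt0.
rewrite lnM ?posrE// => hln.
have rl : 0 < xi * (r * ln 2) by rewrite !mulr_gt0.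
by lra.
Qed.

Lemma Ccap_mono (x y : R) : 0 <= x -> x <= y -> Ccap x <= Ccap y.
Proof.
move=> x0 xy; rewrite /Ccap /log2 ler_pM2l ?invr_gt0// ler_pM2r ?invr_gt0// ler_ln ?posrE; lra.
Qed.

(** The ratio [a * p / (1 + a * I)] increases with the gain [a]: what the weakest receiver can
    decode, every stronger one can decode too. *)
Lemma Ccap_degraded (a b p I : R) : 0 <= a -> a <= b -> 0 <= p -> 0 <= I ->
  Ccap (a * p / (1 + a * I)) <= Ccap (b * p / (1 + b * I)).
Proof.
move=> a0 ab p0 I0; have b0 := le_trans a0 ab.
have da : 0 < 1 + a * I by rewrite ltr_pwDl// mulr_ge0.
have db : 0 < 1 + b * I by rewrite ltr_pwDl// mulr_ge0.
apply: Ccap_mono; first by rewrite divr_ge0 ?mulr_ge0// ltW.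
rewrite ler_pdivrMr// mulrAC ler_pdivlMr//.
have : a * p <= b * p by rewrite ler_wpM2r.
by nra.
Qed.

Lemma Ccap_max (r x y : R) : 0 <= x -> x <= y -> r <= Ccap x ->
  r <= Num.max 0 (2^-1 * log2 (1^-1 + y)).
Proof. by move=> x0 xy h; rewrite le_max invr1 (le_trans h (Ccap_mono x0 xy)) orbT. Qed.

Lemma Cplus_max (r x y : R) : 0 <= x -> x <= y -> r <= Cplus (x - 2^-1) ->
  r <= Num.max 0 (2^-1 * log2 (2^-1 + y)).
Proof.
move=> x0 xy; rewrite /Cplus !le_max => /orP[->//|h]; apply/orP; right.
apply: (le_trans h); rewrite (_ : 2^-1 + y = 1 + (y - 2^-1)); last by field.
rewrite /Ccap /log2 ler_pM2l ?invr_gt0// ler_pM2r ?invr_gt0// ler_ln ?posrE; lra.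
Qed.

End ScaledRates.

Section Masks.
Context {R : realType}.

Lemma sum_layers (F : layer -> R) : \sum_s F s = \sum_(s <- layers) F s.
Proof.
rewrite /index_enum -enumT; congr bigop.
apply: (inj_map val_inj); rewrite val_enum_ord; reflexivity.
Qed.

(* The order of decoding is tabulated as a bit vector so that it can be evaluated. *)
Definition later (sq : seq layer) (s : layer) : seq bool := [seq (index s sq < index s' sq)%N | s' <- layers].

Fixpoint interference (m t : seq bool) (x : seq R) : R :=
  match m, t, x with
  | b :: m', b' :: t', y :: x' => (if b then if b' then 2 * y else y else 0) + interference m' t' x'
  | _, _, _ => 0
  end.

Lemma interference_sum (sq : seq layer) s (tw : layer -> bool) (G : layer -> R) (l : seq layer) :
  interference [seq (index s sq < index s' sq)%N | s' <- l] [seq tw s' | s' <- l] [seq G s' | s' <- l]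
  = \sum_(s' <- l | (index s sq < index s' sq)%N) G s' * copies (R := R) tw s'.
Proof.
elim: l => [|x l IH]; first by rewrite big_nil.
rewrite big_cons /= IH /copies; case: ifP => _; last by rewrite add0r.
by congr (_ + _); case: (tw x); rewrite /= ?addr0 ?mulr1// mulrC.
Qed.

Lemma noise_level_le tw (g G : layer -> R) lam sq s : (forall s', g s' ^+ 2 <= lam * G s') ->
  noise_level tw g sq s <= 1 + lam * interference (later sq s) [seq tw s' | s' <- layers] [seq G s' | s' <- layers].
Proof.
move=> gG; rewrite interference_sum /noise_level lerD2l mulr_sumr.
rewrite (big_mkcond (fun s' => (index s sq < index s' sq)%N)) sum_layers -big_mkcond /=.
apply: ler_sum => s' _; rewrite mulrA ler_wpM2r//.
exact: le_trans ler01 (copies_ge1 tw s').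
Qed.

Lemma interference_ge0 (m t : seq bool) (x : seq R) : (forall y, y \in x -> 0 <= y) -> 0 <= interference m t x.
Proof.
elim: x m t => [|y x IH] [|b m] [|b' t]//= x0; rewrite addr_ge0//; last first.
  by apply: IH => y' y'x; apply: x0; rewrite inE y'x orbT.
have y0 : 0 <= y by apply: x0; rewrite inE eqxx.
by case: b => //; case: b' => //; rewrite mulr_ge0.
Qed.

End Masks.

Section Scheme.
Context {R : realType} {d : measure_display} {Omega : measurableType d}.
Variables (Pr : probability Omega R) (h : 'I_3 -> R) (z : node * nat -> Omega -> R) (P : R).
Hypothesis Hz : iid_std_gaussian Pr z.
Hypothesis P_ge0 : 0 <= P.
Local Notation one := (fun _ : layer => false).
Variables (pw : layer -> bool -> R) (pr : layer -> R) (rt : pair3 -> nat -> R) (r : 'I_3 -> 'I_3 -> R).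
Hypothesis rt_ge0 : forall p k, 0 <= rt p k.
Hypothesis rt_src : forall s, two s -> rt (src s true).1 (src s true).2 = rt (src s false).1 (src s false).2.
Hypothesis pw_ge0 : forall s i, 0 <= pw s i.
Hypothesis pr_ge0 : forall s, 0 <= pr s.
Hypothesis align : forall s, two s -> h (tx s true) ^+ 2 * pw s true = h (tx s false) ^+ 2 * pw s false.
Hypothesis user_power : forall k, \sum_s \sum_i (tx s i == k)%:R * (~~ i || two s)%:R * pw s i <= P.
Hypothesis relay_power : \sum_s pr s <= P.
Definition layer_rate (s : layer) : R := rt (src s false).1 (src s false).2.
Definition received (s : layer) : R := h (tx s false) ^+ 2 * pw s false.
Definition flags (tw : layer -> bool) : seq bool := [seq tw s | s <- layers].
Hypothesis uplink_rate : forall s, layer_rate s <= Num.max 0 (2^-1 * log2 ((copies two s)^-1 +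
  received s / (1 + interference (later layers s) (flags two) [seq received s' | s' <- layers]))).
Hypothesis downlink_rate : forall j s, s \in downlink_order j ->
  layer_rate s <= Num.max 0 (2^-1 * log2 ((copies one s)^-1 + h j ^+ 2 * pr s /
    (1 + interference (later (downlink_order j) s) (flags one) [seq h j ^+ 2 * pr s' | s' <- layers]))).
Hypothesis r_sum : forall p : pair3, r (val p).1 (val p).2 = rt p 0 + rt p 1 + rt p 2.

Let ln2_gt0 : 0 < ln 2 :> R. Proof. by rewrite ln_gt0// ltr1n. Qed.

Lemma power_dichotomy (J : finType) (c : J -> R) (lam : R) : lam < 1 -> \sum_p c p ^+ 2 <= lam * P ->
  \sum_p c p ^+ 2 < P \/ forall p, c p = 0.
Proof.
move=> l1 cP; move: P_ge0; rewrite le_eqVlt => /orP[/eqP P0|P0]; last first.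
  by left; apply: (le_lt_trans cP); rewrite gtr_pMl.
right=> p; apply/eqP; rewrite -sqrf_eq0; apply/eqP.
have c0 p' : p' \in index_enum J -> true -> 0 <= c p' ^+ 2 by move=> _ _; exact: sqr_ge0.
have S0 : \sum_p c p ^+ 2 = 0.
  by apply/eqP; rewrite eq_le sumr_ge0 ?andbT => [|p' _]; [rewrite (le_trans cP)// -P0 mulr0|exact: sqr_ge0].
by apply: (psumr_eq0P _ S0) => // p' _; exact: sqr_ge0.
Qed.

Section Scaling.
Variables (xi lam : R).
Hypothesis xi_gt0 : 0 < xi.
Hypothesis lam_gt0 : 0 < lam.
Hypothesis lam_lt1 : lam < 1.
Hypothesis lam_ln : forall s, 0 < layer_rate s -> - ln lam <= xi * (layer_rate s * ln 2).

(** Layers of rate 0 are switched off. Then a positive gain implies a positive rate, part of which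
    can be given up to obtain a strict inequality. *)
Definition active s : R := (layer_rate s != 0)%:R.
Definition scaled_gain s : R := active s * (`|h (tx s false)| * Num.sqrt (lam * pw s false)).
(** The sign compensates that of the channel, so that the two aligned signals of a layer arrive with
    the same nonnegative amplitude. *)
Definition scaled_amp s i : R :=
  (~~ i || two s)%:R * active s * (Num.sg (h (tx s i)) * Num.sqrt (lam * pw s i)).
Definition scaled_ramp s : R := active s * Num.sqrt (lam * pr s).
Definition scaled_rate p k : R := (1 - xi) * (rt p k * ln 2).

Lemma layer_rate_gt0 s : layer_rate s != 0 -> 0 < layer_rate s.
Proof. by move=> r0; rewrite lt_def r0 rt_ge0. Qed.

Lemma active01 s : active s = 0 \/ active s = 1.
Proof. by rewrite /active; case: (layer_rate s != 0); [right|left]. Qed.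

Lemma scaled_gain_sqr s : scaled_gain s ^+ 2 <= lam * received s.
Proof.
have lG : 0 <= lam * received s by rewrite mulr_ge0 ?(ltW lam_gt0)// mulr_ge0 ?sqr_ge0.
rewrite /scaled_gain; have [->|->] := active01 s; first by rewrite mul0r expr0n.
rewrite mul1r exprMn real_normK ?num_real// sqr_sqrtr; last by rewrite mulr_ge0// ltW.
by rewrite /received mulrCA.
Qed.

Lemma scaled_gain_sqrE s : layer_rate s != 0 -> scaled_gain s ^+ 2 = lam * received s.
Proof.
move=> rs; rewrite /scaled_gain /active rs mul1r exprMn real_normK ?num_real// sqr_sqrtr; last by rewrite mulr_ge0// ltW.
by rewrite /received mulrCA.
Qed.

Lemma scaled_user_gain_sqr j s : gD h scaled_ramp j s ^+ 2 <= lam * (h j ^+ 2 * pr s).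
Proof.
have lG : 0 <= lam * (h j ^+ 2 * pr s) by rewrite mulr_ge0 ?(ltW lam_gt0)// mulr_ge0 ?sqr_ge0.
rewrite /gD /scaled_ramp; have [->|->] := active01 s; first by rewrite mul0r mulr0 expr0n.
rewrite mul1r exprMn real_normK ?num_real// sqr_sqrtr; last by rewrite mulr_ge0// ltW.
by rewrite mulrCA.
Qed.

Lemma scaled_user_gain_sqrE j s : layer_rate s != 0 -> gD h scaled_ramp j s ^+ 2 = lam * (h j ^+ 2 * pr s).
Proof.
move=> rs; rewrite /gD /scaled_ramp /active rs mul1r exprMn real_normK ?num_real// sqr_sqrtr; last by rewrite mulr_ge0// ltW.
by rewrite mulrCA.
Qed.

Lemma interference_uplink_ge0 s : 0 <= interference (later layers s) (flags two) [seq received s' | s' <- layers].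
Proof. by apply: interference_ge0 => y /mapP[s' _ ->]; rewrite mulr_ge0 ?sqr_ge0. Qed.

Lemma interference_downlink_ge0 j s :
  0 <= interference (later (downlink_order j) s) (flags one) [seq h j ^+ 2 * pr s' | s' <- layers].
Proof. by apply: interference_ge0 => y /mapP[s' _ ->]; rewrite mulr_ge0 ?sqr_ge0. Qed.

Lemma sqr_gt0_neq0 (x y : R) : x ^+ 2 = y -> 0 < y -> x != 0.
Proof. by move=> <-; rewrite exprn_even_gt0. Qed.

Lemma scaled_amp_gain s i : h (tx s i) * scaled_amp s i = scaled_gain s * (~~ i || two s)%:R.
Proof.
rewrite /scaled_amp /scaled_gain; case: i => /=; last first.
  by rewrite mul1r mulr1 normrEsg; ring.
case ts : (two s); last by rewrite !mul0r !mulr0.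
rewrite mul1r mulr1 mulrCA; congr (_ * _).
rewrite mulrA [h _ * Num.sg _]mulrC -normrEsg -!sqrtr_sqr -!sqrtrM ?sqr_ge0//; congr Num.sqrt.
by rewrite ![_ * (lam * _)]mulrCA align.
Qed.

Lemma scaled_amp_power k : let c (p : layer * bool) := (tx p.1 p.2 == k)%:R * scaled_amp p.1 p.2 in
  \sum_p c p ^+ 2 < P \/ forall p, c p = 0.
Proof.
move=> c; apply: (power_dichotomy lam_lt1).
apply: (@le_trans _ _ (lam * \sum_s \sum_i (tx s i == k)%:R * (~~ i || two s)%:R * pw s i)); last first.
  by rewrite ler_pM2l.
rewrite mulr_sumr; under [leRHS]eq_bigr do rewrite mulr_sumr.
rewrite pair_bigA /=; apply: ler_sum => -[s i] _; rewrite /c /scaled_amp /=.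
have lp : 0 <= lam * pw s i by rewrite mulr_ge0// ltW.
case: (tx s i == k); last by rewrite !mul0r mulr0 expr0n.
case: (~~ i || two s); last by rewrite !mul0r !mulr0 mul0r mulr0 expr0n.
rewrite !mul1r; have [->|->] := active01 s; first by rewrite mul0r expr0n.
rewrite mul1r exprMn sqr_sqrtr// sqr_sg; case: (_ != 0); by rewrite ?mul1r ?mul0r.
Qed.

Lemma scaled_ramp_power : \sum_s scaled_ramp s ^+ 2 < P \/ forall s, scaled_ramp s = 0.
Proof.
apply: (power_dichotomy lam_lt1).
apply: (@le_trans _ _ (lam * \sum_s pr s)); last by rewrite ler_pM2l.
rewrite mulr_sumr; apply: ler_sum => s _; rewrite /scaled_ramp.
have lp : 0 <= lam * pr s by rewrite mulr_ge0// ltW.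
have [->|->] := active01 s; first by rewrite mul0r expr0n.
by rewrite mul1r sqr_sqrtr.
Qed.

(** One factor [1 - xi] comes from scaling the powers, the other from the additional block. *)
Lemma scaled_achievable : xi <= 1 ->
  achievable Pr z h P (fun i j => (1 - xi) * ((1 - xi) * r i j)).
Proof.
move=> xi1; have rhoE s : rhoL scaled_rate s = (1 - xi) * (layer_rate s * ln 2) by [].
have act_rate s (x : R) : layer_rate s = 0 \/ x != 0 -> x = 0 -> rhoL scaled_rate s = 0.
  by move=> [r0|/negP xn] x0; [rewrite rhoE r0 mul0r mulr0|case: xn; rewrite x0].
have uG s : layer_rate s = 0 \/ scaled_gain s != 0.
  have [->|rn] := eqVneq (layer_rate s) 0; [by left|right].
  apply: (sqr_gt0_neq0 (scaled_gain_sqrE rn)); rewrite mulr_gt0//.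
  exact: (gain_gt0 (layer_rate_gt0 rn) (copies_ge1 two s) (interference_uplink_ge0 s) (uplink_rate s)).
have dG j s : s \in downlink_order j -> layer_rate s = 0 \/ gD h scaled_ramp j s != 0.
  move=> sj; have [->|rn] := eqVneq (layer_rate s) 0; [by left|right].
  apply: (sqr_gt0_neq0 (scaled_user_gain_sqrE j rn)); rewrite mulr_gt0//.
  exact: (gain_gt0 (layer_rate_gt0 rn) (copies_ge1 one s) (interference_downlink_ge0 j s) (downlink_rate sj)).
have act0 s : layer_rate s = 0 -> active s = 0 by move=> r0; rewrite /active r0 eqxx.
apply: (@layered_achievable R d Omega Pr h z P Hz P_ge0 scaled_amp scaled_ramp scaled_gain scaled_rate
  _ _ _ _ scaled_amp_gain scaled_amp_power scaled_ramp_power _ _ _ _ xi _ xi_gt0) => //.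
- by move=> p k; rewrite !mulr_ge0 ?(ltW ln2_gt0)// subr_ge0.
- by move=> s ts; rewrite /rhoL /scaled_rate rt_src.
- by move=> s; rewrite !mulr_ge0// /active; case: (_ != _).
- by move=> s; rewrite !mulr_ge0 ?sqrtr_ge0// /active; case: (_ != _).
- by move=> s; apply: act_rate.
- by move=> j s sj; apply: act_rate; exact: dG.
- move=> s g0; have rn : layer_rate s != 0.
    by apply: contraTneq g0 => /act0; rewrite /scaled_gain => ->; rewrite mul0r ltxx.
  rewrite rhoE scaled_gain_sqrE//.
  apply: (@rate_scaled R (layer_rate s) (copies two s) (received s) _ _ lam xi (layer_rate_gt0 rn) (copies_ge1 two s)
    (interference_uplink_ge0 s) xi_gt0 lam_gt0 (ltW lam_lt1) (lam_ln (layer_rate_gt0 rn)) _ _ (uplink_rate s)).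
    exact: noise_level_ge1.
  by apply: noise_level_le => s'; exact: scaled_gain_sqr.
- move=> j s sj g0; have rn : layer_rate s != 0.
    by apply: contraTneq g0 => /act0; rewrite /gD /scaled_ramp => ->; rewrite mul0r mulr0 ltxx.
  rewrite rhoE scaled_user_gain_sqrE//.
  apply: (@rate_scaled R (layer_rate s) (copies one s) (h j ^+ 2 * pr s) _ _ lam xi (layer_rate_gt0 rn) (copies_ge1 one s)
    (interference_downlink_ge0 j s) xi_gt0 lam_gt0 (ltW lam_lt1) (lam_ln (layer_rate_gt0 rn)) _ _ (downlink_rate sj)).
    exact: noise_level_ge1.
  by apply: noise_level_le => s'; exact: scaled_user_gain_sqr.
- move=> p; rewrite r_sum /scaled_rate -!mulrDr -!mulrDl -!mulrA.
  by [].
Qed.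

End Scaling.

Theorem scheme_in_capacity : cap_region Pr z h P r.
Proof.
move=> e e0.
pose S := \sum_(p : pair3) r (val p).1 (val p).2.
have r0 (p : pair3) : 0 <= r (val p).1 (val p).2 by rewrite r_sum !addr_ge0.
have S0 : 0 <= S by apply: sumr_ge0 => p' _; exact: r0.
(* The total loss on a rate [x] is [xi * (2 - xi) * x], and every rate is bounded by the sum [S]. *)
pose xi := Num.min 1 (e / (2 * (S + 1))).
have S1 : 0 < 2 * (S + 1) by rewrite mulr_gt0// ltr_wpDl.
have xi0 : 0 < xi by rewrite lt_min ltr01 divr_gt0.
have xi1 : xi <= 1 by rewrite ge_min lexx.
have xie : xi * (2 * (S + 1)) <= e by rewrite -ler_pdivlMr// ge_min lexx orbT.
have [m m0 hm] := @finite_lower_bound R layer (fun s => 0 < layer_rate s) layer_rate (fun s => id).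
(* Since [m] is a lower bound for the positive layer rates, this single factor is admissible for all
   active layers. *)
pose lam := expR (- (xi * (m * ln 2))).
have t0 : 0 < xi * (m * ln 2) by rewrite !mulr_gt0.
have lam1 : lam < 1 by rewrite -expR0 ltr_expR oppr_lt0.
exists (fun i j => (1 - xi) * ((1 - xi) * r i j)); split.
  apply: (@scaled_achievable xi lam xi0 (expR_gt0 _) lam1) => // s s0.
  by rewrite expRK opprK ler_pM2l// ler_pM2r// hm.
move=> p; set x := r _ _.
have x0 : 0 <= x by exact: r0.
have xS : x <= S by rewrite /S (bigD1 p)//= lerDl; apply: sumr_ge0 => p' _; exact: r0.
have -> : x - (1 - xi) * ((1 - xi) * x) = xi * ((2 - xi) * x) by ring.
rewrite ger0_norm; last by rewrite !mulr_ge0 ?subr_ge0// ?(ltW xi0)//; lra.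
apply: lt_le_trans xie; rewrite ltr_pM2l//.
have : xi * x >= 0 by rewrite mulr_ge0// ltW.
rewrite mulrBl; lra.
Qed.

End Scheme.

(** * From the stated constraints to the layer rates *)

Section ConstraintShapes.
Context {R : realType}.

Lemma single_layer_rate (r c p p' N I : R) : c = 1 -> 0 <= p -> p = p' -> 0 <= I -> 1 + I <= N ->
  r <= Ccap (p / N) -> r <= Num.max 0 (2^-1 * log2 (c^-1 + p' / (1 + I))).
Proof.
move=> -> p0 <- I0 IN; apply: Ccap_max; first by rewrite divr_ge0//; lra.
by rewrite ler_wpM2l// lef_pV2// posrE; lra.
Qed.

Lemma double_layer_rate (r c p p' N I : R) : c = 2 -> 0 <= p -> p = p' -> 0 <= I -> 1 + I <= N ->
  r <= Cplus (p / N - 2^-1) -> r <= Num.max 0 (2^-1 * log2 (c^-1 + p' / (1 + I))).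
Proof.
move=> -> p0 <- I0 IN; apply: Cplus_max; first by rewrite divr_ge0//; lra.
by rewrite ler_wpM2l// lef_pV2// posrE; lra.
Qed.

Lemma downlink_layer_rate (r c a b p D I0 I : R) : c = 1 -> 0 <= a -> a <= b -> 0 <= p -> 0 <= I0 ->
  D = 1 + a * I0 -> I = b * I0 -> r <= Ccap (a * p / D) ->
  r <= Num.max 0 (2^-1 * log2 (c^-1 + b * p / (1 + I))).
Proof.
move=> -> a0 ab p0 I0p -> -> h; have b0 := le_trans a0 ab.
apply: (@Ccap_max _ _ (b * p / (1 + b * I0))) => //.
  by rewrite divr_ge0 ?mulr_ge0// addr_ge0// mulr_ge0.
exact: le_trans h (Ccap_degraded a0 ab p0 I0p).
Qed.

Lemma interferenceZ (a : R) (m t : seq bool) (x : seq R) :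
  interference m t [seq a * y | y <- x] = a * interference m t x.
Proof.
elim: x m t => [|y x IH] [|b m] [|b' t]/=; rewrite ?mulr0// IH mulrDr; congr (_ + _).
by case: b; case: b'; rewrite ?mulr0// mulrCA.
Qed.

End ConstraintShapes.

Ltac evaluate t := let v := eval vm_compute in t in change t with v.

Section Instance.
Context {R : realType}.
Variables (a0 a1 a2 a3 a4 a5 a6 a7 a8 a9 a10 a11 a12 : R).
Definition by_layer (s : layer) : R :=
  match val s with
  | 0 => a0 | 1 => a1 | 2 => a2 | 3 => a3 | 4 => a4 | 5 => a5 | 6 => a6
  | 7 => a7 | 8 => a8 | 9 => a9 | 10 => a10 | 11 => a11 | _ => a12
  end.
End Instance.

Local Close Scope classical_set_scope.
Unset Implicit Arguments.

Theorem theorem1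
  (R : realType) (d : measure_display) (Omega : measurableType d)
  (Pr : probability Omega R) (z : node * nat -> Omega -> R)
  (Hz : iid_std_gaussian Pr z)
  (h1 h2 h3 P : R)
  (Hh : h2 ^+ 2 <= h1 ^+ 2 /\ h3 ^+ 2 <= h2 ^+ 2)
  (r12 r13 r21 r23 r31 r32 : R)
  (* rate splits *)
  (Rb12 Rb13 Rb21 Rb23 Rb31 Rb32 : R)
  (Rc12 Rc13 Rc21 Rc23 Rc31 Rc32 : R)
  (Ru12 Ru13 Ru21 Ru23 Ru31 Ru32 : R)
  (HRnn : (0 <= Rb12 /\ 0 <= Rb13 /\ 0 <= Rb21 /\ 0 <= Rb23 /\ 0 <= Rb31 /\ 0 <= Rb32) /\
          (0 <= Rc12 /\ 0 <= Rc13 /\ 0 <= Rc21 /\ 0 <= Rc23 /\ 0 <= Rc31 /\ 0 <= Rc32) /\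
          (0 <= Ru12 /\ 0 <= Ru13 /\ 0 <= Ru21 /\ 0 <= Ru23 /\ 0 <= Ru31 /\ 0 <= Ru32))
  (HRsum : (r12 = Rb12 + Rc12 + Ru12 /\ r13 = Rb13 + Rc13 + Ru13 /\
              r21 = Rb21 + Rc21 + Ru21 /\ r23 = Rb23 + Rc23 + Ru23 /\
              r31 = Rb31 + Rc31 + Ru31 /\ r32 = Rb32 + Rc32 + Ru32))
  (HRb : (Rb12 = Rb21 /\ Rb13 = Rb31 /\ Rb23 = Rb32))
  (* Rc12 = Rc23 = Rc31 =: R^c_123 ;  Rc13 = Rc32 = Rc21 =: R^c_132 *)
  (HRc : (Rc23 = Rc12 /\ Rc31 = Rc12 /\ Rc32 = Rc13 /\ Rc21 = Rc13))
  (* user powers *)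
  (Pb12 Pb13 Pb21 Pb23 Pb31 Pb32 : R)
  (Pc12 Pc13 Pc21 Pc23 Pc31 Pc32 : R)
  (Pu12 Pu13 Pu21 Pu23 Pu31 Pu32 : R)
  (Pt23 Pt13 : R)
  (* relay powers *)
  (Pru12 Pru13 Pru21 Pru23 Pru31 Pru32 : R)
  (Prc12 Prc31 Prc21 Prc32 Prb21 Prb31 Prb32 : R)
  (HPnn : (0 <= Pb12 /\ 0 <= Pb13 /\ 0 <= Pb21 /\ 0 <= Pb23 /\ 0 <= Pb31 /\ 0 <= Pb32) /\
          (0 <= Pc12 /\ 0 <= Pc13 /\ 0 <= Pc21 /\ 0 <= Pc23 /\ 0 <= Pc31 /\ 0 <= Pc32) /\
          (0 <= Pu12 /\ 0 <= Pu13 /\ 0 <= Pu21 /\ 0 <= Pu23 /\ 0 <= Pu31 /\ 0 <= Pu32) /\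
          0 <= Pt23 /\ 0 <= Pt13)
  (HPrnn : (0 <= Pru12 /\ 0 <= Pru13 /\ 0 <= Pru21 /\ 0 <= Pru23 /\ 0 <= Pru31 /\ 0 <= Pru32) /\
           (0 <= Prc12 /\ 0 <= Prc31 /\ 0 <= Prc21 /\ 0 <= Prc32 /\ 0 <= Prb21) /\
           0 <= Prb31 /\ 0 <= Prb32)
  (* alignment *)
  (Halign : (h1 ^+ 2 * Pb12 = h2 ^+ 2 * Pb21 /\ h1 ^+ 2 * Pb13 = h3 ^+ 2 * Pb31 /\
               h2 ^+ 2 * Pb23 = h3 ^+ 2 * Pb32 /\ h1 ^+ 2 * Pc12 = h2 ^+ 2 * Pc23
             /\ h2 ^+ 2 * Pt23 = h3 ^+ 2 * Pc31) /\
            h1 ^+ 2 * Pc13 = h3 ^+ 2 * Pc32 /\ h1 ^+ 2 * Pt13 = h2 ^+ 2 * Pc21) :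
  let P1 := Pb12 + Pb13 + Pc12 + Pc13 + Pt13 + Pu12 + Pu13 in
  let P2 := Pb21 + Pb23 + Pc21 + Pc23 + Pt23 + Pu21 + Pu23 in
  let P3 := Pb31 + Pb32 + Pc31 + Pc32 + Pu31 + Pu32 in
  let sigma2 := 1 + h3 ^+ 2 * (2 * Pb31 + 2 * Pb32 + 2 * Pc31 + 2 * Pc32 + Pu31 + Pu32) in
  let sr1 := 1 + h3 ^+ 2 * (Pru12 + Pru32 + Prc12 + Prc21 + Prb21 + Pru21 + Pru31) in
  let sr2 := 1 + h2 ^+ 2 * (Pru21 + Pru31) in
  (* user power constraints *)
  (P1 <= P /\ P2 <= P /\ P3 <= P) ->
  (* relay power constraint *)
  Pru12 + Pru13 + Pru21 + Pru23 + Pru31 + Pru32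
    + Prc12 + Prc31 + Prc21 + Prc32 + Prb21 + Prb31 + Prb32 <= P ->
  (* uplink rate constraints *)
  Ru12 <= Ccap (h1 ^+ 2 * Pu12 / (1 + h3 ^+ 2 * P3 + h2 ^+ 2 * P2 + h1 ^+ 2 * (P - Pu12))) ->
  Ru13 <= Ccap (h1 ^+ 2 * Pu13 / (1 + h3 ^+ 2 * P3 + h2 ^+ 2 * P2 + h1 ^+ 2 * (P - Pu12 - Pu13))) ->
  Ru21 <= Ccap (h2 ^+ 2 * Pu21 / (1 + h3 ^+ 2 * P3 + h2 ^+ 2 * (P2 - Pu21)
                                   + h1 ^+ 2 * (P - Pu12 - Pu13))) ->
  Ru23 <= Ccap (h2 ^+ 2 * Pu23 / (1 + h3 ^+ 2 * P3 + h2 ^+ 2 * (P2 - Pu21 - Pu23)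
                                   + h1 ^+ 2 * (P - Pu12 - Pu13))) ->
  Rc13 <= Cplus (h2 ^+ 2 * Pc21 / (sigma2 + 2 * h2 ^+ 2 * (Pb21 + Pc23)) - 2^-1) ->
  Rc12 <= Cplus (h2 ^+ 2 * Pc23 / (sigma2 + 2 * h2 ^+ 2 * Pb21) - 2^-1) ->
  Rb21 <= Cplus (h2 ^+ 2 * Pb21 / sigma2 - 2^-1) ->
  Ru31 <= Ccap (h3 ^+ 2 * Pu31 / (1 + h3 ^+ 2 * (2 * Pb32 + 2 * Pb31 + 2 * Pc31 + 2 * Pc32 + Pu32))) ->
  Ru32 <= Ccap (h3 ^+ 2 * Pu32 / (1 + 2 * h3 ^+ 2 * (Pb32 + Pb31 + Pc31 + Pc32))) ->
  Rc13 <= Cplus (h3 ^+ 2 * Pc32 / (1 + 2 * h3 ^+ 2 * (Pb32 + Pb31 + Pc31)) - 2^-1) ->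
  Rc12 <= Cplus (h3 ^+ 2 * Pc31 / (1 + 2 * h3 ^+ 2 * (Pb32 + Pb31)) - 2^-1) ->
  Rb31 <= Cplus (h3 ^+ 2 * Pb31 / (1 + 2 * h3 ^+ 2 * Pb32) - 2^-1) ->
  Rb32 <= Cplus (h3 ^+ 2 * Pb32 - 2^-1) ->
  (* downlink rate constraints *)
  Ru13 <= Ccap (h3 ^+ 2 * Pru13 / (sr1 + h3 ^+ 2 * (Pru23 + Prc32 + Prc31 + Prb31 + Prb32))) ->
  Ru23 <= Ccap (h3 ^+ 2 * Pru23 / (sr1 + h3 ^+ 2 * (Prc32 + Prc31 + Prb31 + Prb32))) ->
  Rc13 <= Ccap (h3 ^+ 2 * Prc32 / (sr1 + h3 ^+ 2 * (Prc31 + Prb31 + Prb32))) ->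
  Rc12 <= Ccap (h3 ^+ 2 * Prc31 / (sr1 + h3 ^+ 2 * (Prb31 + Prb32))) ->
  Rb31 <= Ccap (h3 ^+ 2 * Prb31 / (sr1 + h3 ^+ 2 * Prb32)) ->
  Rb32 <= Ccap (h3 ^+ 2 * Prb32 / sr1) ->
  Ru12 <= Ccap (h2 ^+ 2 * Pru12 / (sr2 + h2 ^+ 2 * (Pru32 + Prc12 + Prc21 + Prb21))) ->
  Ru32 <= Ccap (h2 ^+ 2 * Pru32 / (sr2 + h2 ^+ 2 * (Prc12 + Prc21 + Prb21))) ->
  Rc12 <= Ccap (h2 ^+ 2 * Prc12 / (sr2 + h2 ^+ 2 * (Prc21 + Prb21))) ->
  Rc13 <= Ccap (h2 ^+ 2 * Prc21 / (sr2 + h2 ^+ 2 * Prb21)) ->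
  Rb21 <= Ccap (h2 ^+ 2 * Prb21 / sr2) ->
  Ru21 <= Ccap (h1 ^+ 2 * Pru21 / (1 + h1 ^+ 2 * Pru31)) ->
  Ru31 <= Ccap (h1 ^+ 2 * Pru31) ->
  cap_region Pr z (gains h1 h2 h3) P (rates6 r12 r13 r21 r23 r31 r32).
Proof.
move=> P1 P2 P3 sigma2 sr1 sr2 [hP1 [hP2 hP3]] hPr.
move=> u0 u1 u2 u3 u4 u5 u6 u7 u8 u9 u10 u11 u12.
move=> e1 e3 e9 e10 e11 e12 e0 e8 e5 e4 e6 e2 e7.
case: Hh => h21 h32.
move: HRnn => [[? [? [? [? [? ?]]]]] [[? [? [? [? [? ?]]]]] [? [? [? [? [? ?]]]]]]].
move: HRsum => [s12 [s13 [s21 [s23 [s31 s32]]]]].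
move: HRb => [b12 [b13 b23]]; move: HRc => [c23 [c31 [c32 c21]]].
move: HPnn => [[? [? [? [? [? ?]]]]] [[? [? [? [? [? ?]]]]] [[? [? [? [? [? ?]]]]] [? ?]]]].
move: HPrnn => [[? [? [? [? [? ?]]]]] [[? [? [? [? ?]]]] [? ?]]].
move: Halign => [[al6 [al11 [al12 [al5 al10]]]] [al9 al4]].
have P_ge0 : 0 <= P by apply: le_trans hP1; rewrite /P1 !addr_ge0.
(* Powers of the first and the second signal of each layer. The cyclic parts from [U1] to [U3] and
   from [U2] to [U3] are sent in two layers each, which is where [Pt13] and [Pt23] enter. *)
pose pf := by_layer Pu12 Pu13 Pu21 Pu23 Pt13 Pc12 Pb12 Pu31 Pu32 Pc13 Pc31 Pb13 Pb23.
pose pt := by_layer Pu12 Pu13 Pu21 Pu23 Pc21 Pc23 Pb21 Pu31 Pu32 Pc32 Pt23 Pb31 Pb32.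
pose pw s (i : bool) := if i then pt s else pf s.
pose pr := by_layer Pru12 Pru13 Pru21 Pru23 Prc21 Prc12 Prb21 Pru31 Pru32 Prc32 Prc31 Prb31 Prb32.
pose rt (p : pair3) (k : nat) := match k with
  | 0 => rates6 Rb12 Rb13 Rb21 Rb23 Rb31 Rb32 (val p).1 (val p).2
  | 1 => rates6 Rc12 Rc13 Rc21 Rc23 Rc31 Rc32 (val p).1 (val p).2
  | _ => rates6 Ru12 Ru13 Ru21 Ru23 Ru31 Ru32 (val p).1 (val p).2 end.
have m1 x : 0 <= x -> 0 <= h1 ^+ 2 * x by move=> x0; rewrite mulr_ge0 ?sqr_ge0.
have m2 x : 0 <= x -> 0 <= h2 ^+ 2 * x by move=> x0; rewrite mulr_ge0 ?sqr_ge0.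
have m3 x : 0 <= x -> 0 <= h3 ^+ 2 * x by move=> x0; rewrite mulr_ge0 ?sqr_ge0.
have pf0 s : 0 <= pf s by move: s; apply: layer_ind.
have pt0 s : 0 <= pt s by move: s; apply: layer_ind.
have pr0 s : 0 <= pr s by move: s; apply: layer_ind.
pose h := gains h1 h2 h3.
have rxE : [seq received h pw s | s <- layers] =
  [:: h1 ^+ 2 * Pu12; h1 ^+ 2 * Pu13; h2 ^+ 2 * Pu21; h2 ^+ 2 * Pu23; h1 ^+ 2 * Pt13; h1 ^+ 2 * Pc12;
   h1 ^+ 2 * Pb12; h3 ^+ 2 * Pu31; h3 ^+ 2 * Pu32; h1 ^+ 2 * Pc13; h3 ^+ 2 * Pc31; h1 ^+ 2 * Pb13; h2 ^+ 2 * Pb23].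
  by [].
have int0 s := interference_uplink_ge0 h (pw := pw) (fun s i => if i return 0 <= pw s i then pt0 s else pf0 s) s.
have c1 s : two s = false -> copies two s = 1 :> R by rewrite /copies => ->; rewrite addr0.
have c2 s : two s -> copies two s = 2 :> R by rewrite /copies => ->.
have up s : layer_rate rt s <= Num.max 0 (2^-1 * log2 ((copies two s)^-1 + received h pw s /
    (1 + interference (later layers s) (flags two) [seq received h pw s' | s' <- layers]))).
  (* The first four uplink constraints contain [P] where the interference has [P1]; this is their
     slack. *)
  have hm1 : 0 <= h1 ^+ 2 * (P - P1) by apply: m1; rewrite subr_ge0.
  rewrite -b12 in u6; rewrite -c31 in u10; rewrite -b13 in u11; rewrite -b23 in u12.
  rewrite -[_ * Pb32]divr1 in u12.
  move: (int0 s); move: s; rewrite rxE; evaluate (flags two); apply: layer_ind => I0.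
  - rewrite -[received h pw 'L_0]/(h1 ^+ 2 * Pu12) -[layer_rate rt 'L_0]/Ru12.
    apply: (single_layer_rate (c1 'L_0 erefl) _ erefl I0 _ u0); first by rewrite m1.
    evaluate (later layers 'L_0); rewrite /= /P3 /P2; rewrite /P1 in hm1; clear -hm1 al4 al5 al6 al9 al10 al11 al12; lra.
  - rewrite -[received h pw 'L_1]/(h1 ^+ 2 * Pu13) -[layer_rate rt 'L_1]/Ru13.
    apply: (single_layer_rate (c1 'L_1 erefl) _ erefl I0 _ u1); first by rewrite m1.
    evaluate (later layers 'L_1); rewrite /= /P3 /P2; rewrite /P1 in hm1; clear -hm1 al4 al5 al6 al9 al10 al11 al12; lra.
  - rewrite -[received h pw 'L_2]/(h2 ^+ 2 * Pu21) -[layer_rate rt 'L_2]/Ru21.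
    apply: (single_layer_rate (c1 'L_2 erefl) _ erefl I0 _ u2); first by rewrite m2.
    evaluate (later layers 'L_2); rewrite /= /P3 /P2; rewrite /P1 in hm1; clear -hm1 al4 al5 al6 al9 al10 al11 al12; lra.
  - rewrite -[received h pw 'L_3]/(h2 ^+ 2 * Pu23) -[layer_rate rt 'L_3]/Ru23.
    apply: (single_layer_rate (c1 'L_3 erefl) _ erefl I0 _ u3); first by rewrite m2.
    evaluate (later layers 'L_3); rewrite /= /P3 /P2; rewrite /P1 in hm1; clear -hm1 al4 al5 al6 al9 al10 al11 al12; lra.
  - rewrite -[received h pw 'L_4]/(h1 ^+ 2 * Pt13) -[layer_rate rt 'L_4]/Rc13.
    apply: (double_layer_rate (c2 'L_4 isT) _ (esym al4) I0 _ u4); first by rewrite m2.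
    evaluate (later layers 'L_4); rewrite /= /sigma2; clear -al5 al6 al9 al10 al11 al12; lra.
  - rewrite -[received h pw 'L_5]/(h1 ^+ 2 * Pc12) -[layer_rate rt 'L_5]/Rc12.
    apply: (double_layer_rate (c2 'L_5 isT) _ (esym al5) I0 _ u5); first by rewrite m2.
    evaluate (later layers 'L_5); rewrite /= /sigma2; clear -al6 al9 al10 al11 al12; lra.
  - rewrite -[received h pw 'L_6]/(h1 ^+ 2 * Pb12) -[layer_rate rt 'L_6]/Rb12.
    apply: (double_layer_rate (c2 'L_6 isT) _ (esym al6) I0 _ u6); first by rewrite m2.
    evaluate (later layers 'L_6); rewrite /= /sigma2; clear -al9 al10 al11 al12; lra.
  - rewrite -[received h pw 'L_7]/(h3 ^+ 2 * Pu31) -[layer_rate rt 'L_7]/Ru31.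
    apply: (single_layer_rate (c1 'L_7 erefl) _ erefl I0 _ u7); first by rewrite m3.
    evaluate (later layers 'L_7); rewrite /=; clear -al9 al10 al11 al12; lra.
  - rewrite -[received h pw 'L_8]/(h3 ^+ 2 * Pu32) -[layer_rate rt 'L_8]/Ru32.
    apply: (single_layer_rate (c1 'L_8 erefl) _ erefl I0 _ u8); first by rewrite m3.
    evaluate (later layers 'L_8); rewrite /=; clear -al9 al10 al11 al12; lra.
  - rewrite -[received h pw 'L_9]/(h1 ^+ 2 * Pc13) -[layer_rate rt 'L_9]/Rc13.
    apply: (double_layer_rate (c2 'L_9 isT) _ (esym al9) I0 _ u9); first by rewrite m3.
    evaluate (later layers 'L_9); rewrite /=; clear -al10 al11 al12; lra.
  - rewrite -[received h pw 'L_10]/(h3 ^+ 2 * Pc31) -[layer_rate rt 'L_10]/Rc31.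
    apply: (double_layer_rate (c2 'L_10 isT) _ erefl I0 _ u10); first by rewrite m3.
    evaluate (later layers 'L_10); rewrite /=; clear -al11 al12; lra.
  - rewrite -[received h pw 'L_11]/(h1 ^+ 2 * Pb13) -[layer_rate rt 'L_11]/Rb13.
    apply: (double_layer_rate (c2 'L_11 isT) _ (esym al11) I0 _ u11); first by rewrite m3.
    evaluate (later layers 'L_11); rewrite /=; clear -al12; lra.
  - rewrite -[received h pw 'L_12]/(h2 ^+ 2 * Pb23) -[layer_rate rt 'L_12]/Rb23.
    apply: (double_layer_rate (c2 'L_12 isT) _ (esym al12) I0 _ u12); first by rewrite m3.
    evaluate (later layers 'L_12); rewrite /=; clear; lra.
(* Downlink interference before multiplication by the squared gain: it is the same for all users
   that decode the layer. *)
pose base s := interference (later (downlink_order U1) s) (flags (fun=> false)) [seq pr s' | s' <- layers].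
have base0 s : 0 <= base s by apply: interference_ge0 => y /mapP[s' _ ->].
(* A layer is decoded by its weakest intended receiver and by all stronger users. *)
pose weakest (s : layer) : R := by_layer (h2 ^+ 2) (h3 ^+ 2) (h1 ^+ 2) (h3 ^+ 2) (h2 ^+ 2) (h2 ^+ 2) (h2 ^+ 2)
  (h1 ^+ 2) (h2 ^+ 2) (h3 ^+ 2) (h3 ^+ 2) (h3 ^+ 2) (h3 ^+ 2) s.
have weakest0 s : 0 <= weakest s by move: s; apply: layer_ind; exact: sqr_ge0.
have weakestP j s : s \in downlink_order j -> weakest s <= h j ^+ 2.
  have h31 := le_trans h32 h21.
  by case: j => [[|[|[|//]]] j3]; move: s; apply: layer_ind.
have prE : [seq pr s' | s' <- layers] = [:: Pru12; Pru13; Pru21; Pru23; Prc21; Prc12; Prb21; Pru31; Pru32;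
   Prc32; Prc31; Prb31; Prb32] by [].
have down s : layer_rate rt s <= Ccap (weakest s * pr s / (1 + weakest s * base s)).
  rewrite -b12 in e6; rewrite -c31 in e10; rewrite -b13 in e11; rewrite -b23 in e12.
  rewrite -[_ * Pru31]divr1 in e7.
  rewrite /base prE; evaluate (flags (fun=> false)); move: s; apply: layer_ind.
  - evaluate (later (downlink_order U1) 'L_0); apply: (le_trans e0); rewrite le_eqVlt; apply/orP; left; apply/eqP.
    congr (Ccap (_ / _)); rewrite /sr2 /weakest /by_layer /=; ring.
  - evaluate (later (downlink_order U1) 'L_1); apply: (le_trans e1); rewrite le_eqVlt; apply/orP; left; apply/eqP.
    congr (Ccap (_ / _)); rewrite /sr1 /weakest /by_layer /=; ring.
  - evaluate (later (downlink_order U1) 'L_2); apply: (le_trans e2); rewrite le_eqVlt; apply/orP; left; apply/eqP.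
    congr (Ccap (_ / _)); rewrite /weakest /by_layer /=; ring.
  - evaluate (later (downlink_order U1) 'L_3); apply: (le_trans e3); rewrite le_eqVlt; apply/orP; left; apply/eqP.
    congr (Ccap (_ / _)); rewrite /sr1 /weakest /by_layer /=; ring.
  - evaluate (later (downlink_order U1) 'L_4); apply: (le_trans e4); rewrite le_eqVlt; apply/orP; left; apply/eqP.
    congr (Ccap (_ / _)); rewrite /sr2 /weakest /by_layer /=; ring.
  - evaluate (later (downlink_order U1) 'L_5); apply: (le_trans e5); rewrite le_eqVlt; apply/orP; left; apply/eqP.
    congr (Ccap (_ / _)); rewrite /sr2 /weakest /by_layer /=; ring.
  - evaluate (later (downlink_order U1) 'L_6); apply: (le_trans e6); rewrite le_eqVlt; apply/orP; left; apply/eqP.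
    congr (Ccap (_ / _)); rewrite /sr2 /weakest /by_layer /=; ring.
  - evaluate (later (downlink_order U1) 'L_7); apply: (le_trans e7); rewrite le_eqVlt; apply/orP; left; apply/eqP.
    congr (Ccap (_ / _)); rewrite /weakest /by_layer /=; ring.
  - evaluate (later (downlink_order U1) 'L_8); apply: (le_trans e8); rewrite le_eqVlt; apply/orP; left; apply/eqP.
    congr (Ccap (_ / _)); rewrite /sr2 /weakest /by_layer /=; ring.
  - evaluate (later (downlink_order U1) 'L_9); apply: (le_trans e9); rewrite le_eqVlt; apply/orP; left; apply/eqP.
    congr (Ccap (_ / _)); rewrite /sr1 /weakest /by_layer /=; ring.
  - evaluate (later (downlink_order U1) 'L_10); apply: (le_trans e10); rewrite le_eqVlt; apply/orP; left; apply/eqP.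
    congr (Ccap (_ / _)); rewrite /sr1 /weakest /by_layer /=; ring.
  - evaluate (later (downlink_order U1) 'L_11); apply: (le_trans e11); rewrite le_eqVlt; apply/orP; left; apply/eqP.
    congr (Ccap (_ / _)); rewrite /sr1 /weakest /by_layer /=; ring.
  - evaluate (later (downlink_order U1) 'L_12); apply: (le_trans e12); rewrite le_eqVlt; apply/orP; left; apply/eqP.
    congr (Ccap (_ / _)); rewrite /sr1 /weakest /by_layer /=; ring.
(* The order of each user is a prefix of that of [U1], and the layers it does not decode count as
   later ones. *)
have laterE j s : s \in downlink_order j -> later (downlink_order j) s = later (downlink_order U1) s.
  by case: j => [[|[|[|//]]] j3]; move: s; apply: layer_ind; vm_compute.
apply: (@scheme_in_capacity R d Omega Pr h z P Hz P_ge0 pw pr rt) => //.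
- by move=> p [|[|k]]; move: p; apply: pair3_ind.
- by apply: layer_ind => // _; rewrite /rt /rates6 /= ?c21 ?c23 ?b12 ?c32 ?c31 ?b13 ?b23.
- by move=> s []; [exact: pt0|exact: pf0].
- by apply: layer_ind => // _.
- have sumE k : \sum_s \sum_i (tx s i == k)%:R * (~~ i || two s)%:R * pw s i
     = \sum_(s <- layers) ((tx s true == k)%:R * (two s)%:R * pt s + (tx s false == k)%:R * pf s).
    by rewrite sum_layers; apply: eq_bigr => s _; rewrite big_bool /= mulr1.
  case=> [[|[|[|//]]] j3]; rewrite sumE /layers !big_cons big_nil;
    repeat (match goal with |- context [tx ?s ?i == ?k] => evaluate (tx s i == k) end);
    repeat (match goal with |- context [two ?s] => evaluate (two s) end);
    move: hP1 hP2 hP3; rewrite /pt /pf /by_layer /P1 /P2 /P3 /=; clear => ? ? ?; lra.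
- by move: hPr; rewrite sum_layers /layers !big_cons big_nil /pr /by_layer /=; clear => ?; lra.
- move=> j s sj; rewrite (laterE j s sj).
  apply: (@downlink_layer_rate _ _ _ (weakest s) _ _ _ (base s) _ _ _ _ _ _ erefl _ (down s)) => //.
  + by rewrite /copies addr0.
  + exact: weakestP.
  + rewrite /base -interferenceZ; congr interference; rewrite -map_comp; exact: eq_map.
- by apply: pair3_ind; rewrite /rates6 /rt /rates6 /=.
Qed.
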